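(* Let $f:\mathbb R^2\to\mathbb C$ be a source function with compact support $\Omega=\bigcup_{m=1}^M\Omega_m$ such that $(f,\Omega)$ satisfies the source assumption stated in the context. Let $\Theta_L=\{\hat x_1,\dots,\hat x_L\}\subset\mathbb S^1$ be a set of $L$ directions no two of which are collinear, and let $0<k_{\min}<k_{\max}$. If every $\Omega_m$ is a simply connected polygon, $P_1,\dots,P_N$ are all the corners of $\partial\Omega$, and $$L>2N-1,$$ then all the corners $P_1,P_2,\dots,P_N$ can be uniquely determined by the far field patterns $\{u^\infty(\pm\hat x,k):\hat x\in\Theta_L,\ k\in(k_{\min},k_{\max})\}$.
   Context: Notation. $\mathbb S^1=\{x\in\mathbb R^2:|x|=1\}$; for $\hat x\in\mathbb S^1$, $\hat x^\perp$ is $\hat x$ rotated anticlockwise by $\pi/2$; $l_{\hat x,s}:=\{y\in\mathbb R^2:\hat x\cdot y=s\}$. A point $y\in\partial\Omega$ is a corner if the unit normal to $\partial\Omega$ is not continuous at $y$. Source assumption on $(f,\Omega)$, where $\Omega=\operatorname{supp} f$ is compact: (i) $\Omega=\bigcup_{m=1}^M\Omega_m$ where the $\Omega_m$ are compact and pairwise disjoint; each boundary $\partial\Omega_m$ is piecewise $C^1$ with finitely many corners, and the interior of each $\Omega_m$ is a connected domain. (ii) For any $\hat x\in\mathbb S^1$ and any $s\in\mathbb R$ there exist $J(s)<\infty$ and numbers $\alpha_j(s),\beta_j(s)$ with $\beta_j(s)\le\alpha_j(s)$ for $j=1,\dots,J(s)$, $\alpha_j(s)\le\beta_{j+1}(s)$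 for $j=1,\dots,J(s)-1$, and $l_{\hat x,s}\cap\Omega=\bigcup_{j=1}^{J(s)}\{s\hat x+\tau\hat x^\perp:\beta_j(s)\le\tau\le\alpha_j(s)\}$. (iii) $f|_{\Omega_m}\in C^1(\Omega_m)$ for $m=1,\dots,M$, and $f(y)\ne0$ for all $y\in\partial\Omega$. Far field pattern: $u^\infty(\hat x,k)=\int_{\mathbb R^2}e^{-ik\hat x\cdot y}f(y)\,dy$ for $\hat x\in\mathbb S^1$, $k>0$ (the far field pattern of the radiating solution of $\Delta u+k^2u=-f$ in $\mathbb R^2$). ''Uniquely determined'' means: if two sources both satisfy all the hypotheses of the theorem (for the same $\Theta_L,k_{\min},k_{\max}$) and have the same far field patterns $u^\infty(\pm\hat x,k)$ for all $\hat x\in\Theta_L$, $k\in(k_{\min},k_{\max})$, then their sets of corners coincide. *)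

(* Defs.v *)
From mathcomp Require Import all_boot all_order all_algebra.
From mathcomp Require Import all_classical all_reals all_analysis.
From mathcomp.real_closed Require Import complex.

Set Implicit Arguments.
Unset Strict Implicit.
Unset Printing Implicit Defensive.

Import Order.TTheory GRing.Theory Num.Theory.
Import numFieldNormedType.Exports.

Local Open Scope classical_set_scope.
Local Open Scope ring_scope.
Local Open Scope complex_scope.

(* The library norm on R * R is the max norm, so the Euclidean structure is
   introduced by hand. *)
Definition edot (R : realType) (x y : R * R) : R := x.1 * y.1 + x.2 * y.2.

Definition enorm (R : realType) (x : R * R) : R := Num.sqrt (edot x x).

Definition unit_circle (R : realType) : set (R * R) := [set x | enorm x = 1].

Definition rot90 (R : realType) (x : R * R) : R * R := (- x.2, x.1).

Definition line (R : realType) (x : R * R) (s : R) : set (R * R) :=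
  [set y | edot x y = s].

(* Only used for nonzero vectors. *)
Definition collinear (R : realType) (x y : R * R) : Prop :=
  exists c : R, y = c *: x.

Definition segment (R : realType) (a b : R * R) : set (R * R) :=
  [set a + t *: (b - a) | t in `[0, 1]%classic].

Definition boundary (T : topologicalType) (A : set T) : set T :=
  closure A `\` A°.

(* n is the outward unit normal of A at y: up to an angular error that vanishes
   at y, A agrees near y with the half-plane { z | n . (z - y) <= 0 }. *)
Definition unit_normal (R : realType) (A : set (R * R)) (y n : R * R) : Prop :=
  enorm n = 1 /\
  forall e : R, 0 < e -> \forall z \near y,
    (edot n (z - y) < - e * enorm (z - y) -> A z) /\
    (e * enorm (z - y) < edot n (z - y) -> ~ A z).

(* The unit normal exists at every boundary point near y, y included, and is
   continuous at y as a function on the boundary. *)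
Definition normal_continuous_at (R : realType) (A : set (R * R)) (y : R * R)
  : Prop :=
  exists nu : R * R -> R * R,
    (\forall z \near y, boundary A z -> unit_normal A z (nu z)) /\
    nu z @[z --> within (boundary A) (nbhs y)] --> nu y.

Definition corners (R : realType) (A : set (R * R)) : set (R * R) :=
  [set y | boundary A y /\ ~ normal_continuous_at A y].

(* A regular parametrisation that is C^1 on [0, 1] extends to a C^1 map on R,
   so g may be taken C^1 on the whole line. *)
Definition C1_arc (R : realType) (g : R -> R * R) : Prop :=
  [/\ forall t, derivable g t 1,
      continuous (derive1 g),
      forall t, t \in `[0, 1] -> derive1 g t != 0 &
      {in `[0, 1] &, injective g}].

Definition piecewise_C1 (R : realType) (C : set (R * R)) : Prop :=
  exists (n : nat) (g : 'I_n -> R -> R * R),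
    [/\ forall i, C1_arc (g i),
        C = \bigcup_i (g i @` `[0, 1]) &
        forall i j s t, i != j -> s \in `[0, 1] -> t \in `[0, 1] ->
          g i s = g j t -> (s = 0 \/ s = 1) /\ (t = 0 \/ t = 1)].

(* h is C^1 on the closed set A: h is continuous on A, and its partial
   derivatives exist in the interior and extend continuously to A. *)
Definition C1_on (R : realType) (A : set (R * R)) (h : R * R -> R) : Prop :=
  exists h1 h2 : R * R -> R,
    [/\ {within A, continuous h},
        {within A, continuous h1},
        {within A, continuous h2} &
        forall y, A° y ->
          is_derive y ((1, 0) : R * R) h (h1 y) /\
          is_derive y ((0, 1) : R * R) h (h2 y)].

Definition supp (R : realType) (f : R * R -> R[i]) : set (R * R) :=
  closure [set y | f y != 0].

Definition source_assumption (R : realType) (f : R * R -> R[i]) (M : nat)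
    (Omega : 'I_M -> set (R * R)) : Prop :=
  compact (supp f) /\
  [/\ supp f = \bigcup_m Omega m,
      forall m, compact (Omega m),
      forall m m', m != m' -> Omega m `&` Omega m' = set0,
      forall m, piecewise_C1 (boundary (Omega m)) /\
                finite_set (corners (Omega m)) &
      forall m, (Omega m)° !=set0 /\ connected (Omega m)°] /\
  (forall (x : R * R) (s : R), unit_circle x ->
     exists (J : nat) (alpha beta : 'I_J -> R),
       [/\ forall j, beta j <= alpha j,
           forall i j : 'I_J, j = i.+1 :> nat -> alpha i <= beta j &
           line x s `&` supp f =
           \bigcup_j [set s *: x + tau *: rot90 x
                     | tau in `[beta j, alpha j]%classic]]) /\
  [/\ forall m, C1_on (Omega m) (fun y => complex.Re (f y)),
      forall m, C1_on (Omega m) (fun y => complex.Im (f y)) &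
      forall y, boundary (supp f) y -> f y != 0].

(* Two edges may only meet in a common endpoint; as v is injective, only cyclic
   neighbours do. *)
Definition simple_closed_polygonal_curve (R : realType) (C : set (R * R))
  : Prop :=
  exists (n : nat) (v : 'I_n -> R * R),
    let edge i := segment (v i) (v (ordS i)) in
    let ends i := [set v i; v (ordS i)] in
    [/\ (3 <= n)%N,
        injective v,
        forall i j, i != j -> edge i `&` edge j `<=` ends i `&` ends j &
        C = \bigcup_i edge i].

(* Holes are allowed here; they are excluded by simple connectedness. *)
Definition polygon (R : realType) (A : set (R * R)) : Prop :=
  [/\ compact A, A = closure A°, connected A° &
      exists (K : nat) (C : 'I_K -> set (R * R)),
        [/\ forall k, simple_closed_polygonal_curve (C k),
            forall k l, k != l -> C k `&` C l = set0 &
            boundary A = \bigcup_k C k]].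

Definition path_connected (R : realType) (A : set (R * R)) : Prop :=
  A !=set0 /\
  forall a b, A a -> A b -> exists g : R -> R * R,
    [/\ {within `[0, 1], continuous g}, g @` `[0, 1] `<=` A,
        g 0 = a & g 1 = b].

Definition null_homotopic_loops (R : realType) (A : set (R * R)) : Prop :=
  forall g : R -> R * R,
    {within `[0, 1], continuous g} -> g @` `[0, 1] `<=` A -> g 0 = g 1 ->
    exists H : R * R -> R * R,
      [/\ {within `[0, 1] `*` `[0, 1], continuous H},
          H @` (`[0, 1] `*` `[0, 1]) `<=` A,
          forall t, t \in `[0, 1] -> H (0, t) = g t /\ H (1, t) = g 0 &
          forall s, s \in `[0, 1] -> H (s, 0) = g 0 /\ H (s, 1) = g 0].

Definition simply_connected (R : realType) (A : set (R * R)) : Prop :=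
  path_connected A /\ null_homotopic_loops A.

(* e^{- i t} *)
Definition expiN (R : realType) (t : R) : R[i] := cos t -i* sin t.

Definition lebesgue2 (R : realType) :=
  ((@lebesgue_measure R) \x (@lebesgue_measure R))%E.

Definition Cintegral (R : realType) (g : R * R -> R[i]) : R[i] :=
  Rintegral (@lebesgue2 R) setT (fun y => complex.Re (g y)) +i*
  Rintegral (@lebesgue2 R) setT (fun y => complex.Im (g y)).

Definition far_field (R : realType) (f : R * R -> R[i]) (x : R * R) (k : R)
  : R[i] :=
  Cintegral (fun y => expiN (k * edot x y) * f y).

(* Main.v *)
(* Let g be the real or imaginary part of f and H(s) its integral over the line
   x . y = s.  The far field at x and -x for k in an interval gives the sine and
   cosine transforms of H on that interval; differentiating in k they vanish
   after multiplication by any polynomial, so the difference of the H's of two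
   sources with equal data integrates to zero, against cos(k(s - s0)),
   over every interval around s0.  Hence the symmetric second difference of that difference
   at s0 has no term J|s|.
   For a single source with polygonal components, the second difference
   H(s0+s) + H(s0-s) - 2H(s0) is o(s) as soon as the line contains no corner,
   since a straight edge crossing the line contributes linearly in s and an edge
   lying in the line would end at corners.  If the line contains exactly one
   corner P, it is J s + o(s), where J is f(P) times a nonzero number depending
   on the two edges at P.
   If P is a corner of the first source only, each of the at most N1 + N2 - 1
   other corners lies on the line through P for at most one direction, so
   L >= N1 + N2 leaves a direction for which P is the only corner on that line,
   a contradiction. *)

(* Neither Fourier inversion nor analytic continuation in [k] occurs: once polynomial multipliers
   are available, one frequency [k] of the interval suffices. Localisation uses the explicit
   polynomials [(1 - p^n)^(K^n)], which on the bounded support of [H] stay in [0, 1] and tend to the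
   indicator of an interval. Near [u = 0] the weight [cos (k u)] is positive, while an even part
   [A + J |u| + o(u)] with [J] nonzero has a constant sign there, that of [A], or of [J] if [A = 0].
   So [H] may be discontinuous, and nothing has to be known about [H s0]. The obstacle on the
   geometric side is that [f] jumps across the boundary, so points at distance [O(s)] from it escape
   any use of derivatives of [f]. For a transversal line they fill windows of width [O(s)]. There
   continuity alone allows [f] to be replaced, up to [o(s)] after integration, by a constant times
   the indicator of the domain, whose slices are computed exactly. Elsewhere the bound [o(s)] has to
   be uniform along the line, hence the uniform continuity of the derivatives. *)
Require Import Defs.
From mathcomp Require Import all_boot all_order all_algebra.
From mathcomp Require Import all_classical all_reals all_analysis.
From mathcomp Require Import measurable_realfun.
From mathcomp Require Import zify ring lra.
From mathcomp.real_closed Require Import complex.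

Set Implicit Arguments.
Unset Strict Implicit.
Unset Printing Implicit Defensive.

Import Order.TTheory GRing.Theory Num.Theory.
Import numFieldNormedType.Exports.

Local Open Scope classical_set_scope.
Local Open Scope ring_scope.
Local Open Scope complex_scope.

(** * Fourier data on an interval *)

Section line_moments.
Context {R : realType}.
Local Notation mu := (@lebesgue_measure R).
Implicit Types (f g u v H : R -> R).

(** One constant bounds both the values and the support, so a single witness passes through sums and
    products. *)
Definition bounded_support f := measurable_fun setT f /\
  exists C : R, forall s, `|f s| <= C /\ (C < `|s| -> f s = 0).

Definition locally_bounded u := measurable_fun setT u /\
  forall B : R, exists C : R, forall s, `|s| <= B -> `|u s| <= C.

Lemma bounded_support_integrable f : bounded_support f ->
  mu.-integrable setT (EFin \o f).
Proof.
move=> [mf [C fC]].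
rewrite (_ : EFin \o f = (EFin \o f) \_ `[-C, C]%classic).
  apply: (integrable_mkcond (mu := mu) (D :=
    `[-C, C]%classic) (EFin \o f) _).1 => //.
  apply: (@measurable_bounded_integrable _ _ _ mu f `[-C, C]%classic) => //.
  - by rewrite /= lebesgue_measure_itv/=; case: ifP => //= _;
    rewrite -EFinB ltry.
  - exact: measurable_funTS.
  - by exists C; split; [exact: num_real|move=> x Cx y _ /=;
    rewrite (le_trans (fC y).1)// ltW].
apply/funext => s; rewrite patchE; case: ifPn => // /negP sC.
rewrite /= (fC s).2// ltNge; apply/negP => sC'; apply: sC; rewrite inE /=.
by rewrite in_itv /= -ler_norml.
Qed.

Lemma bounded_supportM u f : locally_bounded u -> bounded_support f ->
  bounded_support (fun s => u s * f s).
Proof.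
move=> [mu_ bu] [mf [C fC]]; split; first exact: measurable_funM.
have [D uD] := bu C.
have C0 : 0 <= C by apply: le_trans (fC 0).1.
exists (Num.max C (D * C)) => s; split; last first.
  by rewrite gt_max => /andP[Cs _]; rewrite (fC s).2// mulr0.
have [sC|sC] := leP `|s| C.
  by rewrite normrM le_max; apply/orP; right; rewrite ler_pM// ?uD// (fC s).1.
by rewrite (fC s).2// mulr0 normr0 le_max C0.
Qed.

Lemma bounded_supportD f g : bounded_support f -> bounded_support g ->
  bounded_support (fun s => f s + g s).
Proof.
move=> [mf [C fC]] [mg [D gD]]; split; first exact: measurable_funD.
have C0 : 0 <= C by apply: le_trans (fC 0).1.
have D0 : 0 <= D by apply: le_trans (gD 0).1.
exists (C + D) => s; split.
  by rewrite (le_trans (ler_normD _ _))// lerD ?(fC s).1 ?(gD s).1.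
by move=> CDs; rewrite (fC s).2 ?(gD s).2 ?addr0//; lra.
Qed.

Lemma locally_bounded_cst (c : R) : locally_bounded (fun=> c).
Proof. by split; [exact: measurable_cst|move=> B; exists `|c|]. Qed.

Lemma locally_bounded_id : locally_bounded id.
Proof. by split; [exact: measurable_id|move=> B; exists B]. Qed.

Lemma locally_boundedM u v : locally_bounded u -> locally_bounded v ->
  locally_bounded (fun s => u s * v s).
Proof.
move=> [mu_ bu] [mv bv]; split; first exact: measurable_funM.
move=> B; have [C uC] := bu B; have [D vD] := bv B; exists (C * D) => s sB.
by rewrite normrM ler_pM// ?uC ?vD.
Qed.

Lemma locally_boundedD u v : locally_bounded u -> locally_bounded v ->
  locally_bounded (fun s => u s + v s).
Proof.
move=> [mu_ bu] [mv bv]; split; first exact: measurable_funD.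
move=> B; have [C uC] := bu B; have [D vD] := bv B; exists (C + D) => s sB.
by rewrite (le_trans (ler_normD _ _))// lerD ?uC ?vD.
Qed.

Lemma locally_bounded_cos (k c : R)
  : locally_bounded (fun s => cos (k * s + c)).
Proof.
split; last by move=> B; exists 1 => s _; rewrite ler_norml cos_geN1 cos_le1.
apply: continuous_measurable_fun => s.
apply: (@continuous_comp _ _ _ (fun s => k * s + c) cos);
  last exact: continuous_cos.
by apply: cvgD; [apply: cvgM; [exact: cvg_cst|exact: cvg_id]|exact: cvg_cst].
Qed.

Lemma locally_bounded_sin (k c : R)
  : locally_bounded (fun s => sin (k * s + c)).
Proof.
split; last by move=> B; exists 1 => s _; rewrite ler_norml sin_geN1 sin_le1.
apply: continuous_measurable_fun => s.
apply: (@continuous_comp _ _ _ (fun s => k * s + c) sin);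
  last exact: continuous_sin.
by apply: cvgD; [apply: cvgM; [exact: cvg_cst|exact: cvg_id]|exact: cvg_cst].
Qed.

Definition Int f : R := Rintegral mu setT f.

Lemma IntD f g : bounded_support f -> bounded_support g ->
  Int (fun s => f s + g s) = Int f + Int g.
Proof. by move=> /bounded_support_integrable ? /bounded_support_integrable ?;
  exact: RintegralD. Qed.

Lemma IntZ (c : R) f : bounded_support f -> Int (fun s => c * f s) = c * Int f.
Proof. by move=> /bounded_support_integrable ?; exact: RintegralZl. Qed.

Lemma ler_Int f g : bounded_support f -> bounded_support g ->
  (forall s, f s <= g s) -> Int f <= Int g.
Proof. by move=> /bounded_support_integrable ? /bounded_support_integrable ? ?;
  exact: le_Rintegral. Qed.

Lemma eq_Int f g : f =1 g -> Int f = Int g.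
Proof. by move=> /funext ->. Qed.

Lemma bounded_support_norm f : bounded_support f ->
  bounded_support (fun s => `|f s|).
Proof.
move=> [mf [C fC]]; split; first exact: measurableT_comp.
by exists C => s; rewrite normr_id; split => [|/(fC s).2 ->];
  rewrite ?(fC s).1 ?normr0.
Qed.

Lemma ler_norm_Int f g : bounded_support f -> bounded_support g ->
  (forall s, `|f s| <= g s) -> `|Int f| <= Int g.
Proof.
move=> bf bg fg; apply: le_trans (ler_Int (bounded_support_norm bf) bg fg).
exact: le_normr_Rintegral (bounded_support_integrable bf).
Qed.

Lemma sin_lipschitz (a b : R) : `|sin a - sin b| <= `|a - b|.
Proof.
wlog ab : a b / b <= a.
  by move=> W; case: (leP b a) => [/W//|/ltW /W]; rewrite distrC (distrC b).
have cs : {within `[b, a], continuous (@sin R)}.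
  exact/continuous_subspaceT/continuous_sin.
have [c _ ->] := MVT_segment ab (fun x _ => is_derive_sin x) cs.
by rewrite normrM ler_piMl// ler_norml cos_geN1 cos_le1.
Qed.

Lemma cos_lipschitz (a b : R) : `|cos a - cos b| <= `|a - b|.
Proof.
have E (x : R) : cos x = sin (x + pi / 2) by rewrite sinDpihalf.
by rewrite !E (le_trans (sin_lipschitz _ _))// opprD addrACA subrr addr0.
Qed.

Lemma cos_taylor1 (a u : R) : `|cos (a + u) - cos a + u * sin a| <= u ^+ 2.
Proof.
(* [m] lies within [c - b] of both end points, so the choices [m = b] and [m = c] cover increments
   [u] of either sign at once. *)
suff W (b c : R) : b <= c -> forall m, `|m - b| <= c - b -> `|m - c| <= c - b ->
    `|cos c - cos b + (c - b) * sin m| <= (c - b) ^+ 2.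
  case: (leP 0 u) => [u0|/ltW u0].
    have := @W a (a + u) _ a; rewrite addrAC subrr add0r.
    rewrite (_ : a - (a + u) = - u); last by ring.
    rewrite normrN (ger0_norm u0) normr0; apply => //; lra.
  have := @W (a + u) a _ a; rewrite (_ : a - (a + u) = - u); last by ring.
  rewrite subrr normr0 (ger0_norm (_ : 0 <= - u)) ?sqrrN; last lra.
  rewrite (_ : cos a - cos (a + u) + - u * sin a = - (cos (a + u)
    - cos a + u * sin a)); last by ring.
  by rewrite normrN; apply => //; lra.
move=> bc m mb mc.
have cc : {within `[b, c], continuous (@cos R)}.
  exact/continuous_subspaceT/continuous_cos.
have [d] := MVT_segment bc (fun x _ => is_derive_cos x) cc.
rewrite in_itv/= => /andP[bd dc] ->.
rewrite (_ : _ + _ = (sin m - sin d) * (c - b)); last by ring.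
have cb0 : 0 <= c - b by lra.
rewrite normrM (ger0_norm cb0) expr2 ler_wpM2r//.
apply: le_trans (sin_lipschitz _ _) _.
rewrite ler_norml; move: mb mc; rewrite !ler_norml; lra.
Qed.

Lemma sin_taylor1 (a u : R) : `|sin (a + u) - sin a - u * cos a| <= u ^+ 2.
Proof.
have := cos_taylor1 (a + pi / 2) u.
rewrite sinDpihalf (_ : a + pi / 2 + u = a + u + pi / 2); last by ring.
rewrite !cosDpihalf -normrN (_ : - (_ + _) = sin (a + u) - sin a - u * cos a)
  //.
by ring.
Qed.

End line_moments.

(** * Functions with vanishing transforms on a frequency interval, and their multipliers *)

Section fourier_null.
Context {R : realType}.
Local Notation mu := (@lebesgue_measure R).
Implicit Types (f g u v H : R -> R) (a b k : R).

Definition fourier_null a b H := bounded_support H /\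
  forall k, a < k < b ->
    Int (fun s => cos (k * s) * H s) = 0 /\ Int (fun s => sin (k * s) * H s)
      = 0.

(** Stands in for a limit of difference quotients: in its use the quotient vanishes and misses [x]
    by [O(h)]. *)
Lemma eq0_small (d x C : R) : 0 < d -> (forall h, 0 < h < d -> `|x| <= h * C) ->
  x = 0.
Proof.
move=> d0 hC; apply/eqP; apply: contraT => x0.
have C1 : 0 < `|C| + 1 by rewrite ltr_wpDl.
pose h := Num.min (d / 2) (`|x| / (2 * (`|C| + 1))).
have h0 : 0 < h by rewrite lt_min !divr_gt0 ?normr_gt0// mulr_gt0.
have hd : h < d by rewrite gt_min; apply/orP; left; lra.
have := hC h; rewrite h0 hd => /(_ isT) xhC.
have h2 : h * (`|C| + 1) <= `|x| / 2.
  apply: (@le_trans _ _ (`|x| / (2 * (`|C| + 1)) * (`|C| + 1))).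
    by apply: ler_wpM2r; [exact: ltW|rewrite /h ge_min lexx orbT].
  by rewrite invfM mulrA -mulrA mulVf ?mulr1// gt_eqF.
have : h * C <= h * (`|C| + 1).
  by apply: ler_wpM2l; [exact: ltW|rewrite (le_trans (ler_norm C))// lerDl].
have : 0 < `|x| by rewrite normr_gt0.
lra.
Qed.

Lemma locally_bounded_cosl k : locally_bounded (fun s => cos (k * s)).
Proof. by have := locally_bounded_cos k 0;
  under [X in locally_bounded X]eq_fun do rewrite addr0. Qed.

Lemma locally_bounded_sinl k : locally_bounded (fun s => sin (k * s)).
Proof. by have := locally_bounded_sin k 0;
  under [X in locally_bounded X]eq_fun do rewrite addr0. Qed.

(* Differentiation in [k] under the integral sign. *)
Lemma fourier_null_id a b H : fourier_null a b H ->
  fourier_null a b (fun s => s * H s).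
Proof.
move=> [bH nH].
have bsH : bounded_support (fun s => s * H s).
  exact: bounded_supportM locally_bounded_id bH.
split=> // k /andP[ak kb].
pose C := Int (fun s => s * s * `|H s|).
have bC : bounded_support (fun s => s * s * `|H s|).
  apply: bounded_supportM (bounded_support_norm bH).
  exact: locally_boundedM locally_bounded_id locally_bounded_id.
have bc k' := bounded_supportM (locally_bounded_cosl k') bH.
have bs k' := bounded_supportM (locally_bounded_sinl k') bH.
have bcs := bounded_supportM (locally_bounded_cosl k) bsH.
have bss := bounded_supportM (locally_bounded_sinl k) bsH.
have bZ (c : R) f : bounded_support f -> bounded_support (fun s => c * f s).
  exact/bounded_supportM/locally_bounded_cst.
split; apply: (@eq0_small (b - k) _ C); rewrite ?subr_gt0// => h /andP[h0 hb].
- have kh : a < k + h < b by lra.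
  rewrite -(ler_pM2l h0) mulrA -expr2 -{1}(gtr0_norm h0) -normrM -normrN.
  (* The two added terms integrate to zero, since [k] and [k + h] both lie in the interval; the
     integrand becomes a first-order Taylor remainder, at most [h^2 s^2 |H s|]. *)
  have -> : - (h * Int (fun s => cos (k * s) * (s * H s))) =
      Int (fun s => sin ((k + h) * s) * H s + (-1 * (sin (k * s) * H s) +
         - h * (cos (k * s) * (s * H s)))).
    rewrite !IntD ?IntZ//; [|exact: bZ|exact: bZ|exact: bounded_supportD (bZ _
      _ _) (bZ _ _ _)].
    by rewrite (nH _ kh).2 (nH k _).2 ?ak// mulr0 !add0r mulNr.
  rewrite -IntZ//; apply: ler_norm_Int.
  - exact: bounded_supportD (bounded_supportD (bZ _ _ _) (bZ _ _ _)).
  - exact: bZ.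
  - move=> s.
    rewrite (_ : _ + _ = (sin (k * s + h * s) - sin (k * s)
      - h * s * cos (k * s)) * H s);
      last by rewrite mulrDl; ring.
    rewrite normrM (_ : h ^+ 2 * _ = (h * s) ^+ 2 * `|H s|); last by ring.
    by rewrite ler_wpM2r// sin_taylor1.
- have kh : a < k + h < b by lra.
  rewrite -(ler_pM2l h0) mulrA -expr2 -{1}(gtr0_norm h0) -normrM.
  have -> : h * Int (fun s => sin (k * s) * (s * H s)) =
      Int (fun s => cos ((k + h) * s) * H s + (-1 * (cos (k * s) * H s) +
         h * (sin (k * s) * (s * H s)))).
    rewrite !IntD ?IntZ//; [|exact: bZ|exact: bZ|exact: bounded_supportD (bZ _
      _ _) (bZ _ _ _)].
    by rewrite (nH _ kh).1 (nH k _).1 ?ak// mulr0 !add0r.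
  rewrite -IntZ//; apply: ler_norm_Int.
  - exact: bounded_supportD (bounded_supportD (bZ _ _ _) (bZ _ _ _)).
  - exact: bZ.
  - move=> s.
    rewrite (_ : _ + _ = (cos (k * s + h * s) - cos (k * s)
      + h * s * sin (k * s)) * H s);
      last by rewrite mulrDl; ring.
    rewrite normrM (_ : h ^+ 2 * _ = (h * s) ^+ 2 * `|H s|); last by ring.
    by rewrite ler_wpM2r// cos_taylor1.
Qed.

(** These functions form an algebra containing the constants and the identity, hence all
    polynomials. Quantifying over every [H] makes closure under products a mere composition. *)
Definition multiplier a b u := locally_bounded u /\
  forall H, fourier_null a b H -> fourier_null a b (fun s => u s * H s).

Lemma multiplier_cst a b (c : R) : multiplier a b (fun=> c).
Proof.
split=> [|H [bH nH]]; first exact: locally_bounded_cst.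
split=> [|k kab]; first exact: bounded_supportM (locally_bounded_cst c) bH.
have E h : locally_bounded h -> Int (fun s => h s * H s) = 0 ->
    Int (fun s => h s * (c * H s)) = 0.
  move=> bh h0; under [X in Int X]eq_fun do rewrite mulrCA.
  by rewrite IntZ ?h0 ?mulr0//; exact: bounded_supportM.
by split; apply: E; rewrite ?(nH k kab).1 ?(nH k kab).2//;
  [exact: locally_bounded_cosl|exact: locally_bounded_sinl].
Qed.

Lemma multiplier_id a b : multiplier a b id.
Proof. by split=> [|H /fourier_null_id //]; exact: locally_bounded_id. Qed.

Lemma multiplierM a b u v : multiplier a b u -> multiplier a b v ->
  multiplier a b (fun s => u s * v s).
Proof.
move=> [bu mu_] [bv mv]; split; first exact: locally_boundedM.
by move=> H /mv/mu_; under [X in fourier_null _ _ X]eq_fun do rewrite mulrA.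
Qed.

Lemma multiplierD a b u v : multiplier a b u -> multiplier a b v ->
  multiplier a b (fun s => u s + v s).
Proof.
move=> [bu mu_] [bv mv]; split; first exact: locally_boundedD.
move=> H nH; have [buH uH] := mu_ _ nH; have [bvH vH] := mv _ nH.
under [X in fourier_null _ _ X]eq_fun do rewrite mulrDl.
split=> [|k kab]; first exact: bounded_supportD.
have bc k' := bounded_supportM (locally_bounded_cosl k').
have bs k' := bounded_supportM (locally_bounded_sinl k').
split; under [X in Int X]eq_fun do rewrite mulrDr.
  by rewrite IntD ?(uH _ kab).1 ?(vH _ kab).1 ?addr0//; exact: bc.
by rewrite IntD ?(uH _ kab).2 ?(vH _ kab).2 ?addr0//; exact: bs.
Qed.

Lemma multiplierX a b u n : multiplier a b u ->
  multiplier a b (fun s => u s ^+ n).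
Proof.
move=> mu_; elim: n => [|n IH].
  by under [X in multiplier _ _ X]eq_fun do rewrite expr0;
    exact: multiplier_cst.
by under [X in multiplier _ _ X]eq_fun do rewrite exprS; exact: multiplierM.
Qed.

End fourier_null.

(** * Affine change of variables on the line *)

Section affine_substitution.
Context {R : realType}.
Local Notation mu := (@lebesgue_measure R).
Implicit Types (f : R -> R) (c d : R).

Lemma measurable_affine c d : measurable_fun setT (fun s : R => c * s + d).
Proof.
by apply: measurable_funD; [exact: measurable_funM|exact: measurable_cst].
Qed.

(** By uniqueness of Lebesgue measure: the right-hand side is a measure in [A] with the correct
    value on each []x, y]]. For negative [c] the preimage is closed on the left instead, with the
    same length. *)
Lemma lebesgue_measure_affine c d (c0 : c != 0) (A : set R) : measurable A ->
  mu A = (`|c|%:E * mu ((fun s => (c * s + d)%R) @^-1` A))%E.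
Proof.
pose phi : R -> measurableTypeR R := fun s => (c * s + d)%R.
have mphi : measurable_fun setT phi by exact: measurable_affine.
pose P : {measure set (measurableTypeR R) -> \bar R} :=
  mscale (NngNum (normr_ge0 c))
    (measure_function_pushforward__canonical__measure_function_Measure mu mphi).
move=> mA; apply: (@lebesgue_measure_unique R P) => // _ [[x y] _ <-] /=.
rewrite /mscale/= /pushforward/=.
have [c_gt0|c_lt0] : 0 < c \/ c < 0 by move: c0; rewrite neq_lt => /orP[];
  [right|left].
- rewrite (_ : phi @^-1` _ = `](x - d) / c, (y - d) / c]%classic); last first.
    apply/seteqP; split=> s /=; rewrite !in_itv/= ltr_pdivrMr// ler_pdivlMr//
      /phi;
    rewrite (mulrC s) ltrBlDr lerBrDr //.
  rewrite !lebesgue_measure_itv/= !lte_fin ltr_pM2r ?invr_gt0// ltrD2r.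
  case: ifP => xy; last by rewrite mule0.
  by rewrite -!EFinB -EFinM (gtr0_norm c_gt0); congr EFin; field.
- rewrite (_ : phi @^-1` _ = `[(y - d) / c, (x - d) / c[%classic); last first.
    apply/seteqP; split=> s /=; rewrite !in_itv/= ltr_ndivlMr// ler_ndivrMr//
      /phi;
    rewrite (mulrC s) ltrBlDr lerBrDr andbC //.
  rewrite !lebesgue_measure_itv/= !lte_fin ltr_nM2r ?invr_lt0// ltrD2r.
  case: ifP => xy; last by rewrite mule0.
  by rewrite -!EFinB -EFinM (ltr0_norm c_lt0); congr EFin; field.
Qed.

Lemma ge0_integral_affine c d (c0 : c != 0) (f : R -> \bar R) :
  measurable_fun setT f -> (forall s, 0 <= f s)%E ->
  (\int[mu]_s f s = `|c|%:E * \int[mu]_s f (c * s + d)%R)%E.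
Proof.
move=> mf f0.
pose phi : R -> measurableTypeR R := fun s => (c * s + d)%R.
have mphi : measurable_fun setT phi by exact: measurable_affine.
pose Q : {measure set (measurableTypeR R) -> \bar R} :=
  (measure_function_pushforward__canonical__measure_function_Measure mu mphi).
pose P : {measure set (measurableTypeR R) -> \bar R} :=
  mscale (NngNum (normr_ge0 c)) Q.
rewrite (@eq_measure_integral _ _ R setT P).
  rewrite (ge0_integral_mscale Q measurableT (NngNum (normr_ge0 c))
    mf (fun s _ => f0 s)) /=.
  by rewrite ge0_integral_pushforward//.
by move=> A mA _; exact: lebesgue_measure_affine.
Qed.

Lemma bounded_support_affine c d f : c != 0 -> bounded_support f ->
  bounded_support (fun s => f (c * s + d)).
Proof.
move=> c0 [mf [C fC]]; split.
  exact: (measurableT_comp mf (measurable_affine c d)).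
have C0 : 0 <= C by apply: le_trans (fC 0).1.
exists (C + (C + `|d|) / `|c|) => s; split.
  by rewrite (le_trans (fC _).1)// lerDl divr_ge0// addr_ge0.
move=> Cs; apply: (fC _).2.
have : C + `|d| < `|c| * `|s|.
  rewrite mulrC -ltr_pdivrMr ?normr_gt0//; lra.
have := ler_normD (c * s + d) (- d); rewrite addrK normrN normrM; lra.
Qed.

Lemma Int_affine c d f : c != 0 -> bounded_support f ->
  Int f = `|c| * Int (fun s => f (c * s + d)).
Proof.
move=> c0 bf; have bfa := bounded_support_affine d c0 bf.
have i_f := bounded_support_integrable bf.
have ia := bounded_support_integrable bfa.
have mf : measurable_fun setT (EFin \o f) by apply/measurable_EFinP; case: bf.
suff E : (\int[mu]_s (EFin \o f) s =
    `|c|%:E * \int[mu]_s (EFin \o (fun s => f (c * s + d)%R)) s)%E.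
  by rewrite /Int /Rintegral E fineM//; exact: integrable_fin_num.
(* The substitution is known for nonnegative functions, so it is applied to the positive and
   negative parts. *)
rewrite integralE [X in (_ = _ * X)%E]integralE.
rewrite muleBr; [|by []|exact: integrable_add_def].
rewrite (ge0_integral_affine d c0 (measurable_funepos mf));
  last exact: funepos_ge0.
rewrite (ge0_integral_affine d c0 (measurable_funeneg mf));
  last exact: funeneg_ge0.
have -> : ((EFin \o (fun s => f (c * s + d)%R))^\+)%E = fun s => ((EFin \o
  f)^\+)%E (c * s + d)%R.
  exact: funepos_comp (EFin \o f) (fun s => c * s + d).
have -> // : ((EFin \o (fun s => f (c * s + d)%R))^\-)%E = fun s => ((EFin \o
  f)^\-)%E (c * s + d)%R.
exact: funeneg_comp (EFin \o f) (fun s => c * s + d).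
Qed.

End affine_substitution.

(** * Localisation by polynomial cutoffs *)

Section strip.
Context {R : realType}.
Local Notation mu := (@lebesgue_measure R).
Implicit Types (H : R -> R) (a b k eps q x : R).

Lemma bernoulli_ge x (N : nat) : -1 <= x -> 1 + N%:R * x <= (1 + x) ^+ N.
Proof.
move=> x1; elim: N => [|N IH]; first by rewrite mul0r addr0 expr0.
rewrite exprS.
have := sqr_ge0 x; rewrite expr2 => x2.
have N0 : (0 : R) <= N%:R by [].
have : (1 + x) * (1 + N%:R * x) <= (1 + x) * (1 + x) ^+ N.
  by apply: ler_wpM2l => //; lra.
rewrite -natr1; apply: le_trans.
by have := mulr_ge0 N0 x2; lra.
Qed.

(* [(1 - p ^ n) ^ (K ^ n)] tends to [1] where [K p < 1] and to [0] where
   [K p > 1]; here [q = K p]. *)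
Lemma cutoff_cvg (K : nat) q : (0 < K)%N -> 0 <= q -> q <= K%:R -> q != 1 ->
  (1 - (q / K%:R) ^+ n) ^+ (K ^ n) @[n --> \oo] -->
    (if q < 1 then 1 else 0 : R).
Proof.
move=> K0 q0 qK q1.
have KR : (0 : R) < K%:R by rewrite ltr0n.
have p0 : 0 <= q / K%:R by rewrite divr_ge0.
have p1 : q / K%:R <= 1 by rewrite ler_pdivrMr// mul1r.
have pn0 n : 0 <= (q / K%:R) ^+ n by exact: exprn_ge0.
have pn1 n : (q / K%:R) ^+ n <= 1 by exact: exprn_ile1.
have E n : (K ^ n)%:R * (q / K%:R) ^+ n = q ^+ n.
  by rewrite natrX -exprMn mulrC divfK// gt_eqF.
case: ifPn => [ql|]; last rewrite -leNgt le_eqVlt eq_sym (negbTE q1)/= => qg.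
  (* The lower bound is Bernoulli's inequality, because [K^n (q / K)^n = q^n]. *)
  apply: (@squeeze_cvgr _ _ _ _ (fun n => 1 - q ^+ n) (fun=> 1)).
  - near=> n; rewrite exprn_ile1 ?andbT ?subr_ge0//;
    last by rewrite lerBlDr lerDl.
    have := @bernoulli_ge (- (q / K%:R) ^+ n) (K ^ n); rewrite mulrN E; apply.
    by rewrite lerN2.
  - rewrite -[X in _ --> X]subr0; apply: cvgB; first exact: cvg_cst.
    by apply: cvg_expr; rewrite ger0_norm.
  - exact: cvg_cst.
have q_gt0 : 0 < q by lra.
apply: (@squeeze_cvgr _ _ _ _ (fun=> 0) (fun n => (q^-1) ^+ n)).
- near=> n; rewrite exprn_ge0 ?subr_ge0//=.
  have qn : 0 < q ^+ n by exact: exprn_gt0.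
  rewrite exprVn -[leRHS]mul1r ler_pdivlMr//.
  (* With [p = q / K], the extra factor [(1 + p^n)^(K^n)] is at least [q^n] by Bernoulli, and it
     turns the base [1 - p^n] into [1 - p^(2n) <= 1]. *)
  apply: (@le_trans _ _ ((1 - (q / K%:R) ^+ n) ^+ (K ^ n) * (1 + (q / K%:R)
    ^+ n) ^+ (K ^ n))).
    apply: ler_wpM2l; first by rewrite exprn_ge0// subr_ge0.
    have := @bernoulli_ge ((q / K%:R) ^+ n) (K ^ n);
      rewrite E => /(_ _)/(le_trans _)->//.
      by rewrite lerDr.
    by rewrite (le_trans _ (pn0 n))// lerN10.
  rewrite -exprMn; apply: exprn_ile1; have := pn0 n; have := pn1 n; nra.
- exact: cvg_cst.
- by apply: cvg_expr; rewrite ger0_norm ?invr_ge0// invf_lt1.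
Unshelve. all: by end_near. Qed.

(** The cutoffs [phi n] are polynomials in [s], hence multipliers, so each [phi n * H] still has
    mean zero against the cosine. On the support of [H] they are bounded by 1 and tend almost
    everywhere to the indicator of the strip; dominated convergence concludes. The cutoffs are those
    of the Brosowski-Deutsch proof of the Stone-Weierstrass theorem. *)
Lemma fourier_null_strip a b k s0 eps H : fourier_null a b H -> a < k < b ->
  0 < eps ->
  Int (fun s => cos (k * (s - s0)) * (if `|s - s0| < eps then H s else 0)) = 0.
Proof.
move=> nH kab e0; have [bH _] := nH; have [mH [C HC]] := bH.
(* Normalised so that [q s < 1] exactly when [|s - s0| < eps]. *)
pose q s := (eps^-1 * (s + - s0)) ^+ 2.
have q0 s : 0 <= q s by exact: sqr_ge0.
have mulq : multiplier a b q.
  apply: multiplierX; apply: multiplierM; first exact: multiplier_cst.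
  by apply: multiplierD; [exact: multiplier_id|exact: multiplier_cst].
have [Q qQ] := mulq.1.2 C.
(* An integer bound of [q] on the support of [H], which keeps [q / K] in [0, 1] there. *)
pose K := (Num.bound `|Q|).+1.
have qK s : `|s| <= C -> q s <= K%:R.
  move=> sC; rewrite (le_trans (ler_norm _))// (le_trans (qQ _ sC))//.
  rewrite (le_trans (ler_norm _))// ltW// (lt_le_trans (archi_boundP _))//.
  by rewrite ler_nat.
pose phi n s := (1 + (-1) * (q s * K%:R^-1) ^+ n) ^+ (K ^ n).
have mulphi n : multiplier a b (phi n).
  apply: multiplierX; apply: multiplierD; first exact: multiplier_cst.
  apply: multiplierM; first exact: multiplier_cst.
  by apply: multiplierX; apply: multiplierM => //; exact: multiplier_cst.
pose f n s := cos (k * (s - s0)) * (phi n s * H s).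
have lbc : locally_bounded (fun s => cos (k * (s - s0))).
  have := locally_bounded_cos k (- (k * s0)).
  by under [X in locally_bounded X -> _]eq_fun do rewrite -mulrBr.
have bphi n : bounded_support (fun s => phi n s * H s) := ((mulphi n).2 _ nH).1.
have bf n : bounded_support (f n) by exact: bounded_supportM lbc (bphi n).
have f0 n : Int (f n) = 0.
  have [_ /(_ k kab)[c0 sn0]] := (mulphi n).2 _ nH.
  rewrite (_ : f n = fun s => cos (k * s0) * (cos (k * s) * (phi n s * H s)) +
      sin (k * s0) * (sin (k * s) * (phi n s * H s))); last first.
    by apply/funext => s; rewrite /f mulrBr cosB; ring.
  have b1 := bounded_supportM (locally_bounded_cosl k) (bphi n).
  have b2 := bounded_supportM (locally_bounded_sinl k) (bphi n).
  have bZ (c : R) h : bounded_support h -> bounded_support (fun s => c * h s).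
    exact/bounded_supportM/locally_bounded_cst.
  by rewrite IntD ?IntZ ?c0 ?sn0 ?mulr0 ?addr0//; exact: bZ.
pose g s := cos (k * (s - s0)) * (if `|s - s0| < eps then H s else 0).
have mg : measurable_fun setT g.
  apply: measurable_funM; first exact: lbc.1.
  apply: measurable_fun_if => //; last exact: measurable_funTS.
    apply: measurable_fun_ltr => //; apply: measurableT_comp => //.
    exact: measurable_funB.
have fg : {ae mu, forall s, setT s -> (EFin \o f n) s @[n --> \oo] -->
  (EFin \o g) s}.
  (* At these two points [q = 1], the value excluded from [cutoff_cvg]. *)
  exists [set s0 - eps; s0 + eps]; split.
  - by apply: measurableU; exact: measurable_set1.
  - by apply: countable_lebesgue_measure0; apply: finite_set_countable.
  - move=> s /= ns; apply: contrapT => s2; apply: ns => _.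
    apply: cvg_EFin; first by near=> n.
    have [Cs|sC] := ltP C `|s|.
      rewrite /comp/= /g /f (HC s).2//; under eq_fun do rewrite !mulr0.
      by rewrite if_same mulr0; exact: cvg_cst.
    rewrite /comp/= /g /f; apply: cvgM; first exact: cvg_cst.
    have -> : (if `|s - s0| < eps then H s else 0) =
        (if q s < 1 then 1 else 0) * H s.
      have -> : (q s < 1) = (`|s - s0| < eps).
        rewrite /q -real_normK ?num_real// -[1](expr1n _ 2)
          ltr_pXn2r ?nnegrE// normrM.
        by rewrite gtr0_norm ?invr_gt0// mulrC ltr_pdivrMr// mul1r.
      by case: ifP; rewrite ?mul1r ?mul0r.
    apply: cvgM; last exact: cvg_cst.
    rewrite /phi; under eq_fun do rewrite mulN1r.
    apply: cutoff_cvg => //; first exact: qK.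
    apply: contra_notN s2; rewrite /q sqrf_eq1 => /orP[] /eqP /(congr1 ( *%R
      eps));
      rewrite mulrA divff ?gt_eqF// mul1r ?mulr1 ?mulrN1 => E; [right|left];
      by rewrite /= -E; ring.
have phi01 n s : `|s| <= C -> `|phi n s| <= 1.
  move=> sC.
  have p0 : 0 <= (q s * K%:R^-1) ^+ n by rewrite exprn_ge0// mulr_ge0.
  have p1 : (q s * K%:R^-1) ^+ n <= 1.
    apply: exprn_ile1; first exact: mulr_ge0.
    by rewrite ler_pdivrMr ?ltr0n// mul1r; exact: qK.
  rewrite /phi mulN1r normrX exprn_ile1// ger0_norm; lra.
have f_le n s : `|f n s| <= `|H s|.
  rewrite /f; have [Cs|sC] := ltP C `|s|; first by rewrite (HC s).2// !mulr0.
  rewrite !normrM -[leRHS]mul1r ler_pM ?mulr_ge0//.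
    by rewrite ler_norml cos_geN1 cos_le1.
  by rewrite -[leRHS]mul1r ler_wpM2r// phi01.
have mf n : measurable_fun setT (EFin \o f n) by apply/measurable_EFinP;
  case: (bf n).
have mEg : measurable_fun setT (EFin \o g) by exact/measurable_EFinP.
have iH := bounded_support_integrable (bounded_support_norm bH).
have fH : {ae mu, forall s n, setT s ->
    (`|(f n s)%:E| <= (`|H s|%R)%:E)%E}.
  by apply: aeW => s n _; rewrite /= lee_fin.
have [_ _] := @dominated_convergence _ _ R mu setT measurableT
  (fun n => EFin \o f n) (EFin \o g) _ mf mEg fg iH fH.
have -> : (fun n => \int[mu]_(x in setT) (EFin \o f n) x)%E = fun=> 0%E.
  apply/funext => n; rewrite -[LHS]fineK; first by have /= := f0 n;
    rewrite /Int /Rintegral => ->.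
  exact: integrable_fin_num (bounded_support_integrable (bf n)).
move=> /(cvg_lim (@ereal_hausdorff _)); rewrite lim_cst//.
by rewrite /Int /Rintegral => <-.
Unshelve. all: by end_near. Qed.

End strip.

(** * A function with null data has no kink in its even part *)

Section second_difference.
Context {R : realType}.
Local Notation mu := (@lebesgue_measure R).
Implicit Types (H : R -> R) (a b : R).

Definition interval_indic a b : R -> R := \1_(`[a, b]%classic : set R).

Lemma bounded_support_indic a b : bounded_support (interval_indic a b).
Proof.
split; first exact: measurable_indic.
exists (Num.max 1 (Num.max `|a| `|b|)) => s; split.
  by rewrite /interval_indic indicE; case: (_ \in _);
    rewrite ?normr1 ?normr0 le_max ?lexx ?ler01.
rewrite !gt_max => /and3P[_ sa sb];
  rewrite /interval_indic indicE memNset//= in_itv/=.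
move=> /andP[as_ sb']; have : `|s| <= Num.max `|a| `|b|.
  rewrite le_max; case: (leP 0 s) => s0.
    by rewrite (ger0_norm s0) (le_trans sb' (ler_norm _)) orbT.
  rewrite (ltr0_norm s0) -[`|a|]normrN (le_trans _ (ler_norm _))// lerN2//.
by rewrite le_max leNgt sa leNgt sb.
Qed.

Lemma Int_indic a b : a <= b -> Int (interval_indic a b) = b - a.
Proof.
move=> ab; rewrite /Int /Rintegral integral_indic// setIT.
rewrite [X in fine X](_ : _ = (b - a)%:E)//; last first.
rewrite /= lebesgue_measure_itv/= lte_fin.
have [//|ba] := ltP a b; rewrite (_ : b = a) ?subrr//.
by apply/eqP; rewrite eq_le ab ba.
Qed.

(** Substitute [s = s0 + u] and [s = s0 - u] in the localised identity and add the results; the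
    cosine weight is even. *)
Lemma fourier_null_even a b k s0 eps H : fourier_null a b H -> a < k < b ->
  0 < eps ->
  Int (fun u => cos (k * u) *
    (if `|u| < eps then H (s0 + u) + H (s0 - u) else 0)) = 0.
Proof.
move=> nH kab e0; have S0 := fourier_null_strip s0 nH kab e0.
set F := fun s => _ in S0; have bF : bounded_support F.
  apply: (@bounded_supportM R (fun s => cos (k * (s - s0)))).
    have := locally_bounded_cos k (- (k * s0)).
    by under [X in locally_bounded X -> _]eq_fun do rewrite -mulrBr.
  have [[mH [C HC]] _] := nH; split; last first.
    exists C => s; case: ifP => _; first exact: HC.
    by rewrite normr0; split=> //; apply: le_trans (HC 0).1.
  apply: measurable_fun_if => //; last exact: measurable_funTS.
  apply: measurable_fun_ltr => //; apply: measurableT_comp => //.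
  exact: measurable_funB.
have E1 : Int (fun u => F (1 * u + s0)) = 0.
  have := @Int_affine R 1 s0 F (oner_neq0 _) bF.
  by rewrite S0 normr1 mul1r.
have E2 : Int (fun u => F (-1 * u + s0)) = 0.
  have N1 : (-1 : R) != 0 by rewrite oppr_eq0 oner_neq0.
  by have := @Int_affine R (-1) s0 F N1 bF; rewrite S0 normrN1 mul1r.
have b1 := bounded_support_affine s0 (oner_neq0 R) bF.
have b2 : bounded_support (fun u => F (-1 * u + s0)).
  by apply: bounded_support_affine => //; rewrite oppr_eq0 oner_neq0.
transitivity (Int (fun u => F (1 * u + s0) + F (-1 * u + s0))); last first.
  by rewrite IntD// E1 E2 addr0.
apply: eq_Int => u.
rewrite /F mul1r mulN1r !addrK normrN mulrN cosN (addrC u) (addrC (- u)).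
by case: ifP; rewrite ?mulr0 ?addr0 ?mulrDr.
Qed.

(* The even part of [H] at [s0], weighted by [cos (k u)], has mean zero over every
   small interval, while [2 H(s0) + J |u|] would give it a constant sign there.
     *)
Lemma fourier_null_no_jump a b H s0 J : a < b -> fourier_null a b H ->
  (forall e, 0 < e -> exists2 d, 0 < d & forall u, 0 < u < d ->
     `|H (s0 + u) + H (s0 - u) - 2 * H s0 - J * u| <= e * u) ->
  J = 0.
Proof.
move=> ab nH HJ; apply/eqP; apply: contraT => J0.
have J_gt0 : 0 < `|J| by rewrite normr_gt0.
pose k := (a + b) / 2; have kab : a < k < b by rewrite /k; lra.
pose K u := H (s0 + u) + H (s0 - u); pose A := 2 * H s0.
have KN u : K (- u) = K u by rewrite /K opprK addrC.
have [d d0 Kd] : exists2 d, 0 < d & forall u, 0 < u < d ->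
     `|K u - A - J * u| <= `|J| / 2 * u by apply: HJ; lra.
(* Near 0 the even part [K] has the fixed sign [sg]. The bound [c u], weaker than necessary when [A]
   is nonzero, lets both cases share what follows. *)
have [c [sg [d1 [c0 d1_gt0 lb]]]] : exists c sg d1, [/\ 0 < c, 0 < d1 &
    forall u, 0 <= u < d1 -> c * u <= sg * K u].
  have [A0|A0] := eqVneq A 0.
    exists (`|J| / 2), (Num.sg J), d; split=> //; first lra.
    move=> u /andP[]; rewrite le_eqVlt => /predU1P[<- _|u0 ud].
      have -> : K 0 = 0 by rewrite /K addr0 subr0 -mulr2n -mulr_natl -/A.
      by rewrite !mulr0.
    have /Kd : 0 < u < d by rewrite u0.
    rewrite A0 subr0 => Kle.
    rewrite -[K u](subrK (J * u)) mulrDr mulrA -normrEsg.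
    have : - (Num.sg J * (K u - J * u)) <= `|J| / 2 * u.
      rewrite -mulNr; apply: le_trans (ler_norm _) _.
      by rewrite normrM normrN normr_sg J0 mul1r.
    lra.
  have A_gt0 : 0 < `|A| by rewrite normr_gt0.
  (* Below [|A| / (4 |J|)] the deviation [2 |J| u] is at most [|A| / 2]; [u < 1] then weakens
     [|A| / 2] to [|A| / 2 * u]. *)
  exists (`|A| / 2), (Num.sg A), (Num.min (Num.min d 1) (`|A| / (4 * `|J|))).
  have p0 : 0 < `|A| / (4 * `|J|) by rewrite divr_gt0// mulr_gt0.
  split; [lra|by rewrite !lt_min d0 ltr01|].
  move=> u; rewrite !lt_min => /andP[u0 /andP[/andP[ud u1]]].
  rewrite ltr_pdivlMr ?mulr_gt0// => uJ.
  have Ku : `|K u - A| <= 2 * `|J| * u.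
    move: u0; rewrite le_eqVlt => /predU1P[<-|u0].
      by rewrite /K addr0 subr0 /A mulr2n mulrDl mul1r subrr normr0 mulr0.
    have /Kd Kle : 0 < u < d by rewrite u0.
    rewrite -(subrK (J * u) (K u - A)) (le_trans (ler_normD _ _))//.
    rewrite normrM (gtr0_norm u0).
    have := mulr_gt0 J_gt0 u0; lra.
  rewrite -[K u](subrK A) mulrDr -normrEsg.
  have : - (Num.sg A * (K u - A)) <= 2 * `|J| * u.
    rewrite -mulNr; apply: le_trans (ler_norm _) _.
    by rewrite normrM normrN normr_sg A0 mul1r.
  have : `|A| / 2 * u <= `|A| / 2 * 1 by apply: ler_wpM2l; lra.
  lra.
have kk : 0 < 2 * (`|k| + 1) by rewrite mulr_gt0// ltr_wpDl.
(* Makes [|k u| <= 1 / 2], so the Lipschitz bound yields [cos (k u) >= 1 / 2]. *)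
pose d2 := Num.min d1 (2 * (`|k| + 1))^-1.
have d2_gt0 : 0 < d2 by rewrite lt_min d1_gt0 invr_gt0.
have cos_ge u : `|u| < d2 -> 1 / 2 <= cos (k * u).
  rewrite lt_min => /andP[_ ud].
  have : `|cos (k * u) - cos 0| <= `|k * u - 0| by exact: cos_lipschitz.
  rewrite cos0 subr0 normrM => kc.
  have : `|u| * (2 * (`|k| + 1)) < 1 by rewrite -ltr_pdivlMr// div1r.
  have := normr_ge0 u; move: kc; rewrite ler_norml; lra.
have := fourier_null_even s0 nH kab d2_gt0; set M := fun u => _ => M0.
have bM0 : bounded_support M.
  apply: bounded_supportM; first exact: locally_bounded_cosl.
  have bK : bounded_support K.
    have N1 : (-1 : R) != 0 by rewrite oppr_eq0 oner_neq0.
    have bH := nH.1; have b1 := bounded_support_affine s0 (oner_neq0 R) bH.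
    have b2 := bounded_support_affine s0 N1 bH.
    have := bounded_supportD b1 b2; congr bounded_support; apply/funext => u.
    by rewrite /K mul1r mulN1r (addrC u) (addrC (- u)).
  have [mK [C KC]] := bK; split; last first.
    exists C => u; case: ifP => _; first exact: KC.
    by rewrite normr0; split=> //; apply: le_trans (KC 0).1.
  apply: measurable_fun_if => //; last exact: measurable_funTS.
  by apply: measurable_fun_ltr => //; exact: measurableT_comp.
have bM := bounded_supportM (locally_bounded_cst sg) bM0.
have sM0 : Int (fun u => sg * M u) = 0 by rewrite IntZ// M0 mulr0.
(* A minorant of [sg * M] with positive integral: [c u] is at least [c * (d2 / 4)] on the chosen
   interval, and the cosine contributes [1 / 2]. *)
pose g u := c * (d2 / 4) / 2 * interval_indic (d2 / 4) (d2 / 2) u.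
have bI := bounded_support_indic (d2 / 4) (d2 / 2).
have bg : bounded_support g by apply: bounded_supportM bI;
  exact: locally_bounded_cst.
have : Int g <= 0.
  rewrite -sM0; apply: ler_Int => // u; rewrite /g /M.
  have lbn : `|u| < d2 -> c * `|u| <= sg * K u.
    rewrite lt_min => /andP[ud _].
    have [u0|u0] := leP 0 u.
      by rewrite ger0_norm// in ud *; apply: lb; rewrite u0.
    by rewrite ltr0_norm// -KN in ud *; apply: lb; rewrite ud oppr_ge0 ltW.
  case: ifP => [ud|ud]; last first.
    rewrite /interval_indic indicE memNset ?mulr0//= in_itv/= => /andP[u1 u2].
    by move: ud; rewrite ger0_norm; lra.
  have lu := lbn ud; have cu := cos_ge _ ud.
  have cu0 : 0 <= c * `|u| by rewrite mulr_ge0// ltW.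
  rewrite [leRHS]mulrCA; apply: (@le_trans _ _ (1 / 2 * (c * `|u|)));
    last first.
    by apply: ler_pM; [lra|exact: cu0|exact: cu|exact: lu].
  rewrite /interval_indic indicE; have [uI|_] := boolP (u \in _);
    last by rewrite mulr0; lra.
  move: uI; rewrite inE/= in_itv/= => /andP[u1 u2].
  have : c * (d2 / 4) <= c * `|u|.
    by apply: ler_wpM2l; [exact: ltW|rewrite (le_trans u1)// ler_norm].
  by rewrite mulr1; lra.
rewrite IntZ// Int_indic; last lra.
have : 0 < c * (d2 / 4) / 2 * (d2 / 2 - d2 / 4).
  by rewrite !mulr_gt0 ?divr_gt0//; lra.
by lra.
Qed.

End second_difference.

(** * Plane integrals and their slices *)

Section plane_integral.
Context {R : realType}.
Local Notation mu := (@lebesgue_measure R).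
Local Notation T := (measurableTypeR R * measurableTypeR R)%type.
Implicit Types (f g : R * R -> R).

Definition bounded_support2 g := measurable_fun (setT : set T) g /\
  exists C : R, forall z : R * R, `|g z| <= C /\ (C < `|z| -> g z = 0).

Lemma prod_norm_le (z : R * R) (C : R) : (`|z| <= C) = (`|z.1| <= C)
  && (`|z.2| <= C).
Proof. by rewrite /Num.norm/= ge_max. Qed.

Lemma bounded_support2_integrable g : bounded_support2 g ->
  (@lebesgue2 R).-integrable (setT : set T) (EFin \o g).
Proof.
move=> [mg [C gC]]; pose B := (`[-C, C]%classic `*` `[-C, C]%classic : set T).
have mB : measurable B by apply: measurableX; exact: measurable_itv.
rewrite (_ : EFin \o g = (EFin \o g) \_ B); last first.
  apply/funext => z; rewrite patchE; case: ifPn => // /negP zC.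
  rewrite /= (gC z).2// ltNge; apply/negP => zC'; apply: zC; rewrite inE /B /=.
  by rewrite !in_itv /= -!ler_norml; apply/andP; rewrite -prod_norm_le.
apply: (integrable_mkcond (mu := @lebesgue2 R) (D := B) (EFin \o g) mB).1.
apply: (@measurable_bounded_integrable _ T R (@lebesgue2 R) g B) => //.
- rewrite /= /lebesgue2 product_measure1E;
  [|exact: measurable_itv|exact: measurable_itv].
  rewrite /= lebesgue_measure_itv/=; case: ifP => _; last by rewrite mule0 ltry.
  by rewrite -EFinB -EFinM ltry.
- exact: measurable_funTS.
- by exists C; split; [exact: num_real|move=> x Cx y _ /=;
  rewrite (le_trans (gC y).1)// ltW].
Qed.

Definition Int2 g : R := Rintegral (@lebesgue2 R) setT g.

Lemma Int2D f g : bounded_support2 f -> bounded_support2 g ->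
  Int2 (fun z => f z + g z) = Int2 f + Int2 g.
Proof.
move=> /bounded_support2_integrable ? /bounded_support2_integrable ?.
exact: RintegralD.
Qed.

Lemma Int2B f g : bounded_support2 f -> bounded_support2 g ->
  Int2 (fun z => f z - g z) = Int2 f - Int2 g.
Proof.
move=> /bounded_support2_integrable ? /bounded_support2_integrable ?.
exact: RintegralB.
Qed.

Lemma bounded_support2_section1 f a : bounded_support2 f ->
  bounded_support (fun b => f (a, b)).
Proof.
move=> [mf [C fC]]; split; first exact: (measurableT_comp mf (measurable_pair1
  a)).
exists C => b; split; first exact: (fC _).1.
by move=> Cb; apply: (fC _).2; rewrite ltNge prod_norm_le negb_and -!ltNge Cb
  orbT.
Qed.

Lemma bounded_support2_section2 f b : bounded_support2 f ->
  bounded_support (fun a => f (a, b)).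
Proof.
move=> [mf [C fC]]; split; first exact: (measurableT_comp mf (measurable_pair2
  b)).
exists C => a; split; first exact: (fC _).1.
by move=> Ca; apply: (fC _).2; rewrite ltNge prod_norm_le negb_and -!ltNge Ca.
Qed.

Lemma Int_EFin (h : R -> R) : bounded_support h ->
  (\int[mu]_s (h s)%:E)%E = (Int h)%:E.
Proof.
by move=> /bounded_support_integrable ih; rewrite /Int /Rintegral fineK//;
  exact: integrable_fin_num.
Qed.

Lemma Int_bound (h : R -> R) (C : R) : bounded_support h ->
  (forall s, `|h s| <= C /\ (C < `|s| -> h s = 0)) -> `|Int h| <= C * (C + C).
Proof.
move=> bh hC; have C0 : 0 <= C by apply: le_trans (hC 0).1.
have bI := bounded_support_indic (- C) C.
have bCI := bounded_supportM (locally_bounded_cst C) bI.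
have NC : - C <= C by lra.
have -> : C * (C + C) = Int (fun s => C * interval_indic (- C) C s).
  by rewrite IntZ// Int_indic// opprK.
apply: ler_norm_Int => // s; rewrite /interval_indic indicE.
have [_|] := boolP (s \in _); first by rewrite mulr1 (hC s).1.
move=> /negP sC; rewrite (hC s).2 ?normr0 ?mulr0// ltNge; apply/negP => sC'.
by apply: sC; rewrite inE /= in_itv/= -ler_norml.
Qed.

Lemma bounded_support2_Int1 f : bounded_support2 f ->
  bounded_support (fun a => Int (fun b => f (a, b))).
Proof.
move=> bf; have ibf := bounded_support2_integrable bf; have [mf [C fC]] := bf.
have C0 : 0 <= C by apply: le_trans (fC 0).1.
split.
  apply/measurable_EFinP; rewrite [X in measurable_fun _ X](_ : _ = fubini_F mu
    (EFin \o f)).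
    exact: (measurable_fubini_F (m1 := mu) (m2 := mu)).
  by apply/funext => a; rewrite /= /fubini_F -Int_EFin//;
    exact: bounded_support2_section1.
exists (Num.max C (C * (C + C))) => a; split.
  rewrite le_max; apply/orP; right; apply: Int_bound;
    first exact: bounded_support2_section1.
  move=> b; split; first exact: (fC _).1.
  by move=> Cb; apply: (fC _).2; rewrite ltNge prod_norm_le negb_and -!ltNge Cb
    orbT.
rewrite gt_max => /andP[Ca _]; rewrite (eq_Int (g := fun=> 0)); last first.
  by move=> b; apply: (fC _).2; rewrite ltNge prod_norm_le negb_and -!ltNge Ca.
by rewrite /Int Rintegral_cst//= mul0r.
Qed.

Lemma bounded_support2_Int2 f : bounded_support2 f ->
  bounded_support (fun b => Int (fun a => f (a, b))).
Proof.
move=> bf; have ibf := bounded_support2_integrable bf; have [mf [C fC]] := bf.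
have C0 : 0 <= C by apply: le_trans (fC 0).1.
split.
  apply/measurable_EFinP; rewrite [X in measurable_fun _ X](_ : _ = fubini_G mu
    (EFin \o f)).
    exact: (measurable_fubini_G (m1 := mu) (m2 := mu)).
  by apply/funext => b; rewrite /= /fubini_G -Int_EFin//;
    exact: bounded_support2_section2.
exists (Num.max C (C * (C + C))) => b; split.
  rewrite le_max; apply/orP; right; apply: Int_bound;
    first exact: bounded_support2_section2.
  move=> a; split; first exact: (fC _).1.
  by move=> Ca; apply: (fC _).2; rewrite ltNge prod_norm_le negb_and -!ltNge Ca.
rewrite gt_max => /andP[Cb _]; rewrite (eq_Int (g := fun=> 0)); last first.
  by move=> a; apply: (fC _).2; rewrite ltNge prod_norm_le negb_and -!ltNge Cb
    orbT.
by rewrite /Int Rintegral_cst//= mul0r.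
Qed.

Lemma Int2_fubini1 f : bounded_support2 f ->
  Int2 f = Int (fun a => Int (fun b => f (a, b))).
Proof.
move=> bf; rewrite /Int2 [RHS]/Int /Rintegral; congr fine.
rewrite /lebesgue2 -integral12_prod_meas1;
  last exact: bounded_support2_integrable.
by apply: eq_integral => a _; rewrite /fubini_F -Int_EFin//;
  exact: bounded_support2_section1.
Qed.

Lemma Int2_fubini2 f : bounded_support2 f ->
  Int2 f = Int (fun b => Int (fun a => f (a, b))).
Proof.
move=> bf; rewrite /Int2 [RHS]/Int /Rintegral; congr fine.
rewrite /lebesgue2 -integral21_prod_meas1;
  last exact: bounded_support2_integrable.
by apply: eq_integral => b _; rewrite /fubini_G -Int_EFin//;
  exact: bounded_support2_section2.
Qed.

(** Measurability in the plane refers to the product sigma-algebra; an open set is the union of the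
    countably many squares with rational centre and half-side that it contains. *)
Lemma open_measurable2 (A : set (R * R)) : open A -> measurable (A : set T).
Proof.
move=> oA; pose B (q : (rat * rat) * rat) : set T :=
  ball (ratr q.1.1 : R) (ratr q.2) `*` ball (ratr q.1.2 : R) (ratr q.2).
rewrite (_ : A = \bigcup_q (if pselect (B q `<=` A) then B q else set0)).
  apply: countable_bigcupT_measurable => [|q]; first exact: countableP.
  case: pselect => [BA|nBA]; last exact: measurable0.
  by apply: measurableX; rewrite ball_itv; exact: measurable_itv.
apply/seteqP; split=> [z Az|z [q _]]; last by case: pselect => // BA /BA.
have /nbhs_ballP[e /= e0 eA] : nbhs z A by exact: open_nbhs_nbhs.
have e2 : 0 < e / 2 by lra.
have [r] := rat_in_itvoo e2.
rewrite in_itv/= => /andP[r0 re].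
have near_rat (x : R) : exists q : rat, `|ratr q - x| < ratr r.
  have xr : x - ratr r < x + ratr r by lra.
  have [q] := rat_in_itvoo xr.
  by rewrite in_itv/= -ltr_distl => ?; exists q.
have [q1 q1z] := near_rat z.1; have [q2 q2z] := near_rat z.2.
exists ((q1, q2), r) => //; case: pselect => [BA|[]]; first by split.
move=> y [/=]; rewrite /ball/= => y1 y2; apply: eA; split; rewrite /ball/=.
  have := ler_normD (z.1 - ratr q1) (ratr q1 - y.1);
    rewrite addrA subrK (distrC z.1 (ratr q1)); lra.
have := ler_normD (z.2 - ratr q2) (ratr q2 - y.2);
  rewrite addrA subrK (distrC z.2 (ratr q2)); lra.
Qed.

Lemma within_continuous_measurable2 (K : set (R * R)) g : closed K ->
  {within K, continuous g} -> measurable_fun (K : set T) g.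
Proof.
move=> cK /continuousP cg; apply: (measurability _ (RGenOpens.measurableE R)).
move=> _ [_ [a [b ->] <-]].
have /open_subspaceP[V oV VK] := cg _ (@interval_open R (BRight a) (BLeft b)
  isT isT).
rewrite setIC -VK; apply: measurableI; first exact: open_measurable2.
by rewrite -(setCK K); apply: measurableC; apply: open_measurable2;
  exact: closed_openC.
Qed.

End plane_integral.

(** * Integrals over parallel lines, in a frame adapted to the direction *)

Section radon.
Context {R : realType}.
Local Notation T := (measurableTypeR R * measurableTypeR R)%type.
Implicit Types (g : R * R -> R) (phi : R -> R) (x e w : R * R).

Lemma measurable_linear_form (p q : R) :
  measurable_fun (setT : set T) (fun z : T => p * z.1 + q * z.2).
Proof.
by apply: measurable_funD; apply: measurable_funM.
Qed.

Lemma norm_linear_form (p q C : R) (z : R * R) : `|z| <= C ->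
  `|p * z.1 + q * z.2| <= (`|p| + `|q|) * C.
Proof.
rewrite prod_norm_le => /andP[z1 z2]; rewrite (le_trans (ler_normD _ _))//.
by rewrite !normrM mulrDl lerD// ler_wpM2l.
Qed.

Lemma bounded_support2M phi g (p q : R) : locally_bounded phi ->
  bounded_support2 g ->
  bounded_support2 (fun z => phi (p * z.1 + q * z.2) * g z).
Proof.
move=> [mphi bphi] [mg [C gC]]; split.
  by apply: measurable_funM => //;
    exact: (measurableT_comp mphi (measurable_linear_form p q)).
have C0 : 0 <= C by apply: le_trans (gC 0).1.
have [D phiD] := bphi ((`|p| + `|q|) * C).
exists (Num.max C (D * C)) => z; split; last first.
  by rewrite gt_max => /andP[Cz _]; rewrite (gC z).2// mulr0.
have [zC|zC] := leP `|z| C.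
  rewrite normrM le_max; apply/orP; right; apply: ler_pM => //;
    last exact: (gC z).1.
  exact/phiD/norm_linear_form.
by rewrite (gC z).2// mulr0 normr0 le_max C0.
Qed.

Lemma bounded_support2_linear g (p q r t : R) : p * t - q * r != 0 ->
  bounded_support2 g ->
  bounded_support2 (fun z => g (p * z.1 + q * z.2, r * z.1 + t * z.2)).
Proof.
move=> d0 [mg [C gC]]; split.
  apply: (measurableT_comp mg); apply: measurable_fun_pair;
    exact: measurable_linear_form.
have C0 : 0 <= C by apply: le_trans (gC 0).1.
set d := p * t - q * r in d0.
(* The coefficients are those of the inverse matrix, so [D] bounds the preimage of the ball of
   radius [C]. *)
pose D := Num.max ((`|t / d| + `|- q / d|) * C) ((`|- r / d| + `|p / d|) * C).
exists (Num.max C D) => z; split; first by rewrite le_max (gC _).1.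
rewrite gt_max => /andP[_]; set y := (_, _) => Dz; apply: (gC _).2.
rewrite ltNge; apply: contraTN Dz => yC; rewrite -leNgt prod_norm_le !le_max.
have -> : z.1 = t / d * y.1 + - q / d * y.2 by rewrite /y/= /d; field.
have -> : z.2 = - r / d * y.1 + p / d * y.2 by rewrite /y/= /d; field.
by rewrite !norm_linear_form// orbT.
Qed.

Lemma frame_pointE e w (s t : R) :
  s *: e + t *: w = (s * e.1 + t * w.1, s * e.2 + t * w.2).
Proof. by []. Qed.

(** When [x . e = 1] and [x . w = 0], this is the integral over the line [x . y = s] up to a factor
    independent of [s]: [w] is not normalised, and the constant [c] of [radon_frame] compensates. *)
Definition slice g e w (s : R) : R := Int (fun t => g (s *: e + t *: w)).

Lemma bounded_support2_frame g e w : w.1 * e.2 - e.1 * w.2 != 0 ->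
  bounded_support2 g -> bounded_support2 (fun z => g (z.2 *: e + z.1 *: w)).
Proof.
move=> d0 /(bounded_support2_linear d0); congr bounded_support2.
by apply/funext => z; rewrite frame_pointE; congr (g (_, _)); ring.
Qed.

Lemma bounded_support_slice g e w : w.1 * e.2 - e.1 * w.2 != 0 ->
  bounded_support2 g -> bounded_support (slice g e w).
Proof. by move=> d0 /(bounded_support2_frame d0)/bounded_support2_Int2. Qed.

Lemma Int_slice phi g e w : w.1 * e.2 - e.1 * w.2 != 0 -> locally_bounded phi ->
  bounded_support2 g ->
  Int2 (fun z => phi z.2 * g (z.2 *: e + z.1 *: w)) =
  Int (fun s => phi s * slice g e w s).
Proof.
move=> d0 bphi bg; have bf := bounded_support2_frame d0 bg.
rewrite Int2_fubini2; last first.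
  have := bounded_support2M 0 1 bphi bf; congr bounded_support2.
  by apply/funext => z; rewrite mul0r mul1r add0r.
apply: eq_Int => s /=; rewrite IntZ//.
exact: (bounded_support2_section2 s bf).
Qed.

(* [e], [w] is a frame adapted to the lines [x . y = s]; taking [e] along a
   coordinate axis reduces the change of variables to a one-dimensional one
   and makes derivatives along [e] partial derivatives. *)
Lemma radon_frame x : unit_circle x -> exists (e w w' : R * R) (c : R),
  [/\ [/\ edot x e = 1, edot x w = 0, w.1 * e.2 - e.1 * w.2 != 0 & 0 < c],
      forall z, z = edot x z *: e + edot w' z *: w,
      edot w' w = 1 /\ edot w' e = 0,
      exists2 a : R, a != 0 & e = a *: (1, 0) \/ e = a *: (0, 1) &
      forall g phi, bounded_support2 g -> locally_bounded phi ->
        Int2 (fun y => phi (edot x y) * g y) =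
        c * Int (fun s => phi s * slice g e w s)].
Proof.
move=> x_unit.
have [x2|x2] := eqVneq x.2 0; last first.
  pose c := x.2^-1.
  have c0 : c != 0 by rewrite invr_eq0.
  exists (0, c), (1, - x.1 / x.2), (1, 0), `|c|; split.
  - rewrite /edot/= mulr0 add0r mul1r mul0r subr0 mulfV// mulr1; split=> //.
      by field.
    by rewrite normr_gt0.
  - by case=> z1 z2; rewrite frame_pointE /edot/= /c; congr pair; field.
  - by rewrite /edot/=; split; ring.
  - exists c => //; right; congr pair; rewrite /GRing.scale/= ?mulr0 ?mulr1//.
  move=> g phi bg bphi.
  have d0 : (1 : R) * c - 0 * (- x.1 / x.2) != 0 by rewrite mul1r mul0r subr0.
  have bf : bounded_support2
      (fun z => phi z.2 * g (z.2 *: (0, c) + z.1 *: (1, - x.1 / x.2))).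
    have := bounded_support2M 0 1 bphi
      (bounded_support2_frame (e := (0, c)) (w := (1, - x.1 / x.2)) d0 bg).
    congr bounded_support2; apply/funext => z; by rewrite mul0r mul1r add0r.
  rewrite -(Int_slice (e := (0, c)) (w := (1, - x.1 / x.2)) d0 bphi bg).
  rewrite Int2_fubini1; last exact: bounded_support2M.
  rewrite (Int2_fubini1 bf) -IntZ; last exact: (bounded_support2_Int1 bf).
  apply: eq_Int => a.
  (* For a fixed first coordinate [a], the equation [edot x y = s] is solved for the second
     coordinate, which is affine in [s]. *)
  rewrite (Int_affine (- (x.1 * a) / x.2) c0); last first.
    exact: (bounded_support2_section1 a (bounded_support2M x.1 x.2 bphi bg)).
  congr (_ * _); apply: eq_Int => s; congr (phi _ * g _).
    by rewrite /edot/= /c; field.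
  by rewrite frame_pointE /= /c; congr pair; field.
have x1 : x.1 != 0.
  apply/eqP => x1; move: x_unit; rewrite /unit_circle/= /enorm /edot x1 x2
    !mul0r addr0 sqrtr0.
  by move/eqP; rewrite eq_sym oner_eq0.
pose c := x.1^-1.
have c0 : c != 0 by rewrite invr_eq0.
have d0 : (0 : R) * 0 - c * 1 != 0 by rewrite mul0r sub0r mulr1 oppr_eq0.
exists (c, 0), (0, 1), (0, 1), `|c|; split.
- rewrite /edot/= mulr0 mulfV// x2 !mul0r addr0; split=> //.
  + by rewrite mulr0 addr0.
  + by rewrite sub0r mulr1 oppr_eq0.
  + by rewrite normr_gt0.
- by case=> z1 z2; rewrite frame_pointE /edot/= x2 /c; congr pair; field.
- by rewrite /edot/=; split; ring.
- exists c => //; left; congr pair; rewrite /GRing.scale/= ?mulr0 ?mulr1//.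
move=> g phi bg bphi.
have bf : bounded_support2 (fun z => phi z.2 * g (z.2 *: (c, 0) + z.1 *: (0,
  1))).
  have := bounded_support2M 0 1 bphi (bounded_support2_frame (e :=
    (c, 0)) (w := (0, 1)) d0 bg).
  congr bounded_support2; apply/funext => z; by rewrite mul0r mul1r add0r.
rewrite -(Int_slice (e := (c, 0)) (w := (0, 1)) d0 bphi bg).
rewrite Int2_fubini2; last exact: bounded_support2M.
rewrite (Int2_fubini1 bf) -IntZ; last exact: (bounded_support2_Int1 bf).
apply: eq_Int => b.
rewrite (Int_affine 0 c0); last first.
  exact: (bounded_support2_section2 b (bounded_support2M x.1 x.2 bphi bg)).
congr (_ * _); apply: eq_Int => s; congr (phi _ * g _).
  by rewrite /edot/= /c x2; field.
by rewrite frame_pointE /= /c; congr pair; field.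
Qed.

End radon.

(** * Local geometry of polygons *)

Section plane_vectors.
Context {R : realType}.
Implicit Types (u v : R * R) (t : R).

Lemma fstD u v : (u + v).1 = u.1 + v.1. Proof. by []. Qed.
Lemma sndD u v : (u + v).2 = u.2 + v.2. Proof. by []. Qed.
Lemma fstN u : (- u).1 = - u.1. Proof. by []. Qed.
Lemma sndN u : (- u).2 = - u.2. Proof. by []. Qed.
Lemma fstZ t u : (t *: u).1 = t * u.1. Proof. by []. Qed.
Lemma sndZ t u : (t *: u).2 = t * u.2. Proof. by []. Qed.
Definition vecE := (fstD, sndD, fstN, sndN, fstZ, sndZ).

Lemma vec_eq u v : u.1 = v.1 -> u.2 = v.2 -> u = v.
Proof. by case: u v => [? ?] [? ?] /= -> ->. Qed.

End plane_vectors.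

Ltac vec := apply: vec_eq; rewrite !vecE; try ring.

(** * A polygonal curve is locally a pair of rays *)

Section two_rays.
Context {R : realType}.
Implicit Types (A C : set (R * R)) (q z a b d : R * R) (r : R).

Lemma near_normV (V : pseudoMetricNormedZmodType R) (p : V) (P : V -> Prop) :
  (\forall u \near p, P u) <->
  exists2 r : R, 0 < r & forall u : V, `|u - p| < r -> P u.
Proof.
split=> [/nbhs_normP[r /= r0 rP]|[r r0 rP]].
  by exists r => // u ur; apply: rP; rewrite /ball_/= distrC.
by apply/nbhs_normP; exists r => //= u; rewrite /ball_/= distrC; exact: rP.
Qed.

Lemma near_norm q (P : R * R -> Prop) :
  (\forall z \near q, P z) <-> exists2 r, 0 < r & forall z, `|z - q| < r -> P z.
Proof. exact: near_normV. Qed.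

Lemma closed_avoid (I : finType) (P : pred I) (F : I -> set (R * R)) q :
  (forall i, P i -> closed (F i)) -> (forall i, P i -> ~ F i q) ->
  exists2 r, 0 < r & forall z, `|z - q| < r -> forall i, P i -> ~ F i z.
Proof.
move=> cF Fq; apply/near_norm.
suff H i : \forall z \near q, P i -> ~ F i z by exact: filter_forall H.
have [Pi|nP] := boolP (P i); last first.
  by apply/near_norm; exists 1 => // z _ Pi; rewrite Pi in nP.
have : nbhs q (~` F i) by apply: open_nbhs_nbhs; split;
  [exact/closed_openC/cF|exact: Fq].
by apply: filterS => z nF _.
Qed.

Lemma segmentE a b z : segment a b z <->
  exists2 t, 0 <= t <= 1 & z = a + t *: (b - a).
Proof.
split=> [[t /=]|[t t01 ->]]; first by rewrite in_itv/= => t01 <-; exists t.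
by exists t => //=; rewrite in_itv.
Qed.

Lemma segment_sym a b : segment a b = segment b a.
Proof.
suff S (u v : R * R) : segment u v `<=` segment v u by apply/seteqP; split;
  exact: S.
move=> z /segmentE[t /andP[t0 t1] ->]; apply/segmentE; exists (1 - t).
  by apply/andP; split; lra.
by vec.
Qed.

Lemma segment_start a b : segment a b a.
Proof. by apply/segmentE; exists 0; rewrite ?lexx ?ler01// scale0r addr0. Qed.

Lemma closed_segment a b : closed (segment a b).
Proof.
apply: compact_closed; first exact: norm_hausdorff.
apply: continuous_compact; last exact: segment_compact.
apply: continuous_subspaceT => t.
by apply: cvgD; [exact: cvg_cst|apply: cvgZ; [exact: cvg_id|exact: cvg_cst]].
Qed.

(** Opposite directions are allowed, as in the middle of an edge; only coinciding rays are
    excluded. *)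
Definition two_rays_at C q d1 d2 := exists r, [/\ d1 != 0, d2 != 0,
  forall c, 0 < c -> d2 <> c *: d1, 0 < r &
  forall z, `|z - q| < r -> C z <->
    (exists2 t, 0 <= t & z = q + t *: d1) \/ (exists2 t,
      0 <= t & z = q + t *: d2)].

Lemma two_rays_swap C q d1 d2 : two_rays_at C q d1 d2 -> two_rays_at C q d2 d1.
Proof.
move=> [r [d10 d20 npos r0 H]]; exists r; split=> // [c c0 E|z /H ->];
  last by split=> -[]; [right|left|right|left].
by apply: (npos c^-1); rewrite ?invr_gt0// E scalerA mulVf ?scale1r// gt_eqF.
Qed.

Lemma two_rays_of_segments C q p1 p2 r : p1 != q -> p2 != q ->
  (forall c, 0 < c -> p2 - q <> c *: (p1 - q)) -> 0 < r ->
  (forall z, `|z - q| < r -> C z <-> segment q p1 z \/ segment q p2 z) ->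
  two_rays_at C q (p1 - q) (p2 - q).
Proof.
move=> p1q p2q npos r0 Cz.
have d1 : 0 < `|p1 - q| by rewrite normr_gt0 subr_eq0.
have d2 : 0 < `|p2 - q| by rewrite normr_gt0 subr_eq0.
exists (Num.min r (Num.min `|p1 - q| `|p2 - q|)); split => //.
- by rewrite subr_eq0.
- by rewrite subr_eq0.
- by rewrite !lt_min r0 d1.
move=> z; rewrite !lt_min => /and3P[/Cz -> z1 z2].
have ray p : 0 < `|p - q| -> `|z - q| < `|p - q| ->
    segment q p z <-> exists2 t, 0 <= t & z = q + t *: (p - q).
  move=> dp zp; split=> [/segmentE[t /andP[t0 _] ->]|[t t0 zE]];
    first by exists t.
  apply/segmentE; exists t => //; rewrite t0/=.
  move: zp; rewrite zE addrAC subrr add0r normrZ (ger0_norm t0).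
  by rewrite gtr_pMl// => /ltW.
by rewrite !ray.
Qed.

(** The edges not containing [q] are finitely many closed sets and stay away from it. What remains
    is the two edges at a vertex, or one edge split at [q] into two opposite segments. *)
Lemma simple_closed_polygonal_curve_two_rays C :
  simple_closed_polygonal_curve C ->
  closed C /\ forall q, C q -> exists d1 d2, two_rays_at C q d1 d2.
Proof.
move=> [n [v]] [n3 vinj dis ->].
have clE : closed (\bigcup_i segment (v i) (v (ordS i))).
  by apply: closed_bigcup => [|i _];
    [exact: finite_finset|exact: closed_segment].
split=> // q [i _ qi].
have ordS_neq (j : 'I_n) : ordS j != j.
  rewrite -val_eqE /=; have jn := ltn_ord j.
  have [jn1|nj] := ltnP j.+1 n; first by rewrite modn_small// neq_ltn ltnSn
    orbT.
  have -> : j.+1 = n by apply/eqP; rewrite eqn_leq jn nj.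
  rewrite modnn; apply/eqP => j0; move: nj; rewrite -j0;
    case: (n) n3 => [|[|[]]]//.
have vert (j : 'I_n) : q = v j -> exists d1 d2,
    two_rays_at (\bigcup_i segment (v i) (v (ordS i))) q d1 d2.
  move=> qj; pose j' := ord_pred j.
  have j'K : ordS j' = j by exact: ord_predK.
  have jj' : j != j' by rewrite -{1}j'K ordS_neq.
  have [|k /andP[kj kj'] qk|r r0 far] :=
    @closed_avoid _ [pred k | (k != j) && (k != j')]
      (fun k => segment (v k) (v (ordS k))) q.
  - by move=> k _; exact: closed_segment.
  - have := dis j k; rewrite eq_sym => /(_ kj q)[].
      by split=> //; rewrite qj; exact: segment_start.
    move=> _ []; rewrite qj => /vinj E; first by rewrite E eqxx in kj.
    by move/eqP: kj'; apply; rewrite /j' E ordSK.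
  exists (v (ordS j) - q), (v j' - q).
  have vSq : v (ordS j) != q by rewrite qj (inj_eq vinj).
  have vpq : v j' != q by rewrite qj (inj_eq vinj) eq_sym.
  apply: (two_rays_of_segments vSq vpq _ r0).
    (* If the two edges at [q] had the same direction, the point with parameter [u] on one would
       have parameter [u / c] on the other. The choice of [u] makes both parameters legal and keeps
       the point off the ends, where alone the edges may meet. *)
    move=> c c0 E; pose u := Num.min 1 c / 2.
    have u0 : 0 < u by rewrite divr_gt0// lt_min ltr01.
    have u1 : u < 1 by have : Num.min 1 c <= 1 by [rewrite ge_min lexx];
      rewrite /u; lra.
    have uc : u / c <= 1.
      rewrite ler_pdivrMr// mul1r.
      have : Num.min 1 c <= c by [rewrite ge_min lexx orbT]; rewrite /u; lra.
    have [] := dis j j' jj' (q + u *: (v (ordS j) - q)).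
      split; first by rewrite -qj; apply/segmentE; exists u => //;
        rewrite ltW ?ltW.
      rewrite segment_sym j'K -qj; apply/segmentE; exists (u / c).
        by rewrite uc andbT divr_ge0// ltW.
      by rewrite E scalerA divfK// gt_eqF.
    move=> [] /eqP; rewrite -?qj.
      rewrite -[X in _ == X]addr0 (inj_eq (addrI q)) scaler_eq0 subr_eq0.
      by rewrite (negbTE vSq) orbF gt_eqF.
    rewrite -subr_eq0 (_ : _ - _ = (u - 1) *: (v (ordS j) - q)); last by vec.
    rewrite scaler_eq0 [X in _ || X]subr_eq0 (negbTE vSq) orbF => /eqP; lra.
  move=> z /far zfar; split=> [[k _ zk]|].
    have [kj|kj] := eqVneq k j; first by left; rewrite -kj in qj *; rewrite qj.
    have [kj'|kj'] := eqVneq k j'.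
      by right; rewrite segment_sym qj -j'K -kj'.
    by have := zfar k; rewrite /= kj kj' => /(_ isT).
  move=> [zj|zj]; first by exists j => //; rewrite -qj.
  by exists j' => //; rewrite j'K segment_sym -qj.
have [qvi|qvi] := eqVneq q (v i); first exact: vert qvi.
have [qvS|qvS] := eqVneq q (v (ordS i)); first exact: vert qvS.
move: (qi) => /segmentE[t /andP[t0 t1] qE].
set a := v i in qE qvi; set b := v (ordS i) in qE qvS.
have {}t0 : 0 < t.
  by rewrite lt_def t0 andbT; apply: contra qvi => /eqP t0';
    rewrite qE t0' scale0r addr0.
have {}t1 : t < 1.
  by rewrite lt_def t1 andbT; apply: contra qvS => /eqP t1';
    rewrite qE -t1' scale1r addrC subrK.
have bq : b - q = (1 - t) *: (b - a) by rewrite qE scalerBl scale1r opprD addrA.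
have aq : a - q = - t *: (b - a) by rewrite qE opprD addNKr scaleNr.
have ab0 : b - a != 0 by rewrite subr_eq0 (inj_eq vinj).
have [|k ki qk|r r0 far] := @closed_avoid _ [pred k | k != i]
    (fun k => segment (v k) (v (ordS k))) q.
- by move=> k _; exact: closed_segment.
- have := dis i k; rewrite eq_sym => /(_ ki q)[//|[] E _].
    by rewrite E eqxx in qvi.
  by rewrite /b E eqxx in qvS.
exists (b - q), (a - q); apply: (two_rays_of_segments _ _ _ r0).
- by rewrite eq_sym.
- by rewrite eq_sym.
- move=> c c0 /eqP; rewrite aq bq scalerA -subr_eq0 -scalerBl scaler_eq0
  (negbTE ab0) orbF.
  by move/eqP => E; have := mulr_gt0 c0 (_ : 0 < 1 - t);
    rewrite subr_gt0 => /(_ t1); lra.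
move=> z /far zfar; split=> [[k _ zk]|].
  have [ki|ki] := eqVneq k i; last by case: (zfar k ki zk).
  move: zk; rewrite ki => /segmentE[s /andP[s0 s1] zE].
  have zqE : z = q + (s - t) *: (b - a).
    by rewrite zE qE -addrA -scalerDl addrCA subrr addr0.
  have [ts|st] := leP t s.
    left; apply/segmentE; exists ((s - t) / (1 - t)).
      by rewrite divr_ge0 ?subr_ge0 ?(ltW t1)//= ler_pdivrMr ?subr_gt0// mul1r
        lerD2r.
    by rewrite bq scalerA divfK// subr_eq0 eq_sym lt_eqF.
  right; apply/segmentE; exists ((t - s) / t).
    by rewrite divr_ge0 ?subr_ge0 ?(ltW t0)
      ?(ltW st)//= ler_pdivrMr// mul1r lerBlDr lerDl.
  by rewrite aq scalerA mulrN divfK ?gt_eqF// opprB.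
move=> [] /segmentE[s /andP[s0 s1] zE]; exists i => //; apply/segmentE.
  exists (t + s * (1 - t)).
    have := mulr_ge0 s0 (ltW (_ : 0 < 1 - t)); rewrite subr_gt0 => /(_ t1).
    have : s * (1 - t) <= 1 * (1 - t) by rewrite ler_pM2r// subr_gt0.
    by move=> ? ?; apply/andP; split; lra.
  by rewrite zE bq scalerA qE -addrA -scalerDl.
exists (t - s * t).
  have := mulr_ge0 s0 (ltW t0).
  have : s * t <= 1 * t by rewrite ler_pM2r.
  by move=> ? ?; apply/andP; split; lra.
by rewrite zE aq scalerA qE -addrA -scalerDl mulrN.
Qed.

End two_rays.

Section boundaries.
Context {R : realType}.
Implicit Types (A C : set (R * R)) (q z y d : R * R) (r t : R).

Lemma closed_boundary A : closed (boundary A).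
Proof.
apply: closedI; first exact: closed_closure.
exact/open_closedC/open_interior.
Qed.

Lemma boundary_sub A : closed A -> boundary A `<=` A.
Proof. by move=> cA z [/cA]. Qed.

Lemma boundaryPn A z : closed A -> A z -> ~ boundary A z -> A° z.
Proof.
move=> cA Az nb; apply: contrapT => nI; apply: nb; split=> //.
exact: subset_closure.
Qed.

Section disjoint_family.
Context {I : finType} (F : I -> set (R * R)).
Hypotheses (cF : forall i, closed (F i))
  (dF : forall i j, i != j -> F i `&` F j = set0).

Lemma closed_family_bigcup : closed (\bigcup_i F i).
Proof. by apply: closed_bigcup => [|i _]; [exact: finite_finset|exact: cF]. Qed.

Lemma bigcup_local i q : F i q -> exists2 r, 0 < r &
  forall z, `|z - q| < r -> (\bigcup_i F i) z <-> F i z.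
Proof.
move=> Fq; have [|j ji Fjq|r r0 far] := @closed_avoid _ _ [pred j | j != i] F q.
- by move=> j _; exact: cF.
- by have : (F j `&` F i) q by []; rewrite dF.
exists r => // z /far zfar; split=> [[j _ Fj]|Fz]; last by exists i.
by have [<-//|ji] := eqVneq j i; case: (zfar j ji Fj).
Qed.

(** Near a point of one member the union coincides with that member, and being interior is a local
    property. *)
Lemma boundary_bigcup : boundary (\bigcup_i F i) = \bigcup_i boundary (F i).
Proof.
have near_iff q (U V : set (R * R)) r : 0 < r ->
    (forall z, `|z - q| < r -> U z <-> V z) -> U° q -> V° q.
  move=> r0 UV; rewrite /interior => /near_norm[r' r'0 Ur']; apply/near_norm.
  exists (Num.min r r'); first by rewrite lt_min r0.
  by move=> z; rewrite lt_min => /andP[/UV <- /Ur'].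
apply/seteqP; split=> [z zb|z [i _ zb]].
  have [i _ Fi] := boundary_sub closed_family_bigcup zb.
  exists i => //; split; first exact: subset_closure.
  have [r r0 H] := bigcup_local Fi; case: zb => _; apply: contra_not.
  by apply: (near_iff _ _ _ r) => // y yr; rewrite H.
have Fi := boundary_sub (@cF i) zb.
split; first by apply: subset_closure; exists i.
have [r r0 H] := bigcup_local Fi; case: zb => _; apply: contra_not.
exact: (near_iff _ _ _ r).
Qed.

Lemma two_rays_bigcup : (forall i q, F i q ->
  exists d1 d2, two_rays_at (F i) q d1 d2) ->
  forall q, (\bigcup_i F i) q -> exists d1 d2,
    two_rays_at (\bigcup_i F i) q d1 d2.
Proof.
move=> tr q [i _ Fq]; have [d1 [d2 [r [d10 d20 npos r0 H]]]] := tr i q Fq.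
have [r' r'0 H'] := bigcup_local Fq.
exists d1, d2, (Num.min r r'); split=> //; first by rewrite lt_min r0.
by move=> z; rewrite lt_min => /andP[/H Hz /H' ->].
Qed.

End disjoint_family.

(* Local geometry of a polygon: no isolated pieces of lower dimension, and a
   boundary that is locally a pair of rays. *)
Definition polygonal A := [/\ closed A, A `<=` closure A° &
  forall q, boundary A q -> exists d1 d2, two_rays_at (boundary A) q d1 d2].

Lemma polygon_polygonal A : polygon A -> polygonal A.
Proof.
move=> [cA AE _ [K [C [sC dC bC]]]]; split.
- by apply: compact_closed => //; exact: norm_hausdorff.
- by rewrite -AE.
- move=> q; rewrite bC; apply: two_rays_bigcup => //.
    by move=> k; have [] := simple_closed_polygonal_curve_two_rays (sC k).
  by move=> k p; have [_] := simple_closed_polygonal_curve_two_rays (sC k);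
    apply.
Qed.

Lemma polygonal_bigcup (I : finType) (F : I -> set (R * R)) :
  (forall i, polygonal (F i)) -> (forall i j, i != j -> F i `&` F j = set0) ->
  polygonal (\bigcup_i F i).
Proof.
move=> pF dF; have cF i : closed (F i) by have [] := pF i.
split; first exact: closed_family_bigcup.
- move=> z [i _ Fi]; have [_ /(_ z Fi) + _] := pF i; apply: closure_subset.
  by apply: interiorS => y Fy; exists i.
- move=> q; rewrite boundary_bigcup//; apply: two_rays_bigcup.
  + by move=> i; exact: closed_boundary.
  + move=> i j ij; apply/seteqP; split=> // z [/(boundary_sub (cF i)) zi].
    move=> /(boundary_sub (cF j)) zj.
    by have : (F i `&` F j) z by []; rewrite dF.
  + by move=> i p; have [_ _] := pF i; apply.
Qed.

(** The segment from [y] to [z] is connected and misses the boundary, so its trace on [A] is both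
    open and closed in it. *)
Lemma convex_boundary_free A (K : R * R -> Prop) : closed A ->
  (forall z, K z -> ~ boundary A z) ->
  (forall y z t, K y -> K z -> 0 <= t <= 1 -> K (y + t *: (z - y))) ->
  forall y z, K y -> K z -> A y -> A z.
Proof.
move=> cA Kb Kc y z Ky Kz Ay.
pose D : set (R * R) := [set y + t *: (z - y) | t in `[0, 1]%classic].
have cD : connected D.
  apply: connected_continuous_connected; first exact: segment_connected.
  apply: continuous_subspaceT => t.
  by apply: cvgD; [exact: cvg_cst|apply: cvgZ; [exact: cvg_id|exact: cvg_cst]].
have DK p : D p -> K p by move=> [t /=]; rewrite in_itv/= => t01 <-; exact: Kc.
have AI : D `&` A = D `&` A°.
  apply/seteqP; split=> p [Dp]; last by move=> /interior_subset.
  by move=> Ap; split=> //; apply: boundaryPn => //; apply: Kb; exact: DK.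
have DA : D `&` A = D.
  apply: cD.
  - exists y; split=> //; exists 0; first by rewrite /= in_itv/= lexx ler01.
    by rewrite scale0r addr0.
  - by exists A°; [exact: open_interior|].
  - by exists A.
have : D z by exists 1; [rewrite /= in_itv/= lexx ler01|rewrite scale1r addrC
  subrK].
by rewrite -DA => -[].
Qed.

Lemma ball_convex q r y z t : `|y - q| < r -> `|z - q| < r -> 0 <= t <= 1 ->
  `|y + t *: (z - y) - q| < r.
Proof.
move=> yr zr /andP[t0 t1].
have -> : y + t *: (z - y) - q = (1 - t) *: (y - q) + t *: (z - q) by vec.
rewrite (le_lt_trans (ler_normD _ _))// !normrZ !ger0_norm ?subr_ge0//.
have [->|tn1] := eqVneq t 1; first by rewrite subrr mul0r add0r mul1r.
have t1' : 0 < 1 - t by rewrite subr_gt0 lt_def eq_sym tn1.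
have : (1 - t) * `|y - q| < (1 - t) * r by rewrite ltr_pM2l.
have : t * `|z - q| <= t * r by rewrite ler_wpM2l// ltW.
lra.
Qed.

(** The first point exists because [A] lies in the closure of its interior, the second because [q]
    is not interior. With [convex_boundary_free] they decide which local pieces of the complement of
    the boundary belong to [A]. *)
Lemma boundary_mixed A q r : closed A -> A `<=` closure A° -> boundary A q ->
  0 < r ->
  (exists z, [/\ `|z - q| < r, ~ boundary A z & A z]) /\
  (exists z, [/\ `|z - q| < r, ~ boundary A z & ~ A z]).
Proof.
move=> cA AI bq r0.
have nr : nbhs q [set z | `|z - q| < r] by apply/near_norm; exists r.
split.
  have [z [Iz zr]] := AI _ (boundary_sub cA bq) _ nr.
  by exists z; split=> //; [move=> [_]; apply|exact: interior_subset].
apply: contrapT => H; case: bq => _; apply; apply: filterS nr => z /= zr.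
apply: contrapT => nAz; apply: H; exists z; split=> //.
by move=> /(boundary_sub cA).
Qed.

End boundaries.

(** * Near a boundary point the set is a half-plane, a sector or the complement of one *)

Section local_shape.
Context {R : realType}.
Implicit Types (A : set (R * R)) (q z y d n : R * R) (r t : R).

Definition det2 (u v : R * R) : R := u.1 * v.2 - u.2 * v.1.

Lemma det2D_eq d1 d2 z : det2 d1 d2 != 0 ->
  z = (det2 z d2 / det2 d1 d2) *: d1 + (det2 d1 z / det2 d1 d2) *: d2.
Proof. by rewrite /det2 => d0; apply: vec_eq; rewrite !vecE; field. Qed.

Lemma det2_eq0 d1 d2 : d1 != 0 -> det2 d1 d2 = 0 -> exists c, d2 = c *: d1.
Proof.
move=> d10; rewrite /det2 => d0.
have s0 : d1.1 ^+ 2 + d1.2 ^+ 2 != 0.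
  apply: contra d10; rewrite paddr_eq0 ?sqr_ge0// !sqrf_eq0 => /andP[/eqP ?
    /eqP ?].
  by apply/eqP/vec_eq.
exists ((d1.1 * d2.1 + d1.2 * d2.2) / (d1.1 ^+ 2 + d1.2 ^+ 2)).
apply: vec_eq; rewrite !vecE; apply: (mulIf s0);
  rewrite mulrAC divfK//.
  rewrite (_ : d2.1 * _ = (d1.1 * d2.1 + d1.2 * d2.2)
    * d1.1 - d1.2 * (d1.1 * d2.2 - d1.2 * d2.1)); last by ring.
  by rewrite d0 mulr0 subr0.
rewrite (_ : d2.2 * _ = (d1.1 * d2.1 + d1.2 * d2.2)
  * d1.2 + d1.1 * (d1.1 * d2.2 - d1.2 * d2.1)); last by ring.
by rewrite d0 mulr0 addr0.
Qed.

Lemma convex_linear_cond (u : R * R) q y z t : 0 <= t <= 1 ->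
  0 < edot u (y - q) -> 0 < edot u (z - q) -> 0 < edot u (y + t *: (z - y) - q).
Proof.
move=> /andP[t0 t1] y0 z0.
rewrite (_ : edot _ _ = (1 - t) * edot u (y - q) + t * edot u (z - q));
  last first.
  by rewrite /edot !vecE; ring.
have [->|tn1] := eqVneq t 1; first by rewrite subrr mul0r add0r mul1r.
have t1' : 0 < 1 - t by rewrite subr_gt0 lt_def eq_sym tn1.
have := mulr_gt0 t1' y0; have := mulr_ge0 t0 (ltW z0); lra.
Qed.

Lemma edot_gt0 d : d != 0 -> 0 < edot d d.
Proof.
move=> d0; rewrite lt_def; apply/andP; split; last first.
  by rewrite /edot addr_ge0// -expr2 sqr_ge0.
apply: contra d0; rewrite /edot -!expr2 paddr_eq0 ?sqr_ge0// !sqrf_eq0.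
by move=> /andP[/eqP ? /eqP ?]; apply/eqP/vec_eq.
Qed.

Lemma small_step q d r : 0 < r -> exists2 t, 0 < t & `|q + t *: d - q| < r.
Proof.
move=> r0; exists (r / (`|d| + 1)); first by rewrite divr_gt0// ltr_wpDl.
have d1 : 0 < `|d| + 1 by rewrite ltr_wpDl.
rewrite addrAC subrr add0r normrZ gtr0_norm ?divr_gt0// mulrAC ltr_pdivrMr//.
by rewrite ltr_pM2l// ltrDl.
Qed.

(** The line along [d] cuts the ball into two convex halves free of boundary. Each is inside or
    outside [A], and [boundary_mixed] forces them to differ; the sign of [n] is chosen
    afterwards. *)
Lemma half_plane_local A q d c : closed A -> A `<=` closure A° ->
  boundary A q ->
  two_rays_at (boundary A) q d (- c *: d) -> 0 < c ->
  exists n r, [/\ n != 0, edot n d = 0, 0 < r,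
    forall z, `|z - q| < r -> A z <-> edot n (z - q) <= 0 &
    forall z, `|z - q| < r -> boundary A z -> edot n (z - q) = 0].
Proof.
move=> cA AI bq [r [d0 _ _ r0 bE]] c0; pose n := rot90 d.
have nd : edot n d = 0 by rewrite /edot/=; ring.
have n0 : n != 0.
  by apply: contra d0 => /eqP [/eqP]; rewrite oppr_eq0 => /eqP ? ?;
    apply/eqP/vec_eq.
have bn z : `|z - q| < r -> boundary A z <-> edot n (z - q) = 0.
  move=> /bE ->; split=> [[] [t t0 ->]|zn].
  - by rewrite addrAC subrr add0r /edot !vecE /=; ring.
  - by rewrite addrAC subrr add0r /edot !vecE /=; ring.
  have [t zt] : exists t, z - q = t *: d.
    by apply: det2_eq0 => //; move: zn; rewrite /det2 /edot/=; lra.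
  have {}zt : z = q + t *: d by rewrite -zt addrC subrK.
  have [t0|t0] := leP 0 t; first by left; exists t.
  right; exists (- t / c); first by rewrite divr_ge0 ?oppr_ge0 ?ltW.
  by rewrite scalerA (_ : - t / c * - c = t)//; field; rewrite gt_eqF.
pose P z := `|z - q| < r /\ 0 < edot n (z - q).
pose N z := `|z - q| < r /\ 0 < edot (- n) (z - q).
have PN z : edot (- n) z = - edot n z by rewrite /edot !vecE; ring.
have Pc y z : P y -> P z -> A y -> A z.
  apply: convex_boundary_free => // [u [/bn -> ?]|u v t [u1 u2] [v1 v2] t01].
    by apply/eqP; rewrite gt_eqF.
  by split; [exact: ball_convex|exact: convex_linear_cond].
have Nc y z : N y -> N z -> A y -> A z.
  apply: convex_boundary_free => // [u [/bn ->]|u v t [u1 u2] [v1 v2] t01].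
    by rewrite PN => n1 n2; move: n1; rewrite n2 oppr0 ltxx.
  by split; [exact: ball_convex|exact: convex_linear_cond].
have [[z1 [z1r nb1 Az1]] [z2 [z2r nb2 nAz2]]] := boundary_mixed cA AI bq r0.
have side z : `|z - q| < r -> ~ boundary A z -> P z \/ N z.
  move=> zr; rewrite bn// => /eqP; rewrite neq_lt => /orP[] zn; [right|left];
    split => //.
  by rewrite PN oppr_gt0.
have sA z : `|z - q| < r -> edot n (z - q) = 0 -> A z.
  by move=> zr /(bn _ zr)/(boundary_sub cA).
have fin (m : R * R) : (m = n \/ m = - n) ->
    (forall z, `|z - q| < r -> edot m (z - q) < 0 -> A z) ->
    (forall z, `|z - q| < r -> 0 < edot m (z - q) -> ~ A z) ->
    exists n r, [/\ n != 0, edot n d = 0, 0 < r,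
      forall z, `|z - q| < r -> A z <-> edot n (z - q) <= 0 &
      forall z, `|z - q| < r -> boundary A z -> edot n (z - q) = 0].
  move=> mn mA mnA; exists m, r.
  have m0 z : edot m z = 0 <-> edot n z = 0.
    by case: mn => -> //; rewrite PN; split=> [/eqP|->];
      rewrite ?oppr0// oppr_eq0 => /eqP.
  split=> //; first by case: mn => ->; rewrite ?oppr_eq0.
  - exact/m0.
  - move=> z zr; split=> [Az|]; first by rewrite leNgt;
    apply/negP => /(mnA _ zr).
    rewrite le_eqVlt => /predU1P[/m0/(sA _ zr)//|]; exact: mA.
  - by move=> z zr /(bn _ zr)/m0.
case: (side _ z1r nb1) => [P1|N1].
- apply: (fin (- n)); first by right.
    by move=> z zr; rewrite PN oppr_lt0 => zn; apply: (Pc z1).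
  move=> z zr zn Az; apply: nAz2; case: (side _ z2r nb2) => [P2|N2].
    exact: (Pc z1).
  exact: (Nc z).
- apply: (fin n); first by left.
    by move=> z zr zn; apply: (Nc z1) => //; split=> //; rewrite PN oppr_gt0.
  move=> z zr zn Az; apply: nAz2; case: (side _ z2r nb2) => [P2|N2].
    exact: (Pc z).
  exact: (Nc z1).
Qed.

(** [a] and [b] are the coordinates of [z - q] in the basis [d1], [d2], and the boundary consists of
    the two nonnegative half-axes. The outside of the sector is not convex, but it is the union of
    the convex pieces [a < 0] and [b < 0], which overlap. *)
Lemma sector_local A q d1 d2 : closed A -> A `<=` closure A° -> boundary A q ->
  two_rays_at (boundary A) q d1 d2 -> det2 d1 d2 != 0 ->
  let a z := det2 (z - q) d2 / det2 d1 d2 in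
  let b z := det2 d1 (z - q) / det2 d1 d2 in
  exists2 r, 0 < r &
    (forall z, `|z - q| < r -> A z <-> 0 <= a z /\ 0 <= b z) \/
    (forall z, `|z - q| < r -> A z <-> ~ (0 < a z /\ 0 < b z)).
Proof.
move=> cA AI bq [r [d10 d20 _ r0 bE]] D0 a b.
have zE z : z - q = a z *: d1 + b z *: d2 by exact: det2D_eq.
have abE s t : a (q + (s *: d1 + t *: d2)) = s /\ b (q + (s *: d1 + t *: d2))
  = t.
  have -> : s = s * det2 d1 d2 / det2 d1 d2 by rewrite mulfK.
  have -> : t = t * det2 d1 d2 / det2 d1 d2 by rewrite mulfK.
  by rewrite /a /b; split; congr (_ / _); rewrite mulfK// mulfK// /det2 !vecE;
    ring.
have bn z : `|z - q| < r -> boundary A z <->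
    (0 <= a z /\ b z = 0) \/ (a z = 0 /\ 0 <= b z).
  move=> zr; rewrite bE//; split=> [[] [t t0 ->]|[] [za zb]].
  - by have [] := abE t 0; rewrite scale0r addr0 => -> ->; left.
  - by have [] := abE 0 t; rewrite scale0r add0r => -> ->; right.
  - by left; exists (a z) => //; have := zE z; rewrite zb scale0r addr0 => <-;
    rewrite addrC subrK.
  - by right; exists (b z) => //; have := zE z;
    rewrite za scale0r add0r => <-; rewrite addrC subrK.
have aconv y z t : a (y + t *: (z - y)) = (1 - t) * a y + t * a z.
  by rewrite /a /det2 !vecE; ring.
have bconv y z t : b (y + t *: (z - y)) = (1 - t) * b y + t * b z.
  by rewrite /b /det2 !vecE; ring.
have pos (s t u : R) : 0 <= t <= 1 -> 0 < s -> 0 < u -> 0 < (1 - t) * s + t * u.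
  move=> /andP[t0 t1] s0 u0; have [->|tn1] := eqVneq t 1.
    by rewrite subrr mul0r add0r mul1r.
  have t1' : 0 < 1 - t by rewrite subr_gt0 lt_def eq_sym tn1.
  by have := mulr_gt0 t1' s0; have := mulr_ge0 t0 (ltW u0); lra.
pose K z := `|z - q| < r /\ (0 < a z /\ 0 < b z).
pose La z := `|z - q| < r /\ 0 < - a z.
pose Lb z := `|z - q| < r /\ 0 < - b z.
have Kc y z : K y -> K z -> A y -> A z.
  apply: convex_boundary_free => // [u [/bn ->
    ?]|u v t [u1 [u2 u3]] [v1 [v2 v3]] t01].
    by move=> [] []; lra.
  by split; [exact: ball_convex|rewrite aconv bconv; split; exact: pos].
have Lac y z : La y -> La z -> A y -> A z.
  apply: convex_boundary_free => // [u [/bn -> ?]|u v t [u1 u2] [v1 v2] t01].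
    by move=> [] []; lra.
  split; [exact: ball_convex|rewrite aconv].
  by have := pos _ _ _ t01 u2 v2; lra.
have Lbc y z : Lb y -> Lb z -> A y -> A z.
  apply: convex_boundary_free => // [u [/bn -> ?]|u v t [u1 u2] [v1 v2] t01].
    by move=> [] []; lra.
  split; [exact: ball_convex|rewrite bconv].
  by have := pos _ _ _ t01 u2 v2; lra.
have [t t0 tr] := small_step q (- d1 - d2) r0.
(* A point common to both pieces, through which membership in [A] passes from one to the other. *)
pose m := q + t *: (- d1 - d2).
have [ma mb] : a m = - t /\ b m = - t.
  have [] := abE (- t) (- t); rewrite (_ : q + (_ + _) = m) //.
  by rewrite /m scalerBr scalerN !scaleNr.
have mLa : La m by split=> //; rewrite ma opprK.
have mLb : Lb m by split=> //; rewrite mb opprK.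
pose L z := La z \/ Lb z.
have Lc y z : L y -> L z -> A y -> A z.
  move=> Ly Lz Ay.
  have Am : A m by case: Ly => Ly; [apply: (Lac y)|apply: (Lbc y)].
  by case: Lz => Lz; [apply: (Lac m)|apply: (Lbc m)].
have side z : `|z - q| < r -> ~ boundary A z -> K z \/ L z.
  move=> zr; rewrite bn// => nb.
  have [az|az] := ltP (a z) 0; first by right; left; split=> //;
    rewrite oppr_gt0.
  have [bz|bz] := ltP (b z) 0; first by right; right; split=> //;
    rewrite oppr_gt0.
  left; split=> //; split; rewrite lt_def ?az ?bz andbT; apply/eqP => e0;
    apply: nb.
    by right.
  by left.
have sA z : `|z - q| < r -> boundary A z -> A z by move=> _ /(boundary_sub cA).
have [[z1 [z1r nb1 Az1]] [z2 [z2r nb2 nAz2]]] := boundary_mixed cA AI bq r0.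
exists r => //; case: (side _ z1r nb1) => [K1|L1].
- left=> z zr; split=> [Az|[az bz]].
    have nL : ~ L z.
      move=> Lz; apply: nAz2; case: (side _ z2r nb2) => [K2|L2].
        exact: (Kc z1).
      exact: (Lc z).
    split; rewrite leNgt; apply/negP => lt0; apply: nL; [left|right];
      by split=> //; rewrite oppr_gt0.
  have [bz'|nbz] := pselect (boundary A z); first exact: sA.
  case: (side _ zr nbz) => [Kz|[[_ ?]|[_ ?]]]; [exact: (Kc z1)|lra|lra].
- right=> z zr; split=> [Az Kz|nK].
    apply: nAz2; case: (side _ z2r nb2) => [K2|L2]; last exact: (Lc z1).
    by apply: (Kc z).
  have [bz'|nbz] := pselect (boundary A z); first exact: sA.
  case: (side _ zr nbz) => [[_ Kz] //|Lz]; exact: (Lc z1).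
Qed.

End local_shape.

(** * Corners in terms of the two rays *)

Section corner_classification.
Context {R : realType}.
Implicit Types (A C : set (R * R)) (q z d n : R * R).

Lemma two_rays_dichotomy C q d1 d2 : two_rays_at C q d1 d2 ->
  det2 d1 d2 != 0 \/ exists2 c, 0 < c & d2 = - c *: d1.
Proof.
move=> [r [d10 d20 npos _ _]]; have [D0|D0] := eqVneq (det2 d1 d2) 0;
  last by left.
right; have [c cE] := det2_eq0 d10 D0.
exists (- c); last by rewrite opprK.
rewrite oppr_gt0 lt_neqAle; apply/andP; split.
  by apply: contra d20 => /eqP c0; rewrite cE c0 scale0r.
by rewrite leNgt; apply/negP => /npos /(_ cE).
Qed.

Lemma continuous_edot (n q z : R * R) : {for z,
  continuous (fun y : R * R => edot n (y - q))}.
Proof.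
apply: cvgD; apply: cvgM; try exact: cvg_cst.
  by apply: cvgB; [exact: cvg_fst|exact: cvg_cst].
by apply: cvgB; [exact: cvg_snd|exact: cvg_cst].
Qed.

Lemma continuous_enorm (q z : R * R) : {for z,
  continuous (fun y : R * R => enorm (y - q))}.
Proof.
have c1 : (fun y : R * R => (y - q).1) y @[y --> z] --> (z - q).1.
  by apply: cvgB; [exact: cvg_fst|exact: cvg_cst].
have c2 : (fun y : R * R => (y - q).2) y @[y --> z] --> (z - q).2.
  by apply: cvgB; [exact: cvg_snd|exact: cvg_cst].
have cdot : (fun y : R * R => edot (y - q) (y - q)) y @[y --> z] -->
  edot (z - q) (z - q).
  by apply: cvgD; apply: cvgM.
exact: (cvg_comp _ _ cdot (@sqrt_continuous R _)).
Qed.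

Lemma enormZ (t : R) d : 0 <= t -> enorm (t *: d) = t * enorm d.
Proof.
move=> t0; rewrite /enorm (_ : edot _ _ = t ^+ 2 * edot d d);
  last by rewrite /edot !vecE; ring.
by rewrite sqrtrM ?sqr_ge0// sqrtr_sqr ger0_norm.
Qed.

(** If [edot n d] were nonzero, a boundary point [q + t d] with small [t] would lie strictly inside
    one of the two cones on which the unit normal makes [A] locally full or empty, so it would be
    interior or exterior. *)
Lemma unit_normal_tangent A q n d d' : closed A -> unit_normal A q n ->
  two_rays_at (boundary A) q d d' -> edot n d = 0.
Proof.
move=> cA [n1 nA] [r [d0 _ _ r0 bE]].
have ed0 : 0 < enorm d by rewrite sqrtr_gt0 edot_gt0.
apply/eqP; apply: contraT => nd0.
have nd_gt0 : 0 < `|edot n d| by rewrite normr_gt0.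
(* Half the ratio of [|n . (y - q)|] to [enorm (y - q)] along the ray, leaving a strict gap that
   persists near [y]. *)
pose e := `|edot n d| / 2 / enorm d.
have e0 : 0 < e by rewrite !divr_gt0.
have /near_norm[r' r'0 H] := nA e e0.
have rr0 : 0 < Num.min r r' by rewrite lt_min r0.
have [t t0] := small_step q d rr0; rewrite lt_min => /andP[tr tr'].
pose y := q + t *: d.
have by_ : boundary A y by apply/(bE _ tr); left; exists t => //; exact: ltW.
have yq : y - q = t *: d by rewrite /y addrAC subrr add0r.
have ndy : edot n (y - q) = t * edot n d by rewrite yq /edot !vecE; ring.
have ey : e * enorm (y - q) = t * (`|edot n d| / 2).
  by rewrite yq enormZ ?ltW// /e mulrCA divfK// gt_eqF.
have tn : 0 < t * `|edot n d| by rewrite mulr_gt0.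
have ball_y : \forall z \near y, `|z - q| < r'.
  apply/near_norm; exists (r' - `|y - q|); first by rewrite subr_gt0.
  move=> z zy; have := ler_normD (z - y) (y - q); rewrite addrA subrK; lra.
have cl := @continuous_edot n q y.
have ce := @continuous_enorm q y.
have [nd|nd] := ltP (edot n d) 0.
  have gap : edot n (y - q) + e * enorm (y - q) < 0.
    rewrite ndy ey ltr0_norm//; have : 0 < t * - edot n d by rewrite mulr_gt0//
      oppr_gt0.
    lra.
  have : \forall z \near y, edot n (z - q) + e * enorm (z - q) < 0.
    have cg : (fun z => edot n (z - q) + e * enorm (z - q)) z @[z --> y] -->
        edot n (y - q) + e * enorm (y - q).
      by apply: cvgD => //; apply: cvgM => //; exact: cvg_cst.
    by move: cg => /cvgr_lt /(_ 0 gap).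
  move=> gapz; case: by_ => _; case.
  apply: filterS2 ball_y gapz => z zr zg; have [] := H z zr => HA _; apply: HA.
  lra.
have {}nd : 0 < edot n d by rewrite lt_def nd0.
have gap : 0 < edot n (y - q) - e * enorm (y - q).
  by rewrite ndy ey gtr0_norm//; rewrite gtr0_norm// in tn; lra.
have gapz : \forall z \near y, 0 < edot n (z - q) - e * enorm (z - q).
  have cg : (fun z => edot n (z - q) - e * enorm (z - q)) z @[z --> y] -->
      edot n (y - q) - e * enorm (y - q).
    by apply: cvgB => //; apply: cvgM => //; exact: cvg_cst.
  by move: cg => /cvgr_gt /(_ 0 gap).
have nA_near : \forall z \near y, ~ A z.
  apply: filterS2 ball_y gapz => z zr zg; have [_] := H z zr; apply; lra.
by have [z [Az /(_ Az)]] := by_.1 _ nA_near.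
Qed.

(** A normal orthogonal to two independent directions is zero, so no unit normal exists at [q] at
    all. *)
Lemma independent_rays_corner A q d1 d2 : closed A -> boundary A q ->
  two_rays_at (boundary A) q d1 d2 -> det2 d1 d2 != 0 -> corners A q.
Proof.
move=> cA bq tr D0; split=> // -[nu [nearb _]].
have un : unit_normal A q (nu q) by exact: (nbhs_singleton nearb).
have n1 := unit_normal_tangent cA un tr.
have n2 := unit_normal_tangent cA un (two_rays_swap tr).
have n0 : nu q = 0.
  move: n1 n2 D0; rewrite /edot /det2;
    move: (nu q).1 (nu q).2 (surjective_pairing (nu q)) => a b -> n1 n2 D0.
  have aD : a * (d1.1 * d2.2 - d1.2 * d2.1) = d2.2 * (a * d1.1 + b * d1.2)
    - d1.2 * (a * d2.1 + b * d2.2).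
    by ring.
  have bD : b * (d1.1 * d2.2 - d1.2 * d2.1) = d1.1 * (a * d2.1 + b * d2.2)
    - d2.1 * (a * d1.1 + b * d1.2).
    by ring.
  move: aD bD; rewrite n1 n2 !mulr0 subrr => /eqP;
    rewrite mulf_eq0 (negbTE D0) orbF => /eqP ->.
  by move/eqP; rewrite mulf_eq0 (negbTE D0) orbF => /eqP ->.
move: un => [+ _]; rewrite n0 /enorm /edot/= mulr0 addr0 sqrtr0.
by move/eqP; rewrite eq_sym oner_eq0.
Qed.

(** Near [q] the set is a half-plane, so one constant vector is the unit normal at every nearby
    boundary point. *)
Lemma antiparallel_rays_not_corner A q d c : polygonal A -> boundary A q ->
  two_rays_at (boundary A) q d (- c *: d) -> 0 < c -> ~ corners A q.
Proof.
move=> [cA AI _] bq tr c0 [_]; apply.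
have [n [r [n0 nd r0 An bn]]] := half_plane_local cA AI bq tr c0.
have en0 : 0 < enorm n by rewrite sqrtr_gt0 edot_gt0.
pose m := (enorm n)^-1 *: n.
have mE z : edot m z = (enorm n)^-1 * edot n z by rewrite /edot !vecE; ring.
exists (fun=> m); split; last exact: cvg_cst.
apply/near_norm; exists r => // z zr bz; split.
  by rewrite enormZ ?invr_ge0 ?ltW// mulVf// gt_eqF.
move=> e e0; apply/near_norm; exists (r - `|z - q|); first by rewrite subr_gt0.
move=> y yz.
have yr : `|y - q| < r by have := ler_normD (y - z) (z - q);
  rewrite addrA subrK; lra.
have mn : edot m (y - z) = (enorm n)^-1 * edot n (y - q).
  rewrite mE; congr (_ * _); have := bn _ zr bz; rewrite /edot !vecE; lra.
have ez : 0 <= e * enorm (y - z) by rewrite mulr_ge0 ?sqrtr_ge0// ltW.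
split=> [lt|gt].
  apply/(An _ yr); rewrite leNgt; apply/negP => gt0.
  have : 0 < edot m (y - z) by rewrite mn mulr_gt0// invr_gt0.
  by lra.
move=> /(An _ yr) le0.
have : edot m (y - z) <= 0 by rewrite mn mulr_ge0_le0// invr_ge0 ltW.
by lra.
Qed.

Lemma noncorner_antiparallel A q d1 d2 : polygonal A -> boundary A q ->
  two_rays_at (boundary A) q d1 d2 -> ~ corners A q ->
  exists2 c, 0 < c & d2 = - c *: d1.
Proof.
move=> [cA _ _] bq tr nc; have [D0|//] := two_rays_dichotomy tr.
by case: nc; exact: independent_rays_corner tr D0.
Qed.

(* Follow the straight boundary piece leaving [q]: it has to stop, and it can
   only stop at a corner. *)
Lemma ray_ends_at_corner A q d d' (B : R) : polygonal A ->
  (forall z, A z -> `|z| <= B) -> boundary A q ->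
  two_rays_at (boundary A) q d d' -> exists2 t, 0 < t & corners A (q + t *: d).
Proof.
move=> pA AB bq [r [d0 _ _ r0 bE]]; have [cA AI trA] := pA.
have dn : 0 < `|d| by rewrite normr_gt0.
(* The lengths up to which the ray stays in the boundary. Their supremum is finite because [A] is
   bounded, and it is attained because the boundary is closed. *)
pose T : set R := [set t | 0 <= t /\ forall t', 0 <= t' <= t ->
  boundary A (q + t' *: d)].
have [t1 t10 t1T] : exists2 t1, 0 < t1 & T t1.
  have [t t0 tr] := small_step q d r0.
  exists t => //; split=> [|t' /andP[t'0 t't]]; first exact: ltW.
  apply/bE; last by left; exists t'.
  have tq (s : R) : q + s *: d - q = s *: d by vec.
  move: tr; rewrite !tq !normrZ; apply: le_lt_trans.
  by rewrite ler_pM2r// !ger0_norm// ltW.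
have hT : has_sup T.
  split; first by exists t1.
  exists ((B + `|q|) / `|d|) => t [t0 tb].
  have bt : boundary A (q + t *: d) by apply: tb; rewrite lexx t0.
  have qB := AB _ (boundary_sub cA bt).
  rewrite ler_pdivlMr// -(ger0_norm t0) -normrZ.
  have := ler_normB (q + t *: d) q; rewrite addrAC subrr add0r; lra.
pose ts := sup T.
have t1ts : t1 <= ts by apply: ub_le_sup => //; exact: hT.2.
have ts0 : 0 < ts by exact: lt_le_trans t1ts.
have below t' : 0 <= t' < ts -> boundary A (q + t' *: d).
  move=> /andP[t'0 t'ts]; have tst' : 0 < ts - t' by rewrite subr_gt0.
  have [t [t0 tT]] := sup_adherent tst' hT; rewrite subKr => tt'.
  by apply: tT; rewrite t'0/= ltW.
have step rho : 0 < rho -> exists t', [/\ 0 <= t' < ts,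
  `|q + t' *: d - (q + ts *: d)| < rho &
    forall t, ts <= t <= ts + (ts - t') -> `|q + t *: d - (q + ts *: d)| < rho].
  move=> rho0; pose h := Num.min ts (rho / (2 * `|d|)).
  have h0 : 0 < h by rewrite lt_min ts0 divr_gt0// mulr_gt0.
  have hts : h <= ts by rewrite ge_min lexx.
  have hr t : `|t - ts| <= h -> `|q + t *: d - (q + ts *: d)| < rho.
    move=> th; rewrite opprD addrACA subrr add0r -scalerBl normrZ.
    have : `|t - ts| <= rho / (2 * `|d|)
      by rewrite (le_trans th)// ge_min lexx orbT.
    by rewrite ler_pdivlMr ?mulr_gt0// mulrCA; lra.
  exists (ts - h); split; first by apply/andP; split; lra.
    by apply: hr; rewrite addrAC subrr sub0r normrN ger0_norm// ltW.
  move=> t /andP[t_ge t_le]; apply: hr; rewrite ger0_norm; lra.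
have bts : boundary A (q + ts *: d).
  apply: contrapT => nb.
  have : nbhs (q + ts *: d) (~` boundary A).
    by apply: open_nbhs_nbhs; split=> //; exact/closed_openC/closed_boundary.
  move=> /near_norm[rho rho0 H]; have [t' [t'ts t'r _]] := step rho rho0.
  exact: H t'r (below _ t'ts).
exists ts => //; apply: contrapT => nc.
have [e1 [e2 trQ]] := trA _ bts.
have [c c0 e2E] := noncorner_antiparallel pA bts trQ nc.
have [rho [e10 _ _ rho0 bE']] := trQ.
have on_line z : `|z - (q + ts *: d)| < rho -> boundary A z <->
    exists k : R, z = q + ts *: d + k *: e1.
  move=> /bE' ->; split=> [[] [t t0 ->]|[k zk]].
  - by exists t.
  - by exists (t * - c); rewrite e2E scalerA.
  - have [k0|k0] := leP 0 k; first by left; exists k.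
    right; exists (- k / c); first by rewrite divr_ge0 ?oppr_ge0 ?ltW.
    by rewrite zk e2E scalerA (_ : - k / c * - c = k)//; field; rewrite gt_eqF.
have [t' [/andP[t'0 t'ts] t'r above]] := step rho rho0.
(* If the end point is no corner, the boundary there is a straight line. It contains the slightly
   earlier point at [t'], so its direction is that of [d]. *)
have [k kE] : exists k : R, q + t' *: d = q + ts *: d + k *: e1.
  by apply/(on_line _ t'r)/below; rewrite t'0.
have t't0 : t' - ts != 0 by rewrite subr_eq0 lt_eqF.
have dE : d = (k / (t' - ts)) *: e1.
  apply: (scalerI t't0); rewrite scalerA mulrC divfK// scalerBl.
  by apply: (addrI (q + ts *: d)); rewrite -kE; vec.
(* The straight piece reaches as far beyond [ts] as [t'] lies before it, contradicting the
   supremum. *)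
have : T (ts + (ts - t')).
  split=> [|t /andP[t0 tle]]; first lra.
  have [tts|tts] := ltP t ts; first by apply: below; rewrite t0.
  apply/on_line; first by apply: above; rewrite tts.
  by exists ((t - ts) * (k / (t' - ts))); rewrite -scalerA -dE; vec.
by move=> /(ub_le_sup hT.2); rewrite -/ts; lra.
Qed.

End corner_classification.

(** * Second differences of slices *)

Section slice_lengths.
Context {R : realType}.
Local Notation mu := (@lebesgue_measure R).
Implicit Types (a b l h : R).

Lemma Int_indic_itv a b (P : R -> bool) (lo hi : R) (bl br : bool) :
  (forall t, (t \in `[a, b]) && P t = (t \in Interval (BSide bl lo)
    (BSide br hi))) ->
  Int (fun t => interval_indic a b t * (P t)%:R) = Num.max 0 (hi - lo).
Proof.
move=> PE; pose I : set R := [set` Interval (BSide bl lo) (BSide br hi)].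
rewrite (eq_Int (g := \1_I)); last first.
  move=> t; rewrite /interval_indic !indicE -natrM mulnb;
    congr ((nat_of_bool _)%:R).
  have memI (i : interval R) : (t \in ([set` i] : set R)) = (t \in i).
    by apply/idP/idP; rewrite inE.
  by rewrite !memI PE.
rewrite /Int /Rintegral integral_indic//; last exact: measurable_itv.
rewrite setIT /I /= lebesgue_measure_itv/= lte_fin.
have [lh|hl] := ltP lo hi; first by rewrite /= max_r// subr_ge0 ltW.
by rewrite max_l// subr_le0.
Qed.

Lemma bounded_support_indicM a b (P : R -> bool) : measurable_fun setT P ->
  bounded_support (fun t => interval_indic a b t * (P t)%:R).
Proof.
move=> mP; split; last first.
  have [_ [C HC]] := bounded_support_indic a b; exists C => t.
  case: (P t); rewrite ?mulr1 ?mulr0//; split=> //.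
  by rewrite normr0; apply: le_trans (HC t).1.
apply: measurable_funM; first exact: (bounded_support_indic a b).1.
by apply: (measurableT_comp (f := fun c : bool => (c%:R : R))).
Qed.

Variables (a b l h : R).
Hypotheses (al : a < l) (lb : l < b) (ah : a < h) (hb : h < b).

(** This and the next five lemmas give the possible slices of a sector inside the window [[a, b]].
    The strict versions are for open sectors, which arise as complements of reflex ones. *)
Lemma Int_between : Int (fun t => interval_indic a b t * ((l <= t)
  && (t <= h))%:R) = Num.max 0 (h - l).
Proof.
apply: (@Int_indic_itv _ _ _ l h true false) => t; rewrite !in_itv/=.
apply/idP/idP => [/andP[]//|/andP[lt th]].
by rewrite lt th (le_trans (ltW al) lt) (le_trans th (ltW hb)).
Qed.

Lemma Int_between_lt : Int (fun t => interval_indic a b t * ((l < t)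
  && (t < h))%:R) = Num.max 0 (h - l).
Proof.
apply: (@Int_indic_itv _ _ _ l h false true) => t; rewrite !in_itv/=.
apply/idP/idP => [/andP[]//|/andP[lt th]].
by rewrite lt th (ltW (lt_trans al lt)) (ltW (lt_trans th hb)).
Qed.

Lemma Int_below : Int (fun t => interval_indic a b t * ((t <= h)
  && (t <= l))%:R) = Num.min h l - a.
Proof.
rewrite (@Int_indic_itv _ _ _ a (Num.min h l) true false).
  by rewrite max_r// subr_ge0 le_min !ltW.
move=> t; rewrite !in_itv/= le_min.
apply/idP/idP => [/andP[/andP[-> _] ->]//|/and3P[at_ th tl]].
by rewrite at_ th tl andbT/= (le_trans tl)// ltW.
Qed.

Lemma Int_below_lt : Int (fun t => interval_indic a b t * ((t < h)
  && (t < l))%:R) = Num.min h l - a.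
Proof.
rewrite (@Int_indic_itv _ _ _ a (Num.min h l) true true).
  by rewrite max_r// subr_ge0 le_min !ltW.
move=> t; rewrite !in_itv/= lt_min.
apply/idP/idP => [/andP[/andP[-> _] ->]//|/and3P[at_ th tl]].
by rewrite at_ th tl andbT/= ltW// (lt_trans tl).
Qed.

Lemma Int_above : Int (fun t => interval_indic a b t * ((h <= t)
  && (l <= t))%:R) = b - Num.max h l.
Proof.
rewrite (@Int_indic_itv _ _ _ (Num.max h l) b true false).
  by rewrite max_r// subr_ge0 ge_max !ltW.
move=> t; rewrite !in_itv/= ge_max.
apply/idP/idP => [/andP[/andP[_ ->] ->]//|/andP[/andP[ht lt] tb]].
by rewrite ht lt tb !andbT (le_trans _ lt)// ltW.
Qed.

Lemma Int_above_lt : Int (fun t => interval_indic a b t * ((h < t)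
  && (l < t))%:R) = b - Num.max h l.
Proof.
rewrite (@Int_indic_itv _ _ _ (Num.max h l) b false false).
  by rewrite max_r// subr_ge0 ge_max !ltW.
move=> t; rewrite !in_itv/= gt_max.
apply/idP/idP => [/andP[/andP[_ ->] ->]//|/andP[/andP[ht lt] tb]].
by rewrite ht lt tb !andbT ltW// (lt_trans _ lt).
Qed.

End slice_lengths.

(** * Slices of the set near a boundary point *)

Section cone_slices.
Context {R : realType}.
Implicit Types (A : set (R * R)) (q z d : R * R).
Variables (x e w w' : R * R).
Hypotheses (xe : edot x e = 1) (xw : edot x w = 0) (w'w : edot w' w = 1)
  (w'e : edot w' e = 0) (frame : forall z, z = edot x z *: e + edot w' z *: w)
  (ew : w.1 * e.2 - e.1 * w.2 != 0).

Definition frame_pt q (s t : R) := q + (s *: e + t *: w).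

Lemma frame_pt_inj (d : R * R) (s t u : R) : s *: e + t *: w = u *: d ->
  s = u * edot x d /\ t = u * edot w' d.
Proof.
move=> E; split.
  rewrite (_ : u * _ = edot x (u *: d)); last by rewrite /edot !vecE; ring.
  rewrite -E (_ : edot x _ = s * edot x e + t * edot x w);
    last by rewrite /edot !vecE; ring.
  by rewrite xe xw mulr1 mulr0 addr0.
rewrite (_ : u * _ = edot w' (u *: d)); last by rewrite /edot !vecE; ring.
rewrite -E (_ : edot w' _ = s * edot w' e + t * edot w' w);
  last by rewrite /edot !vecE; ring.
by rewrite w'e w'w mulr1 mulr0 add0r.
Qed.

Lemma frame_pt_near q (r : R) : 0 < r -> exists2 eta, 0 < eta &
  forall s t, `|s| < eta -> `|t| < eta -> `|frame_pt q s t - q| < r.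
Proof.
move=> r0; have N0 : 0 < `|e| + `|w| + 1 by rewrite ltr_wpDl// addr_ge0.
exists (r / (`|e| + `|w| + 1)); first by rewrite divr_gt0.
move=> s t; rewrite !ltr_pdivlMr// => sr tr.
rewrite /frame_pt addrAC subrr add0r (le_lt_trans (ler_normD _ _))// !normrZ.
have [st|ts] := leP `|s| `|t|.
  have : `|s| * `|e| <= `|t| * `|e| by rewrite ler_wpM2r.
  have := normr_ge0 t; lra.
have : `|t| * `|w| <= `|s| * `|w| by rewrite ler_wpM2r// ltW.
have := normr_ge0 s; lra.
Qed.

Definition slice_length A q a b s :=
  Int (fun t => interval_indic a b t * \1_A (frame_pt q s t)).

Lemma slice_lengthE A q a b s (P : R -> bool) (eta : R) :
  - eta < a -> b < eta ->
  (forall t, `|t| < eta -> A (frame_pt q s t) <-> P t) ->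
  slice_length A q a b s = Int (fun t => interval_indic a b t * (P t)%:R).
Proof.
move=> ea be AP; apply: eq_Int => t; rewrite /interval_indic indicE.
have [|_] := boolP (t \in _); last by rewrite !mul0r.
rewrite inE/= in_itv/= => /andP[a_t t_b]; rewrite !mul1r indicE; congr (_%:R).
have te : `|t| < eta by rewrite ltr_norml; apply/andP; split; lra.
congr nat_of_bool; apply/idP/idP; first by rewrite inE => /(AP _ te).
by move=> /(AP _ te) ?; rewrite inE.
Qed.

Let slope d := edot w' d / edot x d.

Lemma det2_frame (s t : R) d : edot x d != 0 ->
  det2 (s *: e + t *: w) d = edot x d * (slope d * s - t) * det2 e w.
Proof.
move=> xd; rewrite [in LHS](frame d)
  (_ : det2 _ _ = (s * edot w' d - t * edot x d) * det2 e w).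
  by rewrite /slope; congr (_ * _); field.
by rewrite /det2 !vecE; ring.
Qed.

(* In the frame the two rays are [t = m1 s] and [t = m2 s], each on the side of
   [s = 0] given by the sign of [edot x d]; the slices of the sector they bound
   are intervals with these end points, and [j] is [+-(m2 - m1)]. *)
Lemma slice_jump A q d1 d2 : polygonal A -> boundary A q ->
  two_rays_at (boundary A) q d1 d2 -> edot x d1 != 0 -> edot x d2 != 0 ->
  exists (j K eta : R), [/\ 0 < K, 0 < eta,
    (corners A q -> j != 0) /\ (~ corners A q -> j = 0),
    forall s t, `|s| < eta -> `|t| < eta -> K * `|s| < `|t| ->
      ~ boundary A (frame_pt q s t) &
    forall s a b, 0 < s < eta -> - eta < a < - (K * s) -> K * s < b < eta ->
      slice_length A q a b s + slice_length A q a b (- s)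
        - 2 * slice_length A q a b 0 = j * s].
Proof.
move=> pA bq tr xd1 xd2; have [cA AI _] := pA.
wlog m12 : d1 d2 tr xd1 xd2 / slope d1 <= slope d2.
  move=> W; case: (leP (slope d1) (slope d2)) => m12; first exact: (W d1 d2).
  by apply: (W d2 d1) => //; [exact: two_rays_swap|exact: ltW].
set m1 := slope d1 in m12; set m2 := slope d2 in m12.
(* Strictly above both slopes in absolute value, so the boundary near [q] stays in the cone
   [|t| <= K |s|] and the window ends lie outside it. *)
pose K := `|m1| + `|m2| + 1.
have K0 : 0 < K by rewrite ltr_wpDl// addr_ge0.
have far : exists2 eta, 0 < eta & forall s t, `|s| < eta -> `|t| < eta ->
    K * `|s| < `|t| -> ~ boundary A (frame_pt q s t).
  have [r [_ _ _ r0 bE]] := tr; have [eta eta0 near_eta] := frame_pt_near q r0.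
  exists eta => // s t s_eta t_eta Kst /(bE _ (near_eta _ _ s_eta t_eta)).
  have H d m u : edot x d != 0 -> slope d = m -> `|m| <= K ->
      frame_pt q s t = q + u *: d -> False.
    move=> xd mE mK /addrI/frame_pt_inj[sE tE].
    have : t = m * s by rewrite sE tE -mE /slope; field.
    move=> tms; move: Kst; rewrite tms normrM ltNge => /negP; apply.
    by rewrite ler_wpM2r.
  case=> -[u _ E].
    by apply: (H d1 m1 u) => //; rewrite /K; have := normr_ge0 m2; lra.
  by apply: (H d2 m2 u) => //; rewrite /K; have := normr_ge0 m1; lra.
have [eta1 eta10 far1] := far.
have pq s t : frame_pt q s t - q = s *: e + t *: w by rewrite /frame_pt addrAC
  subrr add0r.
have [D0|[c c0 d2E]] := two_rays_dichotomy tr; last first.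
  have nc : ~ corners A q.
    by rewrite d2E in tr; exact: antiparallel_rays_not_corner pA bq tr c0.
  have tr' := tr; rewrite d2E in tr'.
  have [n [r [n0 nd r0 An _]]] := half_plane_local cA AI bq tr' c0.
  have [eta2 eta20 near_eta] := frame_pt_near q r0.
  exists 0, K, (Num.min eta1 eta2); split=> //; first by rewrite lt_min eta10.
    by move=> s t; rewrite !lt_min => /andP[? _] /andP[? _]; exact: far1.
  move=> s a b; rewrite lt_min => /andP[s0 /andP[_ s2]].
  rewrite ltrNl lt_min => /andP[/andP[_]]; rewrite ltrNl => a2 aK.
  rewrite lt_min => /andP[bK /andP[_ b2]].
  (* The normal vanishes along [d1], that is on [t = m1 u]. Hence each slice is a half-line ending
     at [m1 u], and its length in the window is affine in [u]. *)
  have nE u t : edot n (u *: e + t *: w) = edot n w * (t - m1 * u).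
    have : edot n e * edot x d1 + edot n w * edot w' d1 = 0.
      by rewrite -[RHS]nd [in RHS](frame d1) /edot !vecE; ring.
    move=> H; have -> : edot n (u *: e + t *: w) = u * edot n e + t * edot n w.
      by rewrite /edot !vecE; ring.
    apply: (mulIf xd1); rewrite /m1 /slope.
    rewrite (_ : edot n w * _ * _ = edot n w * (t * edot x d1 - edot w' d1 *
      u)); last by field.
    have -> : (u * edot n e + t * edot n w) * edot x d1 =
      u * (edot n e * edot x d1) + t * edot n w * edot x d1 by ring.
    have -> : edot n e * edot x d1 = - (edot n w * edot w' d1) by lra.
    by ring.
  have nw0 : edot n w != 0.
    apply: contra n0 => /eqP nw; have := edot_gt0; have nn : edot n n = 0.
      by have := nE (edot x n) (edot w' n); rewrite -frame nw mul0r.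
    move=> /(_ R n) H; apply: contraT => /H; by rewrite nn ltxx.
  have Aslice u t : `|u| <= s -> `|t| < eta2 ->
      A (frame_pt q u t) <-> edot n w * (t - m1 * u) <= 0.
    move=> us t2; have u2 : `|u| < eta2 by exact: le_lt_trans s2.
    by rewrite (An _ (near_eta _ _ u2 t2)) pq nE.
  have bnd u : `|u| <= s -> a < m1 * u < b.
    move=> us; have : `|m1 * u| < K * s.
      rewrite normrM (@le_lt_trans _ _ (`|m1| * s))// ?ler_wpM2l//.
      by rewrite ltr_pM2r// /K; have := normr_ge0 m2; lra.
    by rewrite ltr_norml => /andP[? ?]; apply/andP; split; lra.
  have us1 : `|s| <= s by rewrite gtr0_norm.
  have us2 : `|- s| <= s by rewrite normrN gtr0_norm.
  have us3 : `|0 : R| <= s by rewrite normr0 ltW.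
  have [nw|nw] := ltP 0 (edot n w).
    have L u : `|u| <= s -> slice_length A q a b u = m1 * u - a.
      move=> us; have /andP[? ?] := bnd u us.
      rewrite (@slice_lengthE A q a b u (fun t => (t <= m1 * u)
        && (t <= m1 * u)) eta2)//.
        by rewrite Int_below// minxx.
      by move=> t /(Aslice _ _ us) ->; rewrite andbb pmulr_rle0// subr_le0.
    by rewrite !L//; ring.
  have {}nw : edot n w < 0 by rewrite lt_def eq_sym nw0.
  have L u : `|u| <= s -> slice_length A q a b u = b - m1 * u.
    move=> us; have /andP[? ?] := bnd u us.
    rewrite (@slice_lengthE A q a b u (fun t => (m1 * u <= t)
      && (m1 * u <= t)) eta2)//.
      by rewrite Int_above// maxxx.
    by move=> t /(Aslice _ _ us) ->; rewrite andbb nmulr_rle0// subr_ge0.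
  by rewrite !L//; ring.
have isc := independent_rays_corner cA bq tr D0.
have Dew : det2 e w != 0 by apply: contra ew => /eqP; rewrite /det2 => ?;
  apply/eqP; lra.
have d12E : det2 d1 d2 = edot x d1 * edot x d2 * (m2 - m1) * det2 e w.
  by rewrite [in LHS](frame d1) det2_frame// /m1 /m2 /slope; field;
    rewrite xd1 xd2.
have {}m12 : m1 < m2.
  rewrite lt_neqAle m12 andbT; apply: contra D0 => /eqP m12'.
  by rewrite d12E m12' subrr mulr0 mul0r.
have D_gt0 : 0 < m2 - m1 by rewrite subr_gt0.
have [r r0 shape] := sector_local cA AI bq tr D0.
have [eta2 eta20 near_eta] := frame_pt_near q r0.
pose b1 := 0 < edot x d1; pose b2 := 0 < edot x d2.
have aE u t : det2 (frame_pt q u t - q) d2 / det2 d1 d2 = (m2 * u - t)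
  / (m2 - m1) / edot x d1.
  rewrite pq det2_frame// -/m2 d12E; field.
  by rewrite Dew xd1 xd2 (gt_eqF D_gt0).
have bE u t : det2 d1 (frame_pt q u t - q) / det2 d1 d2 = (t - m1 * u)
  / (m2 - m1) / edot x d2.
  rewrite (_ : det2 d1 _ = - det2 (frame_pt q u t - q) d1);
    last by rewrite /det2; ring.
  rewrite pq det2_frame// -/m1 d12E; field.
  by rewrite Dew xd1 xd2 (gt_eqF D_gt0).
have sgn_le (u v : R) : v != 0 ->
  (0 <= u / (m2 - m1) / v) = (if 0 < v then 0 <= u else u <= 0).
  move=> v0; case: ifPn => [v_gt0|]; first by rewrite !pmulr_lge0 ?invr_gt0.
  rewrite -leNgt le_eqVlt (negbTE v0)/= => v_lt0.
  by rewrite nmulr_lge0 ?invr_lt0// pmulr_lle0 ?invr_gt0.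
have sgn_lt (u v : R) : v != 0 ->
  (0 < u / (m2 - m1) / v) = (if 0 < v then 0 < u else u < 0).
  move=> v0; case: ifPn => [v_gt0|]; first by rewrite !pmulr_lgt0 ?invr_gt0.
  rewrite -leNgt le_eqVlt (negbTE v0)/= => v_lt0.
  by rewrite nmulr_lgt0 ?invr_lt0// pmulr_llt0 ?invr_gt0.
pose Pc u t := (if b1 then t <= m2 * u else m2 * u <= t)
  && (if b2 then m1 * u <= t else t <= m1 * u).
pose Po u t := (if b1 then t < m2 * u else m2 * u < t)
  && (if b2 then m1 * u < t else t < m1 * u).
pose len a b u := if b1 then (if b2 then Num.max 0 (m2 * u - m1 * u)
  else Num.min (m2 * u) (m1 * u) - a)
  else (if b2 then b - Num.max (m2 * u) (m1 * u)
    else Num.max 0 (m1 * u - m2 * u)).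
(* Two rays on the same side of [s = 0]: the slice has length [(m2 - m1) |s|] on that side and 0 on
   the other. Rays on opposite sides: the slice is cut off by a minimum or maximum of [m1 u] and
   [m2 u], whose kink has the opposite sign. *)
pose j := if b1 == b2 then m2 - m1 else m1 - m2.
have j0 : j != 0 by rewrite /j; case: ifP => _;
  rewrite subr_eq0 ?(gt_eqF m12) ?(lt_eqF m12).
have lenE a b s : 0 < s -> len a b s + len a b (- s) - 2 * len a b 0 = j * s.
  move=> s0; have ms : m1 * s < m2 * s by rewrite ltr_pM2r.
  rewrite /len /j; case: (b1); case: (b2) => /=;
    rewrite !mulr0 !mulrN ?subrr ?maxxx ?minxx.
  - rewrite max_r ?max_l; lra.
  - rewrite min_r ?min_l; lra.
  - rewrite max_l ?max_r; lra.
  - rewrite max_l ?max_r; lra.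
have Plen u a b : a < m1 * u < b -> a < m2 * u < b ->
    Int (fun t => interval_indic a b t * (Pc u t)%:R) = len a b u /\
    Int (fun t => interval_indic a b t * (Po u t)%:R) = len a b u.
  move=> /andP[? ?] /andP[? ?]; rewrite /Pc /Po /len; case: (b1); case: (b2).
  - split; [rewrite -(@Int_between _ a b)//|rewrite -(@Int_between_lt _ a b)//];
      by apply: eq_Int => t; rewrite andbC.
  - by rewrite Int_below// Int_below_lt.
  - by rewrite Int_above// Int_above_lt.
  - by rewrite Int_between// Int_between_lt.
have PcE u t : 0 <= det2 (frame_pt q u t - q) d2 / det2 d1 d2 /\
    0 <= det2 d1 (frame_pt q u t - q) / det2 d1 d2 <-> Pc u t.
  rewrite aE bE !sgn_le// /Pc -/b1 -/b2 !subr_ge0 !subr_le0.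
  by split=> [[-> ->]|/andP].
have PoE u t : 0 < det2 (frame_pt q u t - q) d2 / det2 d1 d2 /\
    0 < det2 d1 (frame_pt q u t - q) / det2 d1 d2 <-> Po u t.
  rewrite aE bE !sgn_lt// /Po -/b1 -/b2 !subr_gt0 !subr_lt0.
  by split=> [[-> ->]|/andP].
have far' s t : `|s| < Num.min eta1 eta2 -> `|t| < Num.min eta1 eta2 ->
    K * `|s| < `|t| -> ~ boundary A (frame_pt q s t).
  by rewrite !lt_min => /andP[? _] /andP[? _]; exact: far1.
have bnd m s u a b : `|m| < K -> 0 < s -> `|u| <= s -> a < - (K * s) ->
  K * s < b ->
    a < m * u < b.
  move=> mK s0 us aK bK; have : `|m * u| < K * s.
    rewrite normrM (@le_lt_trans _ _ (`|m| * s))// ?ler_wpM2l//.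
    by rewrite ltr_pM2r.
  by rewrite ltr_norml => /andP[? ?]; apply/andP; split; lra.
have m1K : `|m1| < K by rewrite /K; have := normr_ge0 m2; lra.
have m2K : `|m2| < K by rewrite /K; have := normr_ge0 m1; lra.
have etagt : 0 < Num.min eta1 eta2 by rewrite lt_min eta10.
(* Common ending for the closed sector, with [sgn = 1], and for the complement of the open one, with
   [sgn = -1]. *)
have main (sgn : R) (L : R -> R -> R -> R) : sgn != 0 ->
    (forall a b s, 0 < s -> L a b s + L a b (- s)
      - 2 * L a b 0 = sgn * (j * s)) ->
    (forall s a b u, 0 < s < eta2 -> - eta2 < a < - (K * s) ->
      K * s < b < eta2 ->
      `|u| <= s -> slice_length A q a b u = L a b u) ->
    exists (j K eta : R), [/\ 0 < K, 0 < eta,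
    (corners A q -> j != 0) /\ (~ corners A q -> j = 0),
    forall s t, `|s| < eta -> `|t| < eta -> K * `|s| < `|t| ->
      ~ boundary A (frame_pt q s t) &
    forall s a b, 0 < s < eta -> - eta < a < - (K * s) -> K * s < b < eta ->
      slice_length A q a b s + slice_length A q a b (- s)
        - 2 * slice_length A q a b 0 = j * s].
  move=> sgn0 LE sL; exists (sgn * j), K, (Num.min eta1 eta2); split=> //.
    by split=> // _; rewrite mulf_neq0.
  move=> s a b; rewrite lt_min => /andP[s0 /andP[_ s2]].
  rewrite ltrNl lt_min => /andP[/andP[_]]; rewrite ltrNl => a2 aK.
  rewrite lt_min => /andP[bK /andP[_ b2']].
  have S u : `|u| <= s -> slice_length A q a b u = L a b u.
    by apply: sL; rewrite ?s0 ?a2 ?aK ?bK ?b2'.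
  by rewrite -mulrA -(LE a b s s0) !S// ?normrN ?normr0 ?(gtr0_norm s0)// ltW.
case: shape => shape.
- apply: (main 1 len) => [|a b s s0|s a b u].
  + exact: oner_neq0.
  + by rewrite mul1r lenE.
  move=> /andP[s0 s2] /andP[a2 aK] /andP[bK b2'] us.
  rewrite (@slice_lengthE A q a b u (Pc u) eta2)//.
    by have [] := Plen u a b (bnd _ _ _ _ _ m1K s0 us aK bK)
      (bnd _ _ _ _ _ m2K s0 us aK bK).
  move=> t t2; have u2 : `|u| < eta2 by exact: le_lt_trans s2.
  by rewrite (shape _ (near_eta _ _ u2 t2)) PcE.
- apply: (main (-1) (fun a b u => (b - a) - len a b u)).
  + by rewrite oppr_eq0 oner_neq0.
  + by move=> a b s s0; rewrite mulN1r -(lenE a b s s0); ring.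
  move=> s a b u /andP[s0 s2] /andP[a2 aK] /andP[bK b2'] us.
  rewrite (@slice_lengthE A q a b u (fun t => ~~ Po u t) eta2)//; last first.
    move=> t t2; have u2 : `|u| < eta2 by exact: le_lt_trans s2.
    by rewrite (shape _ (near_eta _ _ u2 t2)) PoE; split=> [/negP|/negP].
  have [_ <-] := Plen u a b (bnd _ _ _ _ _ m1K s0 us aK bK)
    (bnd _ _ _ _ _ m2K s0 us aK bK).
  have Ks : 0 < K * s by rewrite mulr_gt0.
  have abl : a <= b by lra.
  have bP : bounded_support (fun t => interval_indic a b t * (Po u t)%:R).
    apply: bounded_support_indicM.
    have mge (m : R) : measurable_fun setT (fun t : R => t < m)
      by exact: measurable_fun_ltr.
    have mle (m : R) : measurable_fun setT (fun t : R => m < t)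
      by exact: measurable_fun_ltr.
    by apply: measurable_and; [case: (b1)|case: (b2)].
  have bNP := bounded_supportM (locally_bounded_cst (-1)) bP.
  transitivity (Int (interval_indic a b) +
      Int (fun t => -1 * (interval_indic a b t * (Po u t)%:R))); last first.
    by rewrite (Int_indic abl) (IntZ (-1) bP) mulN1r.
  rewrite -(IntD (bounded_support_indic a b) bNP).
  by apply: eq_Int => t; case: (Po u t) => /=; ring.
Qed.

End cone_slices.

(** * Second differences along segments that miss the boundary *)

Section regularity.
Context {R : realType}.
Implicit Types (A K : set (R * R)) (g D : R * R -> R) (y z e v : R * R).

Lemma within_continuous_near K D y : {within K, continuous D} -> K y ->
  forall eps : R, 0 < eps -> exists2 r, 0 < r &
    forall z, K z -> `|z - y| < r -> `|D z - D y| < eps.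
Proof.
move=> cD Ky eps eps0.
have cDy : D z @[z --> within K (nbhs y)] --> D y.
  by rewrite nbhs_subspace_in//; exact: cD.
have /near_norm[r r0 H] : \forall z \near y, K z -> `|D y - D z| < eps.
  have := @cvgr_dist_lt _ _ _ _ _ _ _ cDy eps eps0.
  exact.
by exists r => // z Kz zr; rewrite distrC; apply: H.
Qed.

(** Heine-Cantor for continuity within [K] only. *)
Lemma compact_uniformly_continuous K D : compact K ->
  {within K, continuous D} ->
  forall eps : R, 0 < eps -> exists2 d, 0 < d &
    forall y z, K y -> K z -> `|z - y| < d -> `|D z - D y| < eps.
Proof.
move=> cK cD eps eps0; have eps2 : 0 < eps / 2 by lra.
pose P (d : R) y := K y -> forall z, K z -> `|z - y| < d -> `|D z - D y| < eps.
have : \forall d \near (0 : R), K `<=` P d.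
  apply: ((compact_near_coveringP K).1 cK R (nbhs (0 : R)) P) => y Ky.
  have [r r0 H] := within_continuous_near cD Ky eps2.
  have r2 : 0 < r / 2 by lra.
  exists ([set z | `|z - y| < r / 2], [set d | `|d - 0| < r / 2]).
    split; first by apply/near_norm; exists (r / 2).
    by apply: (@near_normV R R 0 (fun d => `|d - 0| < r / 2)).2; exists (r / 2).
  move=> [z d] [/= zy]; rewrite subr0 => dr Kz z' Kz' z'z.
  have z'y : `|z' - y| < r.
    have := ler_normD (z' - z) (z - y); rewrite addrA subrK.
    have := ler_norm d; lra.
  have zy' : `|z - y| < r by lra.
  have := H _ Kz zy'; have := H _ Kz' z'y.
  have := ler_normD (D z' - D y) (D y - D z);
    rewrite addrA subrK (distrC (D y)); lra.
move=> /near_normV[r r0 H]; exists (r / 2); first lra.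
move=> y z Ky Kz zy; apply: (H (r / 2)) => //.
by rewrite subr0 gtr0_norm; lra.
Qed.

Lemma is_derive_line g y v (t d : R) : is_derive (y + t *: v) v g d <->
  is_derive t 1 (fun u : R => g (y + u *: v)) d.
Proof.
have E (h : R) : (g \o shift (y + t *: v)) (h *: v) =
    ((fun u : R => g (y + u *: v)) \o shift t) (h *: (1 : R)).
  by rewrite /=; congr g; rewrite /GRing.scale/= mulr1; vec.
have Ed : (fun h => h^-1 *: ((g \o shift (y + t *: v)) (h *: v)
  - g (y + t *: v))) =
    (fun h => h^-1 *: (((fun u : R => g (y + u *: v)) \o shift t)
      (h *: (1 : R)) - g (y + t *: v))).
  by apply/funext => h; rewrite E.
have ED : derivable g (y + t *: v) v = derivable (fun u : R => g (y + u *: v))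
  t 1.
  by rewrite /derivable Ed.
have EV : 'D_v g (y + t *: v) = 'D_1 (fun u : R => g (y + u *: v)) t.
  by rewrite /derive Ed.
split=> -[dg gd]; split; [by rewrite -ED|by rewrite -EV|by rewrite ED|by
  rewrite EV].
Qed.

Lemma is_derive_scale g y v (a d : R) : is_derive y v g d ->
  is_derive y (a *: v) g (d * a).
Proof.
move=> gd.
have gd' : is_derive (a * 0) 1 (fun u : R => g (y + u *: v)) d.
  by apply/is_derive_line; rewrite mulr0 scale0r addr0.
have ad : is_derive (0 : R) 1 (fun u : R => a * u) a.
  have := @is_deriveZ R R R id a 0 1 1 (is_derive_id _ _).
  by rewrite /GRing.scale/= mulr1.
have := is_derive1_comp gd' ad;
  rewrite (_ : _ \o _ = fun u : R => g (y + u *: (a *: v))).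
  by move=> /is_derive_line; rewrite scale0r addr0.
by apply/funext => u /=; rewrite scalerA mulrC.
Qed.

(** Only the derivative along [e] matters for slices; since [e] is a multiple of a coordinate
    vector, [C1_on] provides it. *)
Definition directionally_C1 K e g := exists2 D : R * R -> R,
  {within K, continuous D} & forall y, K° y -> is_derive y e g (D y).

Lemma C1_on_directionally K e g (a : R) : C1_on K g ->
  e = a *: (1, 0) \/ e = a *: (0, 1) -> directionally_C1 K e g.
Proof.
move=> [h1 [h2 [_ c1 c2 dg]]] eE.
have [D [cD dD]] : exists D : R * R -> R, {within K, continuous D} /\
    forall y, K° y -> is_derive y e g (D y * a).
  case: eE => ->; [exists h1|exists h2]; split=> // y /dg[? ?];
    exact: is_derive_scale.
exists (fun y => D y * a) => //.
by move=> y; apply: cvgM; [exact: cD|exact: cvg_cst].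
Qed.

(** A segment missing the boundary is either outside [A], where [g = 0], or in the interior of one
    component. There the mean value theorem on both halves gives [(D c1 - D c2) * s], small by
    uniform continuity of the derivative. The point is that [d] does not depend on [y]. *)
Lemma second_difference_small (M : nat) (Omega : 'I_M -> set (R * R)) e g :
  (forall m, polygonal (Omega m)) -> (forall m, compact (Omega m)) ->
  (forall m m', m != m' -> Omega m `&` Omega m' = set0) ->
  (forall m, directionally_C1 (Omega m) e g) ->
  (forall y, ~ (\bigcup_m Omega m) y -> g y = 0) ->
  forall eps : R, 0 < eps -> exists2 d, 0 < d & forall s y, 0 < s < d ->
    (forall r : R, `|r| <= s -> ~ boundary (\bigcup_m Omega m) (y + r *: e)) ->
    `|g (y + s *: e) + g (y - s *: e) - 2 * g y| <= eps * s.
Proof.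
move=> pO cO dO C1 g0 eps eps0; set A := \bigcup_m Omega m.
have clO m : closed (Omega m) by have [] := pO m.
have clA : closed A by exact: closed_family_bigcup.
have bA : boundary A = \bigcup_m boundary (Omega m) by exact: boundary_bigcup.
have C1' m : exists D : R * R -> R, {within Omega m, continuous D} /\
    forall y, (Omega m)° y -> is_derive y e g (D y).
  by have [D cD gD] := C1 m; exists D.
have [D HD] := choice C1'.
pose Q m (d : R) := forall y z, Omega m y -> Omega m z -> `|z - y| < d ->
  `|D m z - D m y| < eps.
have /near_normV[d0 d00 H] : \forall d \near (0 : R), forall m, Q m d.
  suff QH m : \forall d \near (0 : R), Q m d by exact: filter_forall QH.
  have [d d_gt0 dQ] := compact_uniformly_continuous (cO m) (HD m).1 eps0.
  apply/near_normV; exists d => // d'; rewrite subr0 => d'd y z Oy Oz zy.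
  by apply: dQ => //; rewrite (lt_trans zy)// (le_lt_trans (ler_norm _)).
have QH m : Q m (d0 / 2) by apply: H; rewrite subr0 gtr0_norm; lra.
have e1 : 0 < 4 * (`|e| + 1) by rewrite mulr_gt0// ltr_wpDl.
(* The two intermediate points are at distance at most [2 s |e|], which is then below [d0 / 2]. *)
exists (d0 / (4 * (`|e| + 1))); first by rewrite divr_gt0.
move=> s y /andP[s0]; rewrite ltr_pdivlMr// => sd bfree.
pose L z := exists2 r : R, `|r| <= s & z = y + r *: e.
have Ly : L y by exists 0; rewrite ?normr0 ?ltW// scale0r addr0.
have Lp r : `|r| <= s -> L (y + r *: e) by exists r.
have Lb z : L z -> ~ boundary A z by move=> [r rs ->]; exact: bfree.
have Lc u v t : L u -> L v -> 0 <= t <= 1 -> L (u + t *: (v - u)).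
  move=> [r1 r1s ->] [r2 r2s ->] /andP[t0 t1]; exists ((1 - t) * r1 + t * r2);
    last by vec.
  have t1' : 0 <= 1 - t by rewrite subr_ge0.
  rewrite (le_trans (ler_normD _ _))// !normrM (ger0_norm t1') (ger0_norm t0).
  have : (1 - t) * `|r1| <= (1 - t) * s by rewrite ler_wpM2l.
  have : t * `|r2| <= t * s by rewrite ler_wpM2l.
  lra.
have Ns : `|- s| <= s by rewrite normrN gtr0_norm.
have Ps : `|s| <= s by rewrite gtr0_norm.
rewrite -scaleNr.
have [[m _ Oy]|nAy] := pselect (A y); last first.
  have nA z : L z -> g z = 0.
    by move=> Lz; apply: g0 => Az; apply: nAy;
      exact: (convex_boundary_free clA Lb Lc Lz Ly Az).
  by rewrite (nA _ (Lp _ Ps)) (nA _ (Lp _ Ns)) (nA _ Ly)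
    mulr0 subr0 addr0 normr0 mulr_ge0// ltW.
have Lbm z : L z -> ~ boundary (Omega m) z.
  by move=> Lz bz; apply: (Lb z Lz); rewrite bA; exists m.
have LO z : L z -> Omega m z.
  by move=> Lz; exact: (convex_boundary_free (clO m) Lbm Lc Ly Lz Oy).
have LI z : L z -> (Omega m)° z.
  by move=> Lz; apply: boundaryPn => //; [exact: LO|exact: Lbm].
have dphi (t : R) : `|t| <= s ->
  is_derive t 1 (fun u : R => g (y + u *: e)) (D m (y + t *: e)).
  by move=> ts; apply/is_derive_line; apply: (HD m).2; apply: LI; exact: Lp.
have mvt (a b : R) : - s <= a -> a <= b -> b <= s -> exists2 c : R, `|c| <= s &
    g (y + b *: e) - g (y + a *: e) = D m (y + c *: e) * (b - a).
  move=> sa ab bs.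
  have abs_le (c : R) : a <= c <= b -> `|c| <= s.
    by move=> /andP[ac cb]; rewrite ler_norml; apply/andP; split; lra.
  have dc (c : R) : c \in `[a, b] ->
    is_derive c 1 (fun u : R => g (y + u *: e)) (D m (y + c *: e)).
    by rewrite in_itv/= => /abs_le/dphi.
  have dc' (c : R) : c \in `]a, b[ ->
    is_derive c 1 (fun u : R => g (y + u *: e)) (D m (y + c *: e)).
    by move=> cab; apply: dc; exact: subset_itv_oo_cc cab.
  have cc : {within `[a, b], continuous (fun u : R => g (y + u *: e))}.
    by apply: derivable_within_continuous => c /dc[].
  have [c cab cE] := MVT_segment ab dc' cc; exists c => //.
  by apply: abs_le; move: cab; rewrite in_itv.
have [c1 c1s E1] := mvt 0 s ltac:(lra) (ltW s0) (lexx s).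
have [c2 c2s E2] := mvt (- s) 0 (lexx _) ltac:(lra) (ltW s0).
have -> : g (y + s *: e) + g (y + - s *: e) - 2 * g y =
    (D m (y + c1 *: e) - D m (y + c2 *: e)) * s.
  move: E1 E2; rewrite scale0r addr0 subr0 sub0r opprK mulrBl => <- <-; ring.
rewrite normrM (gtr0_norm s0) ler_wpM2r ?ltW//.
apply: QH; [exact/LO/Lp|exact/LO/Lp|].
have -> : y + c1 *: e - (y + c2 *: e) = (c1 - c2) *: e by vec.
rewrite normrZ; have : `|c1 - c2| <= 2 * s by rewrite (le_trans (ler_normB _
  _))//; lra.
move=> /(ler_wpM2r (normr_ge0 e)); lra.
Qed.

End regularity.

(** * Expansion of the second difference near one point of the line *)

Section slice_asymptotics.
Context {R : realType}.
Local Notation T := (measurableTypeR R * measurableTypeR R)%type.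
Variables (x e w w' : R * R).
Hypotheses (xe : edot x e = 1) (xw : edot x w = 0) (w'w : edot w' w = 1)
  (w'e : edot w' e = 0) (frame : forall z, z = edot x z *: e + edot w' z *: w)
  (ew : w.1 * e.2 - e.1 * w.2 != 0).
Implicit Types (g : R * R -> R) (p q y z : R * R).
Local Notation pt := (frame_pt e w).

Lemma locally_bounded_indic (a b : R) : locally_bounded (interval_indic a b).
Proof.
have [mI [C HC]] := bounded_support_indic a b.
by split=> // B; exists C => s _; exact: (HC s).1.
Qed.

Lemma bounded_support_frame_pt g q s : bounded_support2 g ->
  bounded_support (fun t => g (pt q s t)).
Proof.
move=> bg; have bf := bounded_support2_section2 (edot x q + s)
  (bounded_support2_frame ew bg).
have := bounded_support_affine (edot w' q) (oner_neq0 R) bf;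
  congr bounded_support.
apply/funext => t; congr g; rewrite /= /pt [in RHS](frame q); vec.
Qed.

Definition sdiff g q s t := g (pt q s t) + g (pt q (- s) t) - 2 * g (pt q 0 t).

Definition sdiff_Int g q s a b :=
  Int (fun t => interval_indic a b t * sdiff g q s t).

Lemma bounded_support_sdiff g q s : bounded_support2 g ->
  bounded_support (sdiff g q s).
Proof.
move=> bg; have b1 := bounded_support_frame_pt q s bg.
have b2 := bounded_support_frame_pt q (- s) bg.
have b3 := bounded_supportM (locally_bounded_cst (- 2))
  (bounded_support_frame_pt q 0 bg).
have := bounded_supportD (bounded_supportD b1 b2) b3; congr bounded_support.
by apply/funext => t; rewrite mulNr.
Qed.

Lemma bounded_support_indic_sdiff g q s a b : bounded_support2 g ->
  bounded_support (fun t => interval_indic a b t * sdiff g q s t).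
Proof.
by move=> /(bounded_support_sdiff q s); apply: bounded_supportM;
  exact: locally_bounded_indic.
Qed.

Lemma interval_indicE (a b t : R) : interval_indic a b t = (a <= t <= b)%R%:R.
Proof.
rewrite /interval_indic indicE; congr ((nat_of_bool _)%:R).
by apply/idP/idP; rewrite inE /= in_itv.
Qed.

Lemma sdiff_Int_shift g q s a b (t0 : R) : bounded_support2 g ->
  sdiff_Int g (pt q 0 t0) s a b = sdiff_Int g q s (a + t0) (b + t0).
Proof.
move=> bg.
have := Int_affine t0 (oner_neq0 R) (bounded_support_indic_sdiff q s (a + t0)
  (b + t0) bg).
rewrite normr1 mul1r /sdiff_Int => ->; apply: eq_Int => t.
have pE u : pt (pt q 0 t0) u t = pt q u (1 * t + t0) by rewrite /pt; vec.
by rewrite !interval_indicE mul1r !lerD2r /sdiff !pE mul1r.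
Qed.

Lemma Int_degenerate g q s b : bounded_support2 g -> sdiff_Int g q s b b = 0.
Proof.
move=> bg; apply/eqP; rewrite -normr_le0.
have [_ [C HC]] := bounded_support_sdiff q s bg.
have C0 : 0 <= C by apply: le_trans (HC 0).1.
have bI := bounded_supportM (locally_bounded_cst C) (bounded_support_indic b b).
apply: le_trans (ler_norm_Int (bounded_support_indic_sdiff q s b b bg) bI _) _.
  move=> t; rewrite interval_indicE; case: (b <= t <= b).
    by rewrite mul1r mulr1 (HC t).1.
  by rewrite mul0r mulr0 normr0.
by rewrite (IntZ C (bounded_support_indic b b)) Int_indic// subrr mulr0.
Qed.

Lemma sdiff_Int_add g q s a b c : bounded_support2 g -> a <= b -> b <= c ->
  sdiff_Int g q s a c = sdiff_Int g q s a b + sdiff_Int g q s b c.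
Proof.
move=> bg ab bc; have B a' b' := bounded_support_indic_sdiff q s a' b' bg.
have NB := bounded_supportM (locally_bounded_cst (-1)) (B b b).
(* The closed windows overlap at [b]; subtracting the degenerate window there makes the identity
   hold pointwise. *)
rewrite -[RHS]addr0 -[X in _ = _ + X](mulr0 (-1)) -(Int_degenerate q s b bg).
rewrite -(IntZ (-1) (B b b)) -(IntD (B a b) (B b c)).
rewrite -(IntD (bounded_supportD (B a b) (B b c)) NB).
apply: eq_Int => t; rewrite !interval_indicE mulrA -!mulrDl; congr (_ * _).
have [at_|ta] := leP a t; have [tb|bt] := leP t b; have [bt'|tb'] := leP b t;
  have [tc|ct] := leP t c; rewrite /=; try lra; ring.
Qed.

(** The expansion [j s + o(s)] restricted to a window of the line. It is additive in the window,
    which allows the line to be treated piece by piece. *)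
Definition jump_on g q a b j := forall eps : R, 0 < eps -> exists2 d, 0 < d &
  forall s, 0 < s < d -> `|sdiff_Int g q s a b - j * s| <= eps * s.

Lemma jump_on_add g q a b c j1 j2 : bounded_support2 g -> a <= b -> b <= c ->
  jump_on g q a b j1 -> jump_on g q b c j2 -> jump_on g q a c (j1 + j2).
Proof.
move=> bg ab bc J1 J2 eps eps0; have eps2 : 0 < eps / 2 by lra.
have [d1 d10 H1] := J1 _ eps2; have [d2 d20 H2] := J2 _ eps2.
exists (Num.min d1 d2); first by rewrite lt_min d10.
move=> s; rewrite lt_min => /andP[s0 /andP[s1 s2]].
have {}H1 : `|sdiff_Int g q s a b - j1 * s| <= eps / 2 * s by apply: H1;
  rewrite s0.
have {}H2 : `|sdiff_Int g q s b c - j2 * s| <= eps / 2 * s by apply: H2;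
  rewrite s0.
rewrite (sdiff_Int_add q s bg ab bc) mulrDl opprD addrACA.
by rewrite (le_trans (ler_normD _ _))//; lra.
Qed.

Section source.
Variables (M : nat) (Omega : 'I_M -> set (R * R)) (g : R * R -> R).
Local Notation A := (\bigcup_m Omega m).
Hypotheses (pO : forall m, polygonal (Omega m)) (cO : forall m,
  compact (Omega m))
  (dO : forall m m', m != m' -> Omega m `&` Omega m' = set0)
  (gC1 : forall m, directionally_C1 (Omega m) e g)
  (gcont : forall m, {within Omega m, continuous g})
  (g0 : forall y, ~ A y -> g y = 0)
  (bg : bounded_support2 g) (bA : bounded_support2 (\1_A : R * R -> R)).

Let pA : polygonal A := polygonal_bigcup pO dO.
Let clO m : closed (Omega m). Proof. by have [] := pO m. Qed.
Let clA : closed A. Proof. by have [] := pA. Qed.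

Lemma segment_same_side y s :
  (forall r : R, `|r| <= s -> ~ boundary A (y + r *: e)) ->
  forall r : R, `|r| <= s -> (\1_A (y + r *: e) : R) = \1_A y.
Proof.
move=> bfree r rs.
pose L z := exists2 r : R, `|r| <= s & z = y + r *: e.
have s0 : 0 <= s by exact: le_trans rs.
have Ly : L y by exists 0; rewrite ?normr0// scale0r addr0.
have Lr : L (y + r *: e) by exists r.
have Lb z : L z -> ~ boundary A z by move=> [u us ->]; exact: bfree.
have Lc u v t : L u -> L v -> 0 <= t <= 1 -> L (u + t *: (v - u)).
  move=> [r1 r1s ->] [r2 r2s ->] /andP[t0 t1]; exists ((1 - t) * r1 + t * r2);
    last by vec.
  have t1' : 0 <= 1 - t by rewrite subr_ge0.
  rewrite (le_trans (ler_normD _ _))// !normrM (ger0_norm t1') (ger0_norm t0).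
  have : (1 - t) * `|r1| <= (1 - t) * s by rewrite ler_wpM2l.
  have : t * `|r2| <= t * s by rewrite ler_wpM2l.
  lra.
rewrite !indicE; congr ((nat_of_bool _)%:R); apply/idP/idP; rewrite !inE => Az.
  exact: (convex_boundary_free clA Lb Lc Lr Ly Az).
exact: (convex_boundary_free clA Lb Lc Ly Lr Az).
Qed.

Let far eps (eps0 : 0 < eps) := second_difference_small pO cO dO gC1 g0 eps0.

Lemma frame_ptE q s t : pt q s t = pt q 0 t + s *: e.
Proof. by rewrite /pt; vec. Qed.

Lemma jump_off_boundary q : ~ boundary A q -> exists2 eta, 0 < eta &
  forall a b, - eta < a -> a <= b -> b < eta -> jump_on g q a b 0.
Proof.
move=> nb.
have /near_norm[r r0 nbr] : nbhs q (~` boundary A).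
  by apply: open_nbhs_nbhs; split=> //; exact/closed_openC/closed_boundary.
have [eta eta0 Heta] := frame_pt_near e w q r0.
exists eta => // a b ea ab be eps eps0.
(* The summand 1 covers the window [a = b]. *)
have eps' : 0 < eps / (b - a + 1) by rewrite divr_gt0//; lra.
have [d d0 Hd] := far eps'.
exists (Num.min d eta); first by rewrite lt_min d0.
move=> s; rewrite lt_min => /andP[s0 /andP[sd seta]]; rewrite mul0r subr0.
have bI := bounded_supportM (locally_bounded_cst (eps / (b - a + 1) * s))
  (bounded_support_indic a b).
apply: le_trans (ler_norm_Int (bounded_support_indic_sdiff q s a b bg) bI _) _.
  move=> t; rewrite interval_indicE.
  have [/andP[a_t t_b]|_] := boolP (a <= t <= b);
    last by rewrite mul0r mulr0 normr0.
  rewrite mul1r mulr1 /sdiff (frame_ptE q s) (frame_ptE q (- s)) scaleNr.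
  apply: Hd; first by rewrite s0.
  move=> u us; rewrite -frame_ptE; apply: nbr; apply: Heta; first by lra.
  by rewrite ltr_norml; apply/andP; split; lra.
rewrite (IntZ _ (bounded_support_indic a b)) Int_indic// mulrAC ler_pM2r//.
rewrite -[leRHS]mulr1 -mulrA ler_pM2l// mulrC ler_pdivrMr; lra.
Qed.

(** Near [q] only the component containing [q] is present; [g] is continuous on it and zero off
    [A]. *)
Lemma near_value q : boundary A q -> forall e1 : R, 0 < e1 -> exists2 r, 0 < r &
  forall z, `|z - q| < r -> `|g z - g q * \1_A z| <= e1.
Proof.
move=> bq e1 e10; have [m _ Oq] := boundary_sub clA bq.
have [r1 r10 H1] := bigcup_local clO dO Oq.
have [r2 r20 H2] := within_continuous_near (@gcont m) Oq e10.
exists (Num.min r1 r2); first by rewrite lt_min r10.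
move=> z; rewrite lt_min indicE => /andP[zr1 zr2].
have [|] := boolP (z \in _).
  by rewrite inE => /(H1 _ zr1) Oz; rewrite mulr1 ltW// H2.
move=> /negP nA; rewrite mulr0 subr0 g0 ?normr0 ?ltW// => Az.
by apply: nA; rewrite inE.
Qed.

(* Where [|t| <= K s], [g] is replaced by the constant [g q] on [A]; elsewhere the
   segment of half-length [s] misses the boundary and the second difference is
   [o(s)]. *)
Lemma jump_at_boundary q d1 d2 : boundary A q ->
  two_rays_at (boundary A) q d1 d2 ->
  edot x d1 != 0 -> edot x d2 != 0 -> exists j eta : R, [/\ 0 < eta,
    (corners A q -> g q != 0 -> j != 0), (~ corners A q -> j = 0) &
    forall a b, - eta < a -> a < 0 -> 0 < b -> b < eta -> jump_on g q a b j].
Proof.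
move=> bq tr xd1 xd2.
have [j [K [eta [K0 eta0 [jc jnc] nb sums]]]] :=
  slice_jump xe xw w'w w'e frame ew pA bq tr xd1 xd2.
exists (g q * j), eta; split=> //.
- by move=> /jc j0 gq; rewrite mulf_neq0.
- by move=> /jnc ->; rewrite mulr0.
move=> a b ea a0 b0 be eps eps0.
(* Over the central window of length [2 K s] the integrand is at most [4] times this constant, which
   contributes [eps / 2 * s]; the constant [eps / (2 * (b - a))] below yields the other half. *)
have e10 : 0 < eps / (16 * K) by rewrite divr_gt0// mulr_gt0.
have [r r0 near_q] := near_value bq e10.
have [rho rho0 near_rho] := frame_pt_near e w q r0.
have ba : 0 < b - a by lra.
have eps'0 : 0 < eps / (2 * (b - a)) by rewrite divr_gt0// mulr_gt0.
have [df df0 Hf] := far eps'0.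
pose d := Num.min (Num.min (Num.min eta df) (Num.min (- a / K) (b / K)))
  (Num.min rho (rho / K)).
exists d; first by rewrite !lt_min eta0 df0 rho0 !divr_gt0// oppr_gt0.
move=> s; rewrite !lt_min !ltr_pdivlMr//.
move=> /andP[s0 /andP[/andP[/andP[s_eta s_df] /andP[sa sb]] /andP[s_rho
  s_rhoK]]].
have JA : sdiff_Int (\1_A : R * R -> R) q s a b = j * s.
  have B u := bounded_supportM (locally_bounded_indic a b)
    (bounded_support_frame_pt q u bA).
  have NB := bounded_supportM (locally_bounded_cst (- 2)) (B 0).
  rewrite -(sums s a b); [|lra|lra|lra].
  rewrite /slice_length -mulNr -(IntZ (- 2) (B 0)) -(IntD (B s) (B (- s))).
  rewrite -(IntD (bounded_supportD (B s) (B (- s))) NB).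
  by apply: eq_Int => t; rewrite /sdiff; ring.
have bS := bounded_support_indic_sdiff q s a b.
have bAq := bounded_supportM (locally_bounded_cst (- g q)) (bS _ bA).
(* The indicator has the exact second difference [j s], so only [g - g q * \1_A] has to be
   estimated. *)
have -> : sdiff_Int g q s a b - g q * j * s =
    Int (fun t => interval_indic a b t * sdiff g q s t +
      - g q * (interval_indic a b t * sdiff (\1_A : R * R -> R) q s t)).
  by rewrite (IntD (bS _ bg) bAq) (IntZ (- g q) (bS _ bA))
    -/(sdiff_Int _ _ _ _ _) -/(sdiff_Int _ _ _ _ _) JA; ring.
have bI1 := bounded_supportM (locally_bounded_cst (eps / (2 * (b - a)) * s))
  (bounded_support_indic a b).
have bI2 := bounded_supportM (locally_bounded_cst (4 * (eps / (16 * K))))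
  (bounded_support_indic (- (K * s)) (K * s)).
have Ks0 : 0 < K * s by rewrite mulr_gt0.
apply: le_trans (ler_norm_Int (bounded_supportD (bS _ bg) bAq)
  (bounded_supportD bI1 bI2) _) _; last first.
  rewrite (IntD bI1 bI2) !(IntZ _ (bounded_support_indic _ _)) !Int_indic;
    [|lra|lra].
  rewrite le_eqVlt; apply/orP; left; apply/eqP; field.
  by rewrite (gt_eqF K0) (gt_eqF ba).
move=> t; rewrite !interval_indicE.
have eps's : 0 <= eps / (2 * (b - a)) * s by rewrite mulr_ge0 ?ltW.
have e1' : 0 <= 4 * (eps / (16 * K)) by rewrite mulr_ge0// ltW.
have [/andP[a_t t_b]|_] := boolP (a <= t <= b); last first.
  by rewrite !mul0r !mulr0 addr0 normr0 add0r mulr_ge0.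
rewrite !mul1r !mulr1; rewrite -ler_norml.
have t_eta : `|t| < eta by rewrite ltr_norml; apply/andP; split; lra.
have [tK|Kt] := leP `|t| (K * s).
  rewrite mulr1.
  have t_rho : `|t| < rho by rewrite (le_lt_trans tK)// mulrC.
  have H u : `|u| <= s -> `|g (pt q u t)
    - g q * \1_A (pt q u t)| <= eps / (16 * K).
    by move=> us; apply: near_q; apply: near_rho => //;
      exact: le_lt_trans s_rho.
  have H1 : `|g (pt q s t) - g q * \1_A (pt q s t)| <= eps / (16 * K).
    by apply: H; rewrite gtr0_norm.
  have H2 : `|g (pt q (- s) t) - g q * \1_A (pt q (- s) t)| <= eps / (16 * K).
    by apply: H; rewrite normrN gtr0_norm.
  have H3 : `|g (pt q 0 t) - g q * \1_A (pt q 0 t)| <= eps / (16 * K).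
    by apply: H; rewrite normr0 ltW.
  rewrite /sdiff; move: H1 H2 H3 eps's.
  move: (g (pt q s t)) (g (pt q (- s) t)) (g (pt q 0 t)) => g1 g2 g3.
  move: (\1_A (pt q s t)) (\1_A (pt q (- s) t)) (\1_A (pt q 0 t)) => i1 i2 i3.
  move: (eps / (16 * K)) (eps / (2 * (b - a)) * s) => c1 c2.
  rewrite !ler_norml => /andP[? ?] /andP[? ?] /andP[? ?] ?; apply/andP; split;
    lra.
have bfree (u : R) : `|u| <= s -> ~ boundary A (pt q 0 t + u *: e).
  move=> us; rewrite -frame_ptE; apply: nb => //;
    first exact: le_lt_trans s_eta.
  by rewrite (le_lt_trans _ Kt)// ler_pM2l.
have I1 : (\1_A (pt q s t) : R) = \1_A (pt q 0 t).
  by rewrite (frame_ptE q s); apply: (segment_same_side bfree);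
    rewrite gtr0_norm.
have I2 : (\1_A (pt q (- s) t) : R) = \1_A (pt q 0 t).
  by rewrite (frame_ptE q (- s)); apply: (segment_same_side bfree);
    rewrite normrN gtr0_norm.
rewrite [X in _ + - g q * X](_ : _ = 0) ?mulr0 ?addr0;
  last by rewrite /sdiff I1 I2; ring.
have := Hf s (pt q 0 t) _ bfree; rewrite -scaleNr -!frame_ptE; apply.
by rewrite s0.
Qed.

End source.

End slice_asymptotics.

(** * Assembly of the expansion along a whole line *)

Section line_asymptotics.
Context {R : realType}.
Variables (x e w w' : R * R).
Hypotheses (xe : edot x e = 1) (xw : edot x w = 0) (w'w : edot w' w = 1)
  (w'e : edot w' e = 0) (frame : forall z, z = edot x z *: e + edot w' z *: w)
  (ew : w.1 * e.2 - e.1 * w.2 != 0).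
Implicit Types (g : R * R -> R) (p q y z : R * R).
Local Notation pt := (frame_pt e w).
Local Notation jump_on := (jump_on e w).

Lemma jump_on_shift g q (t0 a b j : R) : bounded_support2 g ->
  jump_on g (pt q 0 t0) (a - t0) (b - t0) j -> jump_on g q a b j.
Proof.
move=> bg J eps /J[d d0 H]; exists d => // s /H.
by rewrite (sdiff_Int_shift frame ew q s _ _ t0 bg) !subrK.
Qed.

(** Compactness of [[a0, b0]] in supremum form: [ts] is the furthest point that windows starting
    left of [a0] can pass. The local windows straddle their point because the expansion at a
    boundary point is only available for such windows. *)
Lemma jump_on_glue g p (a0 b0 : R) : bounded_support2 g -> a0 <= b0 ->
  (forall t, a0 <= t <= b0 -> exists2 eta, 0 < eta & forall a b,
     t - eta < a < t -> t < b < t + eta -> jump_on g p a b 0) ->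
  exists2 eta, 0 < eta & forall a b,
    a0 - eta < a < a0 -> b0 < b < b0 + eta -> jump_on g p a b 0.
Proof.
move=> bg ab0 good.
have [|eta0 eta00 good0] := good a0; first by rewrite lexx.
pose P (t eta : R) := forall a b, a0 - eta0 < a < a0 -> t < b < t + eta ->
  jump_on g p a b 0.
pose T : set R := [set t | a0 <= t <= b0 /\ exists2 eta, 0 < eta & P t eta].
have Ta : T a0 by split; [rewrite lexx|exists eta0 => // a b; exact: good0].
have hT : has_sup T.
  by split; [exists a0|exists b0 => t [/andP[]]].
pose ts := sup T.
have a0ts : a0 <= ts by apply: ub_le_sup => //; exact: hT.2.
have tsb0 : ts <= b0 by apply: ge_sup => [|t [/andP[]]//]; exists a0.
have Tts : T ts.
  split; first by rewrite a0ts.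
  have [|eta eta_gt0 H] := good ts; first by rewrite a0ts.
  have [t' [/andP[at' t'b] [eta' eta'0 Pt']]] := sup_adherent eta_gt0 hT;
    rewrite -/ts => t'ts.
  have t'le : t' <= ts.
    by apply: ub_le_sup; [exact: hT.2|split; [rewrite at'|exists eta']].
  have [t'E|t'lt] := eqVneq t' ts; first by exists eta' => //; rewrite -t'E.
  have {}t'lt : t' < ts by rewrite lt_neqAle t'lt.
  exists eta => // a b aI bI.
  (* A cut point in the overlap of the window already reached from [t'] and the local window around
     [ts]. *)
  pose b' := (t' + Num.min ts (t' + eta')) / 2.
  have m1 : Num.min ts (t' + eta') <= ts by rewrite ge_min lexx.
  have m2 : Num.min ts (t' + eta') <= t' + eta' by rewrite ge_min lexx orbT.
  have m3 : t' < Num.min ts (t' + eta') by rewrite lt_min t'lt ltrDl.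
  have /andP[aI1 aI2] := aI; have /andP[bI1 bI2] := bI.
  rewrite -[0](addr0 0); apply: (@jump_on_add _ _ _ _ _ frame ew g p a b' b)
    => //.
  - by rewrite /b'; lra.
  - by rewrite /b'; lra.
  - by apply: Pt' => //; rewrite /b'; apply/andP; split; lra.
  - by apply: H => //; rewrite /b'; apply/andP; split; lra.
have [_ [eta eta_gt0 Pts]] := Tts.
have [tsE|tsne] := eqVneq ts b0.
  exists (Num.min eta0 eta); first by rewrite lt_min eta00.
  move=> a b /andP[a1 a2] /andP[b1 b2].
  have m1 : Num.min eta0 eta <= eta0 by rewrite ge_min lexx.
  have m2 : Num.min eta0 eta <= eta by rewrite ge_min lexx orbT.
  by apply: Pts; rewrite ?tsE; apply/andP; split; lra.
have tslt : ts < b0 by rewrite lt_neqAle tsne.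
pose t2 := Num.min (ts + eta / 2) b0.
have t2b : t2 <= b0 by rewrite ge_min lexx orbT.
have t2e : t2 <= ts + eta / 2 by rewrite ge_min lexx.
have t2ts : ts < t2 by rewrite lt_min tslt andbT; lra.
have : T t2.
  split; first by rewrite t2b andbT; lra.
  exists (ts + eta - t2); first lra.
  by move=> a b aI /andP[b1 b2]; apply: Pts => //; apply/andP; split; lra.
by move=> /(ub_le_sup hT.2); rewrite -/ts leNgt t2ts.
Qed.

Section source.
Variables (M : nat) (Omega : 'I_M -> set (R * R)) (g : R * R -> R).
Local Notation A := (\bigcup_m Omega m).
Hypotheses (pO : forall m, polygonal (Omega m)) (cO : forall m,
  compact (Omega m))
  (dO : forall m m', m != m' -> Omega m `&` Omega m' = set0)
  (gC1 : forall m, directionally_C1 (Omega m) e g)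
  (gcont : forall m, {within Omega m, continuous g})
  (g0 : forall y, ~ A y -> g y = 0)
  (bg : bounded_support2 g) (bA : bounded_support2 (\1_A : R * R -> R)).

Lemma edot_frame_pt q s t : edot x (pt q s t) = edot x q + s.
Proof.
rewrite (_ : edot x _ = edot x q + (s * edot x e + t * edot x w)); last first.
  by rewrite /edot /pt !vecE; ring.
by rewrite xe xw mulr1 mulr0 addr0.
Qed.

Lemma edot'_frame_pt q s t : edot w' (pt q s t) = edot w' q + t.
Proof.
rewrite (_ : edot w' _ = edot w' q + (s * edot w' e + t * edot w' w));
  last first.
  by rewrite /edot /pt !vecE; ring.
by rewrite w'e w'w mulr1 mulr0 add0r.
Qed.

(** A ray inside the line ends at a corner of the line, necessarily [P], and strictly away from [q].
    So [q] is no corner, the opposite ray also lies in the line, and it would have to end at [P] as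
    well. *)
Lemma rays_transversal (B s0 : R) (P q d1 d2 : R * R) :
  (forall z, A z -> `|z| <= B) ->
  (forall Q, corners A Q -> edot x Q = s0 -> Q = P) -> edot x q = s0 ->
  boundary A q -> two_rays_at (boundary A) q d1 d2 -> edot x d1 != 0.
Proof.
move=> AB onlyP qs0 bq tr; have pA := polygonal_bigcup pO dO.
have [r [d10 d20 _ _ _]] := tr.
apply/eqP => xd1.
have xqd (d : R * R) t : edot x d = 0 -> edot x (q + t *: d) = s0.
  move=> xd; rewrite (_ : edot _ _ = edot x q + t * edot x d); last first.
    by rewrite /edot !vecE; ring.
  by rewrite xd mulr0 addr0.
have [t1 t10 c1] := ray_ends_at_corner pA AB bq tr.
have P1 := onlyP _ c1 (xqd _ _ xd1).
have qP : q <> P.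
  move=> qP; move/eqP: P1; rewrite -qP -[X in _ == X]addr0 (inj_eq (addrI q)).
  by rewrite scaler_eq0 (negbTE d10) gt_eqF.
have nc : ~ corners A q by move=> cq; apply: qP; exact: onlyP.
have [c c0 d2E] := noncorner_antiparallel pA bq tr nc.
have xd2 : edot x d2 = 0.
  have -> : edot x d2 = - c * edot x d1 by rewrite d2E /edot !vecE; ring.
  by rewrite xd1 mulr0.
have [t2 t20 c2] := ray_ends_at_corner pA AB bq (two_rays_swap tr).
have := onlyP _ c2 (xqd _ _ xd2); rewrite -P1 d2E => /addrI/eqP.
rewrite scalerA -subr_eq0 -scalerBl scaler_eq0 (negbTE d10) orbF => /eqP.
by have := mulr_gt0 t20 c0; lra.
Qed.

(** [P] is allowed to be off the line or no corner, so the same lemma serves a source with one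
    corner on the line and a source with none. *)
Lemma slice_second_difference (s0 : R) (P : R * R) :
  (forall Q, corners A Q -> edot x Q = s0 -> Q = P) ->
  exists J : R, [/\ forall eps, 0 < eps ->
    exists2 d, 0 < d & forall s, 0 < s < d ->
      `|slice g e w (s0 + s) + slice g e w (s0 - s)
        - 2 * slice g e w s0 - J * s| <= eps * s,
    corners A P -> edot x P = s0 -> g P != 0 -> J != 0 &
    (forall Q, corners A Q -> edot x Q <> s0) -> J = 0].
Proof.
move=> onlyP; have pA := polygonal_bigcup pO dO; have [clA _ trA] := pA.
have [B AB] : exists B : R, forall z, A z -> `|z| <= B.
  have [_ [C HC]] := bA; exists C => z Az; rewrite leNgt;
    apply/negP => /(HC z).2.
  by rewrite indicE mem_set// => /eqP; rewrite oner_eq0.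
pose p := s0 *: e.
have xp : edot x p = s0.
  have -> : edot x p = s0 * edot x e by rewrite /p /edot !vecE; ring.
  by rewrite xe mulr1.
have w'p : edot w' p = 0.
  have -> : edot w' p = s0 * edot w' e by rewrite /p /edot !vecE; ring.
  by rewrite w'e mulr0.
have [C [C0 HC]] : exists C : R, 0 <= C /\ forall u t, C < `|t| ->
  g (pt p u t) = 0.
  have [_ [C HC]] := bg; exists ((`|w'.1| + `|w'.2|) * C); split.
    by rewrite mulr_ge0 ?addr_ge0//; apply: le_trans (HC 0).1.
  move=> u t Ct; apply: (HC _).2; rewrite ltNge; apply: contraTN Ct => zC.
  have := norm_linear_form w'.1 w'.2 zC;
    rewrite -/(edot w' _) edot'_frame_pt w'p add0r.
  by rewrite -leNgt.
have full s a b : a < - C -> C < b -> sdiff_Int e w g p s a b =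
    slice g e w (s0 + s) + slice g e w (s0 - s) - 2 * slice g e w s0.
  move=> aC Cb.
  have B_ u := bounded_support_frame_pt frame ew p u bg.
  have NB := bounded_supportM (locally_bounded_cst (- 2)) (B_ 0).
  have sl u : slice g e w (s0 + u) = Int (fun t => g (pt p u t)).
    by apply: eq_Int => t; congr g; rewrite /pt /p; vec.
  rewrite sl (sl (- s)) -[X in _ - 2 * slice _ _ _ X](addr0 s0)
    sl -mulNr -(IntZ (- 2) (B_ 0)).
  rewrite -(IntD (B_ s) (B_ (- s))) -(IntD (bounded_supportD (B_ s)
    (B_ (- s))) NB).
  apply: eq_Int => t; rewrite interval_indicE mulNr /sdiff.
  have [//|nab] := boolP (a <= t <= b); first by rewrite mul1r.
  have Ct : C < `|t|.
    move: nab; rewrite negb_and -!ltNge => /orP[ta|bt].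
      by rewrite ltrNr in aC; rewrite -normrN (lt_le_trans _ (ler_norm _))//;
        lra.
    by rewrite (lt_le_trans _ (ler_norm _))//; lra.
  by rewrite !HC// mulr0 subr0 addr0 mul0r.
have off_P t : pt p 0 t <> P \/ ~ corners A P ->
  exists2 eta, 0 < eta & forall a b,
     t - eta < a < t -> t < b < t + eta -> jump_on g p a b 0.
  move=> qP; pose q := pt p 0 t.
  have xq : edot x q = s0 by rewrite edot_frame_pt xp addr0.
  have nc : ~ corners A q.
    move=> cq; have E := onlyP _ cq xq; case: qP; first by rewrite -E.
    by rewrite -E.
  have [bq|nb] := pselect (boundary A q); last first.
    have [eta eta0 H] := jump_off_boundary frame ew pO cO dO gC1 g0 bg nb.
    exists eta => // a b /andP[a1 a2] /andP[b1 b2].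
    by apply: (@jump_on_shift g p t) => //; apply: H; lra.
  have [d1 [d2 tr]] := trA _ bq.
  have xd1 := rays_transversal AB onlyP xq bq tr.
  have xd2 := rays_transversal AB onlyP xq bq (two_rays_swap tr).
  have [j [eta [eta0 _ /(_ nc) -> H]]] :=
    jump_at_boundary xe xw w'w w'e frame ew pO cO dO gC1 gcont g0 bg bA bq tr
      xd1 xd2.
  exists eta => // a b /andP[a1 a2] /andP[b1 b2].
  by apply: (@jump_on_shift g p t) => //; apply: H; lra.
(* Without a corner on the line, every point has jump 0 and gluing covers the support. Otherwise two
   glued stretches surround a window at [P]. *)
have [[cP xP]|nPl] := pselect (corners A P /\ edot x P = s0); last first.
  have good t : - C <= t <= C -> exists2 eta, 0 < eta & forall a b,
      t - eta < a < t -> t < b < t + eta -> jump_on g p a b 0.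
    move=> _; apply: off_P; have [cP|] := pselect (corners A P); last by right.
    by left=> E; apply: nPl; split=> //; rewrite -E edot_frame_pt xp addr0.
  have CC : - C <= C by lra.
  have [eta eta0 H] := jump_on_glue bg CC good.
  exists 0; split=> //; last by move=> cP xP; case: nPl.
  move=> eps eps0; have [|//|d d0 Hd] :=
    H (- C - eta / 2) (C + eta / 2) _ _ eps eps0.
  - by apply/andP; split; lra.
  - by apply/andP; split; lra.
  by exists d => // s /Hd; rewrite full//; lra.
have [d1 [d2 tr]] := trA _ cP.1.
have xd1 := rays_transversal AB onlyP xP cP.1 tr.
have xd2 := rays_transversal AB onlyP xP cP.1 (two_rays_swap tr).
have [j [eta [eta0 jP _ H]]] :=
  jump_at_boundary xe xw w'w w'e frame ew pO cO dO gC1 gcont g0 bg bA cP.1 tr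
    xd1 xd2.
exists j; split; [|by move=> _ _; exact: jP|by move=> /(_ _ cP)].
pose tP := edot w' P.
have PE : pt p 0 tP = P by rewrite /pt /p /tP [RHS]frame xP; vec.
have good t : t != tP -> exists2 eta, 0 < eta & forall a b,
    t - eta < a < t -> t < b < t + eta -> jump_on g p a b 0.
  move=> ttP; apply: off_P; left=> E; move/eqP: ttP; apply.
  by rewrite /tP -E edot'_frame_pt w'p add0r.
pose B1 := Num.max C (`|tP| + eta) + 1.
have B1C : C < B1 by rewrite ltr_pwDr// le_max lexx.
have B1t : `|tP| + eta < B1 by rewrite ltr_pwDr// le_max lexx orbT.
have := B1t; have := ler_norm tP; have := ler_norm (- tP);
  rewrite normrN => tP1 tP2 tP3.
have le1 : - B1 <= tP - eta / 2 by lra.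
have le2 : tP + eta / 2 <= B1 by lra.
have [eta1 eta10 H1] : exists2 eta1, 0 < eta1 & forall a b,
  - B1 - eta1 < a < - B1 ->
    tP - eta / 2 < b < tP - eta / 2 + eta1 -> jump_on g p a b 0.
  by apply: jump_on_glue => // t /andP[_ tt]; apply: good; apply/eqP => E; lra.
have [eta2 eta20 H2] : exists2 eta2, 0 < eta2 & forall a b,
  tP + eta / 2 - eta2 < a < tP + eta / 2 ->
    B1 < b < B1 + eta2 -> jump_on g p a b 0.
  by apply: jump_on_glue => // t /andP[tt _]; apply: good; apply/eqP => E; lra.
(* Chosen so that the cut points [b1] and [a1] fall inside the glued stretches and also on either
   side of [tP] within distance [eta]. *)
pose m1 := Num.min eta1 (eta / 2); pose m2 := Num.min eta2 (eta / 2).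
have m1a : m1 <= eta1 by rewrite ge_min lexx.
have m1b : m1 <= eta / 2 by rewrite ge_min lexx orbT.
have m10 : 0 < m1 by rewrite lt_min eta10 divr_gt0.
have m2a : m2 <= eta2 by rewrite ge_min lexx.
have m2b : m2 <= eta / 2 by rewrite ge_min lexx orbT.
have m20 : 0 < m2 by rewrite lt_min eta20 divr_gt0.
pose a := - B1 - eta1 / 2; pose b := B1 + eta2 / 2.
pose b1 := tP - eta / 2 + m1 / 2; pose a1 := tP + eta / 2 - m2 / 2.
have J1 : jump_on g p a b1 0.
  by apply: H1; apply/andP; split; rewrite /a /b1; lra.
have J2 : jump_on g p a1 b 0.
  by apply: H2; apply/andP; split; rewrite /a1 /b; lra.
have J3 : jump_on g p b1 a1 j.
  apply: (@jump_on_shift g p tP) => //; rewrite PE; apply: H; rewrite /b1 /a1;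
    lra.
have ab1 : a <= b1 by rewrite /a /b1; lra.
have b1a1 : b1 <= a1 by rewrite /b1 /a1; lra.
have a1b : a1 <= b by rewrite /a1 /b; lra.
have := jump_on_add frame ew bg (le_trans ab1 b1a1)
  a1b (jump_on_add frame ew bg ab1 b1a1 J1 J3) J2.
rewrite add0r addr0 => J eps /J[d d0 Hd]; exists d => // s /Hd.
by rewrite full// /a /b; lra.
Qed.

End source.

End line_asymptotics.

(** * Uniqueness *)

Section sources.
Context {R : realType}.
Local Notation T := (measurableTypeR R * measurableTypeR R)%type.
Implicit Types (g : R * R -> R) (f : R * R -> R[i]) (x y z P Q : R * R).

Lemma compact_norm_bound (K : set (R * R)) : compact K ->
  exists C : R, forall z, K z -> `|z| <= C.
Proof.
move=> cK; have [C [_ HC]] := compact_bounded cK.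
by exists (C + 1) => z; apply: HC; rewrite ltrDl.
Qed.

Lemma piecewise_continuous_bounded_support (M : nat) (Omega : 'I_M ->
  set (R * R)) g :
  (forall m, compact (Omega m)) ->
  (forall m m', m != m' -> Omega m `&` Omega m' = set0) ->
  (forall m, {within Omega m, continuous g}) ->
  (forall y, ~ (\bigcup_m Omega m) y -> g y = 0) -> bounded_support2 g.
Proof.
move=> cO dO gcont g0.
have clO m : closed (Omega m) by apply: compact_closed => //;
  exact: norm_hausdorff.
have mO m : measurable (Omega m : set T).
  by rewrite -(setCK (Omega m)); apply: measurableC; apply: open_measurable2;
    exact/closed_openC/clO.
split.
  have -> : g = fun y => \sum_(m < M) (g \_ (Omega m)) y.
    apply/funext => y; have [[m _ Om]|nA] := pselect ((\bigcup_m Omega m) y).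
      rewrite (bigD1 m)//= big1 ?addr0 => [|m' m'm];
        first by rewrite patchE mem_set.
      rewrite patchE memNset// => Om'.
      by have : (Omega m' `&` Omega m) y by []; rewrite dO.
    rewrite g0// big1// => m _; rewrite patchE; case: ifPn => // _; exact: g0.
  apply: measurable_sum => m; apply: (measurable_restrictT g (mO m)).1.
  exact: within_continuous_measurable2.
have [N HN] := choice (fun m => compact_norm_bound (cO m)).
have /choice[G HG] : forall m, exists C : R, forall y, Omega m y -> `|g y| <= C.
  move=> m; have := continuous_compact (gcont m) (cO m).
  move=> /compact_bounded[C [_ HC]]; exists (C + 1) => y Oy.
  by apply: (HC (C + 1)); [rewrite ltrDl|exists y].
pose S (h : 'I_M -> R) := \sum_(m < M) `|h m|.
have leS h m : h m <= S h.
  by rewrite /S (bigD1 m)//= (le_trans (ler_norm _))// lerDl sumr_ge0.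
have S0 h : 0 <= S h by rewrite sumr_ge0.
exists (S N + S G) => y; have [[m _ Om]|nA] := pselect ((\bigcup_m Omega m) y).
  split; first by rewrite (le_trans (HG _ _ Om))// (le_trans (leS G m))// lerDr.
  move=> Ny; have := HN _ _ Om; have := leS N m; have := S0 G; lra.
by rewrite g0// normr0 addr_ge0.
Qed.

Lemma bounded_support2_indic (K : set (R * R)) : compact K ->
  bounded_support2 (\1_K : R * R -> R).
Proof.
move=> cK; have clK : closed K by apply: compact_closed => //;
  exact: norm_hausdorff.
split.
  apply: measurable_indic; rewrite -(setCK K); apply: measurableC.
  by apply: open_measurable2; exact: closed_openC.
have [C HC] := compact_norm_bound cK; exists (`|C| + 1) => z; rewrite indicE.
have [|_] := boolP (z \in K); last by rewrite normr0 addr_ge0.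
rewrite inE => /HC zC; split; first by rewrite normr1 lerDr.
by have := ler_norm C; lra.
Qed.

Lemma Int2Z (c : R) g : bounded_support2 g ->
  Int2 (fun z => c * g z) = c * Int2 g.
Proof. by move=> /bounded_support2_integrable ?; exact: RintegralZl. Qed.

Definition far_real g x k (c : R -> R) :=
  Int2 (fun y => c (k * edot x y) * g y).

Lemma bounded_support2_cos x k g : bounded_support2 g ->
  bounded_support2 (fun y => cos (k * edot x y) * g y).
Proof. exact: (bounded_support2M x.1 x.2 (locally_bounded_cosl k)). Qed.

Lemma bounded_support2_sin x k g : bounded_support2 g ->
  bounded_support2 (fun y => sin (k * edot x y) * g y).
Proof. exact: (bounded_support2M x.1 x.2 (locally_bounded_sinl k)). Qed.

Lemma far_field_Re f x k :
  bounded_support2 (fun y => complex.Re (f y)) ->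
  bounded_support2 (fun y => complex.Im (f y)) ->
  complex.Re (far_field f x k) =
  far_real (fun y => complex.Re (f y))
    x k cos + far_real (fun y => complex.Im (f y)) x k sin.
Proof.
move=> bR bI; rewrite /far_real -Int2D;
  [|exact: bounded_support2_cos|exact: bounded_support2_sin].
rewrite /far_field /Cintegral /=; apply: eq_Rintegral => y _.
by rewrite /expiN; case: (f y) => a b /=; ring.
Qed.

Lemma far_field_Im f x k :
  bounded_support2 (fun y => complex.Re (f y)) ->
  bounded_support2 (fun y => complex.Im (f y)) ->
  complex.Im (far_field f x k) =
  far_real (fun y => complex.Im (f y))
    x k cos - far_real (fun y => complex.Re (f y)) x k sin.
Proof.
move=> bR bI; rewrite /far_real -Int2B;
  [|exact: bounded_support2_cos|exact: bounded_support2_sin].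
rewrite /far_field /Cintegral /=; apply: eq_Rintegral => y _.
by rewrite /expiN; case: (f y) => a b /=; ring.
Qed.

Lemma far_real_cosN g x k : far_real g (- x) k cos = far_real g x k cos.
Proof.
congr Int2; apply/funext => y.
by rewrite (_ : edot (- x) y = - edot x y) ?mulrN ?cosN// /edot !vecE; ring.
Qed.

Lemma far_real_sinN g x k : bounded_support2 g ->
  far_real g (- x) k sin = - far_real g x k sin.
Proof.
move=> bg; rewrite -[RHS]mulN1r /far_real.
rewrite -(Int2Z (-1) (bounded_support2_sin x k bg)); congr Int2;
  apply/funext => y.
have -> : edot (- x) y = - edot x y by rewrite /edot !vecE; ring.
by rewrite mulrN sinN mulNr mulN1r.
Qed.

(** Each far field value mixes a cosine transform of one component of [f] with a sine transform of
    the other. Replacing [x] by [-x] flips the sine part only, so the two observations separate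
    them. *)
Lemma far_field_eq f1 f2 x k :
  bounded_support2 (fun y => complex.Re (f1 y)) ->
  bounded_support2 (fun y => complex.Im (f1 y)) ->
  bounded_support2 (fun y => complex.Re (f2 y)) ->
  bounded_support2 (fun y => complex.Im (f2 y)) ->
  far_field f1 x k = far_field f2 x k ->
    far_field f1 (- x) k = far_field f2 (- x) k ->
  forall p : R[i] -> R, p = complex.Re (R := R) \/ p = complex.Im (R := R) ->
  forall c : R -> R, c = cos \/ c = sin ->
  far_real (fun y => p (f1 y)) x k c = far_real (fun y => p (f2 y)) x k c.
Proof.
move=> bR1 bI1 bR2 bI2 E E'.
have := congr1 (complex.Re (R := R)) E; have := congr1 (complex.Re (R := R)) E'.
have := congr1 (complex.Im (R := R)) E; have := congr1 (complex.Im (R := R)) E'.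
rewrite !far_field_Re// !far_field_Im// !far_real_cosN !far_real_sinN//.
by move=> e1 e2 e3 e4 p [] -> c [] ->; lra.
Qed.

(* A point [Q <> P] lies on the line through [P] orthogonal to [x i] for at most
   one [i]. *)
Lemma good_direction (L N : nat) (x : 'I_L -> R * R) (s : seq (R * R)) P :
  (forall i, unit_circle (x i)) -> (forall i j, i != j ->
    ~ collinear (x i) (x j)) ->
  P \in s -> (size s <= L)%N ->
  exists i, forall Q, Q \in s -> edot (x i) Q = edot (x i) P -> Q = P.
Proof.
move=> xu xc Ps sL; apply: contrapT => H.
have /choice[Q HQ] : forall i, exists Q,
    [/\ Q \in s, edot (x i) Q = edot (x i) P & Q <> P].
  move=> i; apply: contrapT => nQ; apply: H; exists i => Q Qs xQ.
  by apply: contrapT => QP; apply: nQ; exists Q.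
(* If one point served two directions, both would be orthogonal to the nonzero vector [Q i - P],
   hence collinear. *)
have Qinj : injective Q.
  move=> i j QE; apply/eqP; apply: contraT => ij; case: (xc i j ij).
  have [_ xi QP] := HQ i; have [_ xj _] := HQ j.
  have x0 : x i != 0.
    apply/eqP => xi0; have := xu i;
      rewrite /unit_circle/= /enorm xi0 /edot/= mulr0 addr0 sqrtr0.
    by move/eqP; rewrite eq_sym oner_eq0.
  have d0 : Q i - P != 0 by rewrite subr_eq0; apply/eqP.
  apply: det2_eq0 => //.
  have e1 : edot (x i) (Q i - P) = 0.
    by rewrite -(subrr (edot (x i) P)) -{1}xi /edot !vecE; ring.
  have e2 : edot (x j) (Q i - P) = 0.
    by rewrite -(subrr (edot (x j) P)) -{1}xj -QE /edot !vecE; ring.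
  apply/eqP; apply: contraT => D0; move/eqP: d0; case.
  move: e1 e2; rewrite /edot; set d := Q i - P => e1 e2.
  have D1 : det2 (x i) (x j) * d.1 = 0.
    have -> : det2 (x i) (x j) * d.1 = (x j).2 * ((x i).1 * d.1 + (x i).2 *
      d.2) -
        (x i).2 * ((x j).1 * d.1 + (x j).2 * d.2) by rewrite /det2; ring.
    by rewrite e1 e2 !mulr0 subrr.
  have D2 : det2 (x i) (x j) * d.2 = 0.
    have -> : det2 (x i) (x j) * d.2 = (x i).1 * ((x j).1 * d.1 + (x j).2 *
      d.2) -
        (x j).1 * ((x i).1 * d.1 + (x i).2 * d.2) by rewrite /det2; ring.
    by rewrite e1 e2 !mulr0 subrr.
  by apply: vec_eq; apply: (mulfI D0); rewrite mulr0.
(* Pigeonhole: [P] and the [L] distinct bad points would be [L + 1] elements of [s]. *)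
have : (size (P :: [seq Q i | i <- enum 'I_L]) <= size s)%N.
  apply: uniq_leq_size.
    rewrite /= (map_inj_uniq Qinj) enum_uniq andbT.
    by apply/mapP => -[i _ PE]; have [_ _] := HQ i; apply.
  by move=> z; rewrite inE => /orP[/eqP ->//|/mapP[i _ ->]]; have [] := HQ i.
by rewrite /= size_map size_enum_ord => /leq_trans/(_ sL); rewrite ltnn.
Qed.

End sources.

Section uniqueness.
Context {R : realType}.
Implicit Types (f : R * R -> R[i]) (P Q : R * R).

Lemma source_component f (M : nat) (Omega : 'I_M -> set (R * R)) (p : R[i] ->
  R) :
  source_assumption f Omega -> (forall m, polygon (Omega m)) ->
  p = complex.Re (R := R) \/ p = complex.Im (R := R) ->
  [/\ forall m, polygonal (Omega m), forall m, compact (Omega m),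
      forall m m', m != m' -> Omega m `&` Omega m' = set0,
      forall m, C1_on (Omega m) (fun y => p (f y)) &
      forall y, ~ (\bigcup_m Omega m) y -> p (f y) = 0].
Proof.
move=> [cs [[sE cO dO _ _] [_ [CR CI _]]]] pol pE; split=> //.
- by move=> m; exact: polygon_polygonal.
- by case: pE => ->.
- move=> y ny; have -> : f y = 0.
    apply/eqP; apply: contraT => fy; case: ny; rewrite -sE.
    by apply: subset_closure.
  by case: pE => ->.
Qed.

Lemma corners_sub (L : nat) (x : 'I_L -> R * R) (kmin kmax : R) f1 f2
    (M1 M2 : nat) (Omega1 : 'I_M1 -> set (R * R)) (Omega2 : 'I_M2 ->
      set (R * R))
    (N1 N2 : nat) :
  (forall i, unit_circle (x i)) -> (forall i j, i != j ->
    ~ collinear (x i) (x j)) ->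
  kmin < kmax ->
  source_assumption f1 Omega1 -> (forall m, polygon (Omega1 m)) ->
  (corners (supp f1) #= `I_N1)%card ->
  source_assumption f2 Omega2 -> (forall m, polygon (Omega2 m)) ->
  (corners (supp f2) #= `I_N2)%card -> (N1 + N2 <= L)%N ->
  (forall i k, k \in `]kmin, kmax[ ->
     far_field f1 (x i) k = far_field f2 (x i) k /\
     far_field f1 (- x i) k = far_field f2 (- x i) k) ->
  corners (supp f1) `<=` corners (supp f2).
Proof.
move=> xu xc kk S1 pol1 card1 S2 pol2 card2 NL far P cP1.
apply: contrapT => ncP2.
have fin1 : finite_set (corners (supp f1)) by exists N1.
have fin2 : finite_set (corners (supp f2)) by exists N2.
have enumeration (A : set (R * R)) n : finite_set A -> (A #= `I_n)%card ->
    exists2 s : seq (R * R), size s = n & forall Q, A Q -> Q \in s.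
  move=> fA An; exists (finmap.enum_fset (fset_set A));
    first exact: card_fset_set.
  by move=> Q AQ; have := in_fset_set fA Q; rewrite (mem_set AQ).
have [s1 size1 in1] := enumeration _ _ fin1 card1.
have [s2 size2 in2] := enumeration _ _ fin2 card2.
have [i Hi] : exists i, forall Q, Q \in s1 ++ s2 ->
  edot (x i) Q = edot (x i) P -> Q = P.
  apply: good_direction => //; first by rewrite mem_cat in1.
  by rewrite size_cat size1 size2.
have only1 Q : corners (supp f1) Q -> edot (x i) Q = edot (x i) P -> Q = P.
  by move=> /in1 Q1; apply: Hi; rewrite mem_cat Q1.
have none2 Q : corners (supp f2) Q -> edot (x i) Q <> edot (x i) P.
  move=> cQ xQ; apply: ncP2; rewrite -(_ : Q = P)//.
  by apply: Hi => //; rewrite mem_cat in2// orbT.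
(* [f1] does not vanish on the boundary, so its real or imaginary part is nonzero at [P]; the rest
   works with that real function. *)
have [p pE pP] : exists2 p : R[i] -> R,
    p = complex.Re (R := R) \/ p = complex.Im (R := R) & p (f1 P) != 0.
  have : f1 P != 0 by case: S1 => _ [_ [_ [_ _]]]; apply; exact: cP1.1.
  case: (f1 P) => a b; rewrite eq_complex/= negb_and => /orP[a0|b0].
    by exists (complex.Re (R := R)); [left|].
  by exists (complex.Im (R := R)); [right|].
have bs f (M : nat) (Omega : 'I_M -> set (R * R)) q :
    source_assumption f Omega -> (forall m, polygon (Omega m)) ->
    q = complex.Re (R := R) \/ q = complex.Im (R := R) ->
    bounded_support2 (fun y => q (f y)).
  move=> S pol qE; have [_ cO dO C1 g0] := source_component S pol qE.
  by apply: (piecewise_continuous_bounded_support cO dO) => // m;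
    have [? [? []]] := C1 m.
have [e [w [w' [c [[xe xw ew c0] frame [w'w w'e] axis radon]]]]] :=
  radon_frame (xu i).
have jump f (M : nat) (Omega : 'I_M -> set (R * R)) :
    source_assumption f Omega -> (forall m, polygon (Omega m)) ->
    (forall Q, corners (supp f) Q -> edot (x i) Q = edot (x i) P -> Q = P) ->
    exists J : R, [/\ forall eps, 0 < eps ->
      exists2 d, 0 < d & forall s, 0 < s < d ->
      let G := slice (fun y => p (f y)) e w in
      `|G (edot (x i) P + s) + G (edot (x i) P - s) - 2 * G (edot (x i) P)
        - J * s| <= eps * s,
    corners (supp f) P -> p (f P) != 0 -> J != 0 &
    (forall Q, corners (supp f) Q -> edot (x i) Q <> edot (x i) P) -> J = 0].
  move=> S pol only; have [pO cO dO C1 g0] := source_component S pol pE.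
  have sE : supp f = \bigcup_m Omega m by case: S => _ [[]].
  have gC1 m : directionally_C1 (Omega m) e (fun y => p (f y)).
    by have [a _ eE] := axis; exact: C1_on_directionally (C1 m) eE.
  have gcont m : {within Omega m, continuous (fun y => p (f y))}.
    by have [? [? []]] := C1 m.
  have bA : bounded_support2 (\1_(\bigcup_m Omega m) : R * R -> R).
    by apply: bounded_support2_indic; rewrite -sE; case: S.
  move: only; rewrite sE => only.
  have [J [HJ J1 J2]] := slice_second_difference xe xw w'w w'e frame ew pO cO
    dO gC1
    gcont g0 (bs _ _ _ _ S pol pE) bA only.
  by exists J; split=> // cP pf; exact: J1.
have [J1 [HJ1 J10 _]] := jump _ _ _ S1 pol1 only1.
(* The second source has no corner on this line, so the uniqueness condition holds vacuously and the
   jump is 0. *)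
have [J2 [HJ2 _ J20]] := jump _ _ _ S2 pol2 (fun Q cQ xQ => False_ind _ (none2
  Q cQ xQ)).
have {}J10 := J10 cP1 pP; have {}J20 := J20 none2.
pose g1 y := p (f1 y); pose g2 y := p (f2 y).
have b1 : bounded_support2 g1 by exact: bs S1 pol1 pE.
have b2 : bounded_support2 g2 by exact: bs S2 pol2 pE.
have bs1 := bounded_support_slice ew b1;
  have bs2 := bounded_support_slice ew b2.
pose H s := slice g1 e w s + -1 * slice g2 e w s.
have bNs2 := bounded_supportM (locally_bounded_cst (-1)) bs2.
have nH : fourier_null kmin kmax H.
  split=> [|k kI]; first exact: bounded_supportD.
  have kin : k \in `]kmin, kmax[ by rewrite in_itv.
  have [E E'] := far i k kin.
  have FE := far_field_eq (bs _ _ _ _ S1 pol1 (or_introl erefl))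
    (bs _ _ _ _ S1 pol1 (or_intror erefl))
    (bs _ _ _ _ S2 pol2 (or_introl erefl))
      (bs _ _ _ _ S2 pol2 (or_intror erefl)) E E' pE.
  have main (u : R -> R) : u = cos \/ u = sin ->
    locally_bounded (fun s => u (k * s)) ->
      Int (fun s => u (k * s) * H s) = 0.
    move=> uE bu; have := FE u uE; rewrite /far_real.
    rewrite (radon g1 (fun s => u (k * s)))// (radon g2 (fun s => u (k * s)))//.
    move=> /(mulfI (lt0r_neq0 c0)) E12.
    transitivity (Int (fun s => u (k * s) * slice g1 e w s + -1 * (u (k * s)
      * slice g2 e w s))).
      by apply: eq_Int => s; rewrite /H; ring.
    have B1 := bounded_supportM bu bs1; have B2 := bounded_supportM bu bs2.
    have NB2 := bounded_supportM (locally_bounded_cst (-1)) B2.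
    by rewrite (IntD B1 NB2) (IntZ (-1) B2) E12 mulN1r subrr.
  split; apply: main; [by left|exact: locally_bounded_cosl|by right|exact:
    locally_bounded_sinl].
have : J1 - J2 = 0.
  apply: (fourier_null_no_jump kk nH (s0 := edot (x i) P)) => eps eps0.
  have eps2 : 0 < eps / 2 by lra.
  have [d1 d10 H1] := HJ1 _ eps2; have [d2 d20 H2] := HJ2 _ eps2.
  exists (Num.min d1 d2); first by rewrite lt_min d10.
  move=> u; rewrite lt_min => /andP[u0 /andP[u1 u2]].
  have := H1 u; rewrite u0 u1 => /(_ isT) /= K1.
  have := H2 u; rewrite u0 u2 => /(_ isT) /= K2.
  rewrite -/g1 -/g2 in K1 K2; rewrite /H; clear -K1 K2.
  move: (slice g1 e w _) (slice g1 e w _) (slice g1 e w _) K1 => a1 a2 a3 K1.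
  move: (slice g2 e w _) (slice g2 e w _) (slice g2 e w _) K2 => c1 c2 c3 K2.
  move: K1 K2; rewrite !ler_norml => /andP[? ?] /andP[? ?].
  by apply/andP; split; lra.
by rewrite J20 subr0 => /eqP; rewrite (negbTE J10).
Qed.

End uniqueness.

Theorem theorem3p4 (R : realType) (L : nat) (x : 'I_L -> R * R)
    (kmin kmax : R) (f1 f2 : R * R -> R[i]) (M1 M2 : nat)
    (Omega1 : 'I_M1 -> set (R * R)) (Omega2 : 'I_M2 -> set (R * R))
    (N1 N2 : nat) :
  (forall i, unit_circle (x i)) ->
  (forall i j, i != j -> ~ collinear (x i) (x j)) ->
  0 < kmin -> kmin < kmax ->
  source_assumption f1 Omega1 ->
  (forall m, polygon (Omega1 m) /\ simply_connected (Omega1 m)) ->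
  (corners (supp f1) #= `I_N1)%card ->
  2 * N1%:Z - 1 < L%:Z ->
  source_assumption f2 Omega2 ->
  (forall m, polygon (Omega2 m) /\ simply_connected (Omega2 m)) ->
  (corners (supp f2) #= `I_N2)%card ->
  2 * N2%:Z - 1 < L%:Z ->
  (forall i k, k \in `]kmin, kmax[ ->
     far_field f1 (x i) k = far_field f2 (x i) k /\
     far_field f1 (- x i) k = far_field f2 (- x i) k) ->
  corners (supp f1) = corners (supp f2).
Proof.
move=> xu xc _ kk S1 pol1 card1 L1 S2 pol2 card2 L2 far.
(* Over the integers the two bounds say [2 N1 <= L] and [2 N2 <= L]; their average is the claim. *)
have NL : (N1 + N2 <= L)%N by lia.
have p1 m : polygon (Omega1 m) by case: (pol1 m).
have p2 m : polygon (Omega2 m) by case: (pol2 m).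
apply/seteqP; split.
  exact: (corners_sub xu xc kk S1 p1 card1 S2 p2 card2 NL far).
apply: (corners_sub xu xc kk S2 p2 card2 S1 p1 card1); first by rewrite addnC.
by move=> i k kI; have [-> ->] := far i k kI.
Qed.
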